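(* Let $0<p<1$, $q=1-p$, $N\ge 1$, and let $c$ be the counterclockwise circle centered at the origin with radius $r$ satisfying $$0<r<\frac{-1+\sqrt{1+4pq}}{2q}.$$ Let $Y=(y_1,\dots,y_N)\in\mathbb{Z}^N$ with $y_1<\cdots<y_N$, $X=(x_1,\dots,x_N)\in\mathbb{Z}^N$ with $x_1<\cdots<x_N$, and $t\ge 0$. Then the $N^N\times N^N$ transition matrix $\mathbf{P}_Y(X;t)$ of the $N$-particle multi-species ASEP is given by $$\mathbf{P}_Y(X;t)=\frac{1}{(2\pi i)^N}\int_c\cdots\int_c\sum_{\sigma\in S_N}\mathbf{A}_\sigma\prod_{i=1}^N\Big(\xi_{\sigma(i)}^{x_i-y_{\sigma(i)}-1}e^{\varepsilon(\xi_i)t}\Big)\,d\xi_1\cdots d\xi_N,$$ where $\varepsilon(\xi)=\frac{p}{\xi}+q\xi-1$ and the integral is taken entrywise.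
   Context: Multi-species ASEP: $N$ particles on $\mathbb{Z}$, each belonging to a species in $\{1,\dots,N\}$, at most one particle per site (an empty site is regarded as species $0$). Each particle, after an exponential waiting time of rate $1$, chooses to jump to the right neighbour with probability $p$ or to the left neighbour with probability $q=1-p$; if the target site holds a particle of species $l'\ge l$ (where $l$ is the jumping particle's species) the jump is suppressed, and if $l'<l$ (including empty sites) the two exchange positions. A state is $(X,\pi)$ with $X=(x_1<\cdots<x_N)$ the positions and $\pi=\pi_1\cdots\pi_N$ the word of species of the particles from left to right. $P_{(Y,\nu)}(X,\pi;t)$ is the probability that the state is $(X,\pi)$ at time $t$ given initial state $(Y,\nu)$. $\mathbf{P}_Y(X;t)$ is the $N^N\times N^N$ matrix whose rows and columns are indexed by words of length $N$ over $\{1,\dots,N\}$ in lexicographic order, with $(\pi,\nu)$ entry $P_{(Y,\nu)}(X,\pi;t)$. For nonzero complex $\xi_\alpha,\xi_\beta$ set $D=p+q\xi_\alpha\xi_\beta-\xi_\alpha$ and $S_{\beta\alpha}=-\frac{p+q\xi_\alpha\xi_\beta-\xi_\beta}{D}$, $P_{\beta\alpha}=\frac{(p-q\xi_\alpha)(\xi_\beta-1)}{D}$, $Q_{\beta\alpha}=\frac{(p-q\xi_\beta)(\xi_\alpha-1)}{D}$, $T_{\beta\alpha}=\frac{\xi_\beta-\xi_\alpha}{D}$. $\mathbf{R}_{\beta\alpha}$ is the $N^2\times N^2$ matrix with rows and columns indexed by two-letter words over $\{1,\dots,N\}$ (lexicographic order) and entries: $[\mathbf{R}_{\beta\alpha}]_{ij,kl}=S_{\beta\alpha}$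 if $kl=ij$ and $i=j$; $=P_{\beta\alpha}$ if $kl=ij$ and $i<j$; $=Q_{\beta\alpha}$ if $kl=ij$ and $i>j$; $=pT_{\beta\alpha}$ if $kl=ji$ and $i<j$; $=qT_{\beta\alpha}$ if $kl=ji$ and $i>j$; $=0$ otherwise. Tensor products are Kronecker products with lexicographic indexing, and for $1\le l\le N-1$, $\mathbf{T}_l(\beta,\alpha)=\mathbf{I}_N^{\otimes(l-1)}\otimes\mathbf{R}_{\beta\alpha}\otimes\mathbf{I}_N^{\otimes(N-l-1)}$. For $\sigma\in S_N$ (written as the word $\sigma(1)\cdots\sigma(N)$), let $T_i$ act by swapping the entries in positions $i,i+1$. Write $\sigma=T_{a_n}\cdots T_{a_1}$ (applied to the identity) for some sequence $a_1,\dots,a_n\in\{1,\dots,N-1\}$, put $\sigma^{(0)}=\mathrm{Id}$, $\sigma^{(k)}=T_{a_k}\cdots T_{a_1}$, and define $$\mathbf{A}_\sigma=\mathbf{T}_{a_n}\big(\sigma^{(n-1)}(a_n+1),\sigma^{(n-1)}(a_n)\big)\cdots\mathbf{T}_{a_1}\big(\sigma^{(0)}(a_1+1),\sigma^{(0)}(a_1)\big),$$ with $\mathbf{A}_{\mathrm{Id}}=\mathbf{I}_{N^N}$; here $\mathbf{T}_l(\beta,\alpha)$ uses $\mathbf{R}_{\beta\alpha}$ with variables $\xi_\beta,\xi_\alpha$. This matrix does not depend on the chosen sequence. *)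

(* Defs.v *)
From Stdlib Require Import Reals ZArith List Sorted Bool Arith Lia.
From Coquelicot Require Import Coquelicot.
Import ListNotations.
Open Scope R_scope.

(* A state (X, pi): positions x_1 < ... < x_N (list Z) and species word pi_1 ... pi_N. *)
Definition state := (list Z * list nat)%type.

Definition state_eqb (s s' : state) : bool :=
  if list_eq_dec Z.eq_dec (fst s) (fst s') then
    if list_eq_dec Nat.eq_dec (snd s) (snd s') then true else false
  else false.

Definition replace_at {A} (k : nat) (v : A) (l : list A) : list A :=
  firstn k l ++ v :: skipn (S k) l.

(* T_i : swap the entries in (1-indexed) positions i and i+1 *)
Definition swap_at (i : nat) (w : list nat) : list nat :=
  firstn (i - 1) w ++ [nth i w 0%nat; nth (i - 1) w 0%nat] ++ skipn (S i) w.

(* All possible (rate, new state) jumps out of state s.  Particle k (0-indexed)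
   rings at rate 1, chooses right w.p. p, left w.p. q = 1 - p.  A jump onto an
   empty site moves the particle; a jump onto a neighbour of strictly lower
   species exchanges the two particles (positions unchanged, species swapped);
   otherwise the jump is suppressed (no transition). *)
Definition moves (p : R) (s : state) : list (R * state) :=
  let (X, pi) := s in
  let n := length X in
  flat_map (fun k =>
    let x := nth k X 0%Z in
    let l := nth k pi 0%nat in
    (if ((S k <? n)%nat && (nth (S k) X 0%Z =? x + 1)%Z)%bool then
       (if (nth (S k) pi 0%nat <? l)%nat then [(p, (X, swap_at (S k) pi))] else [])
     else [(p, (replace_at k (x + 1)%Z X, pi))])
    ++
    (if ((0 <? k)%nat && (nth (k - 1) X 0%Z =? x - 1)%Z)%bool then
       (if (nth (k - 1) pi 0%nat <? l)%nat then [(1 - p, (X, swap_at k pi))] else [])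
     else [(1 - p, (replace_at k (x - 1)%Z X, pi))]))
  (seq 0 n).

(* Entries of Q^n, Q the generator: Q(s,s'') = rate, Q(s,s) = - total rate. *)
Fixpoint Qpow (p : R) (n : nat) (s s' : state) : R :=
  match n with
  | O => if state_eqb s s' then 1 else 0
  | S m => fold_right (fun (mv : R * state) acc =>
             fst mv * (Qpow p m (snd mv) s' - Qpow p m s s') + acc) 0 (moves p s)
  end.

(* Transition probability P_{s}(s';t) = (exp(tQ))_{s,s'} (bounded rates). *)
Definition asep_prob (p t : R) (s s' : state) : R :=
  Series (fun n => t ^ n / INR (fact n) * Qpow p n s s').

Fixpoint words_len (m N : nat) : list (list nat) :=
  match m with
  | O => [[]]
  | S m' => flat_map (fun a => map (cons a) (words_len m' N)) (seq 1 N)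
  end.

Definition words (N : nat) := words_len N N.

(* sigma in S_N, written as the word sigma(1)...sigma(N) *)
Definition is_permb (N : nat) (w : list nat) : bool :=
  forallb (fun a => existsb (Nat.eqb a) w) (seq 1 N).

Definition perms (N : nat) : list (list nat) := filter (is_permb N) (words N).

(* N^N x N^N complex matrices, rows/columns indexed by words *)
Definition mat := list nat -> list nat -> C.

Definition csum {A} (l : list A) (f : A -> C) : C :=
  fold_right (fun a acc => Cplus (f a) acc) (RtoC 0) l.
Definition cprod {A} (l : list A) (f : A -> C) : C :=
  fold_right (fun a acc => Cmult (f a) acc) (RtoC 1) l.

Definition mmul (N : nat) (A B : mat) : mat :=
  fun w w' => csum (words N) (fun u => Cmult (A w u) (B u w')).

Definition mid : mat :=
  fun w w' => if list_eq_dec Nat.eq_dec w w' then RtoC 1 else RtoC 0.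

(* [R_{beta alpha}]_{ij,kl} with xb = xi_beta, xa = xi_alpha *)
Definition Rentry (p : R) (xb xa : C) (i j k l : nat) : C :=
  let q := RtoC (1 - p) in
  let pc := RtoC p in
  let D := Cminus (Cplus pc (Cmult q (Cmult xa xb))) xa in
  let S_ := Copp (Cdiv (Cminus (Cplus pc (Cmult q (Cmult xa xb))) xb) D) in
  let P_ := Cdiv (Cmult (Cminus pc (Cmult q xa)) (Cminus xb (RtoC 1))) D in
  let Q_ := Cdiv (Cmult (Cminus pc (Cmult q xb)) (Cminus xa (RtoC 1))) D in
  let T_ := Cdiv (Cminus xb xa) D in
  if ((k =? i) && (l =? j))%nat then
    (if (i =? j)%nat then S_ else if (i <? j)%nat then P_ else Q_)
  else if ((k =? j) && (l =? i))%nat then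
    (if (i <? j)%nat then Cmult pc T_ else Cmult q T_)
  else RtoC 0.

(* T_l(beta,alpha) = I^{(l-1)} (x) R_{beta alpha} (x) I^{(N-l-1)}, entrywise *)
Definition Tmat (p : R) (N : nat) (xi : nat -> C) (l beta alpha : nat) : mat :=
  fun w w' =>
    Cmult (Rentry p (xi beta) (xi alpha)
             (nth (l - 1) w 0%nat) (nth l w 0%nat) (nth (l - 1) w' 0%nat) (nth l w' 0%nat))
          (if forallb (fun k => orb (orb (Nat.eqb k (l - 1)) (Nat.eqb k l))
                                   (Nat.eqb (nth k w 0%nat) (nth k w' 0%nat)))
                      (seq 0 N)
           then RtoC 1 else RtoC 0).

Definition apply_seq (a : list nat) (w : list nat) : list nat :=
  fold_left (fun tau ak => swap_at ak tau) a w.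

(* A for the sequence a = [a_1; ...; a_n]:
   T_{a_n}(s^(n-1)(a_n+1), s^(n-1)(a_n)) ... T_{a_1}(s^(0)(a_1+1), s^(0)(a_1)) *)
Definition Amat_seq (p : R) (N : nat) (xi : nat -> C) (a : list nat) : mat :=
  snd (fold_left (fun (st : list nat * mat) ak =>
         let (tau, M) := st in
         (swap_at ak tau,
          mmul N (Tmat p N xi ak (nth ak tau 0%nat) (nth (ak - 1) tau 0%nat)) M))
       a (seq 1 N, mid)).

Definition valid_decomp (N : nat) (dec : list nat -> list nat) : Prop :=
  forall sigma, In sigma (perms N) ->
    List.Forall (fun a => (1 <= a <= N - 1)%nat) (dec sigma) /\
    apply_seq (dec sigma) (seq 1 N) = sigma.

Definition cexp (z : C) : C :=
  Cmult (RtoC (exp (Re z))) (cos (Im z), sin (Im z)).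

Definition zpowC (z : C) (k : Z) : C :=
  if (0 <=? k)%Z then pow_n (K := C_Ring) z (Z.to_nat k)
  else Cinv (pow_n (K := C_Ring) z (Z.to_nat (- k))).

Definition epsC (p : R) (xi : C) : C :=
  Cminus (Cplus (Cdiv (RtoC p) xi) (Cmult (RtoC (1 - p)) xi)) (RtoC 1).

Definition circle_int (r : R) (f : C -> C) : C :=
  RInt (V := C_R_CompleteNormedModule)
    (fun th => Cmult (f (Cmult (RtoC r) (cos th, sin th)))
                     (Cmult Ci (Cmult (RtoC r) (cos th, sin th))))
    0 (2 * PI).

Definition upd_env (env : nat -> C) (i : nat) (z : C) : nat -> C :=
  fun j => if (j =? i)%nat then z else env j.

Fixpoint circle_int_n (r : R) (k : nat) (f : (nat -> C) -> C) (env : nat -> C) : C :=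
  match k with
  | O => f env
  | S k' => circle_int r (fun z => circle_int_n r k' f (upd_env env (S k') z))
  end.

Definition integrand (p t : R) (N : nat) (dec : list nat -> list nat)
    (X Y : list Z) (pi nu : list nat) (xi : nat -> C) : C :=
  csum (perms N) (fun sigma =>
    Cmult (Amat_seq p N xi (dec sigma) pi nu)
      (cprod (seq 1 N) (fun i =>
         let si := nth (i - 1) sigma 0%nat in
         Cmult (zpowC (xi si) (nth (i - 1) X 0%Z - nth (si - 1) Y 0%Z - 1)%Z)
               (cexp (Cmult (epsC p (xi i)) (RtoC t)))))).

(* Main.v *)
(** Row vectors multiplied from the right by [T_k(k+1,k)], followed by the
    exchange of [xi_k] and [xi_(k+1)], define operators [rho_k] satisfying the
    Coxeter relations of the symmetric group (the braid relation is the
    Yang-Baxter equation).  Hence the row [pi] of the sum of the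
    [A_sigma xi_(sigma(1))^x_1 ... xi_(sigma(N))^x_N] is a symmetrisation, whatever
    decompositions are chosen, and it is invariant under every [rho_k].

    Multiplying the integrand by [E = sum_i eps(xi_i)] amounts to applying the
    generator: for free particles this is immediate, and the two-particle
    boundary conditions hold because the corresponding integrand is antisymmetric
    in [xi_k, xi_(k+1)].  Invariance of the symmetrisation gives the backward
    equation in [(Y, nu)] when [rho_k] is applied after it, and the forward equation
    in [(X, pi)] when [rho_k] is applied before it.

    The small radius makes every denominator the sum of a geometric series, so
    that [A_sigma] is analytic in the polydisc and the contour integrals extract
    coefficients.  At [t = 0] this makes the integral vanish unless
    [sum x <= sum y] and [x_N <= y_N].  Its difference [K] from the identity
    commutes with the generator; by induction on [sum (y - x) + (y_N - x_N)] this
    gives [K(Y, X) = K(Y + e_N, X + e_N)], and once [x_N > y_(N-1)] only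
    permutations fixing [N] contribute and the last particle decouples.

    Therefore inserting [E^m] in the integrand produces the [m]-th power of the
    generator, and summing the exponential series, uniformly convergent on the
    torus, finishes the proof. *)

Require Import Defs.
From Stdlib Require Import Reals ZArith List Sorted Bool Lia Lra.
From Stdlib Require Import Permutation FunctionalExtensionality ClassicalEpsilon.
From Coquelicot Require Import Coquelicot.
Import ListNotations.
Open Scope R_scope.
Local Open Scope C_scope.

(** Iterated Riemann integrals are total functions here, meaningful only on integrable arguments,
    and exchanging their order would call for Fubini. Both difficulties are avoided by admitting
    only integrands that are uniform limits of Laurent polynomials on the torus: their integral is
    the limit of the coefficients of [1/(xi_1 ... xi_n)], so linearity, symmetry in the variables
    and Cauchy's theorem become statements about finite lists of coefficients. The algebra rests on
    writing each two-site matrix as [S + T H], where [H] is the exchange generator of the two sites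
    and satisfies Hecke relations; the entries [P] and [Q] are [S - q T] and [S - p T]. Independence
    of the decomposition also needs that the Coxeter relations suffice to present the symmetric
    group, which a normal form provides. The obstacle is [t = 0], where the terms of the sum over
    permutations need not vanish one by one. What replaces a direct computation is that the backward
    and forward generators have the same effect, both inserting one factor [E]; this propagates
    known zeros to all pairs of configurations. *)

Ltac eqC := match goal with |- ?a = ?b => change (@eq C a b) end.

(** * Finite sums of complex numbers *)

Lemma csum_app {A} (l l' : list A) f : csum (l ++ l') f = csum l f + csum l' f.
Proof. induction l as [|a l IH]; simpl; [|rewrite IH]; ring. Qed.

Lemma csum_map {A B} (g : A -> B) (l : list A) f :
  csum (map g l) f = csum l (fun a => f (g a)).
Proof. induction l as [|a l IH]; simpl; [|rewrite IH]; reflexivity. Qed.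

Lemma csum_ext {A} (l : list A) f g :
  (forall a, In a l -> f a = g a) -> csum l f = csum l g.
Proof.
  induction l as [|a l IH]; simpl; intros H; [reflexivity|].
  rewrite H, IH; auto.
Qed.

Lemma csum_plus {A} (l : list A) f g :
  csum l (fun a => f a + g a) = csum l f + csum l g.
Proof. induction l as [|a l IH]; simpl; [|rewrite IH]; ring. Qed.

Lemma csum_scal {A} (l : list A) c f : csum l (fun a => c * f a) = c * csum l f.
Proof. induction l as [|a l IH]; simpl; [|rewrite IH]; ring. Qed.

Lemma csum_zero {A} (l : list A) (f : A -> C) : (forall a, In a l -> f a = 0) -> csum l f = 0.
Proof.
  induction l as [|a l IH]; simpl; intros H; [reflexivity|].
  rewrite H, IH; auto; ring.
Qed.

Lemma csum_Permutation {A} (l l' : list A) f :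
  Permutation l l' -> csum l f = csum l' f.
Proof. induction 1; simpl; try congruence; ring. Qed.

Lemma csum_flat_map {A B} (g : A -> list B) (l : list A) f :
  csum (flat_map g l) f = csum l (fun a => csum (g a) f).
Proof. induction l as [|a l IH]; simpl; [|rewrite csum_app, IH]; reflexivity. Qed.

Lemma csum_filter {A} (l : list A) (b : A -> bool) f :
  csum l f = csum (filter b l) f + csum (filter (fun a => negb (b a)) l) f.
Proof.
  induction l as [|a l IH]; simpl; [ring|].
  destruct (b a); simpl; rewrite IH; ring.
Qed.

Lemma csum_swap {A B} (l : list A) (l' : list B) f :
  csum l (fun a => csum l' (fun b => f a b)) = csum l' (fun b => csum l (fun a => f a b)).
Proof.
  induction l as [|a l IH]; simpl.
  - symmetry; apply csum_zero; reflexivity.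
  - rewrite IH, <- csum_plus; reflexivity.
Qed.

(** * Contour integrals of Laurent polynomials *)

Lemma pow_n_Cpow (z : C) n : pow_n (K := C_Ring) z n = z ^ n.
Proof. induction n as [|n IH]; simpl; [|rewrite IH]; reflexivity. Qed.

Lemma zpowC_nat z n : zpowC z (Z.of_nat n) = z ^ n.
Proof.
  unfold zpowC. destruct (Z.leb_spec 0 (Z.of_nat n)); [|lia].
  rewrite Nat2Z.id; apply pow_n_Cpow.
Qed.

Lemma zpowC_neg z n : zpowC z (- Z.of_nat n) = / z ^ n.
Proof.
  unfold zpowC. destruct (Z.leb_spec 0 (- Z.of_nat n)).
  - replace n with 0%nat by lia. simpl. change (one : C) with (RtoC 1). field.
  - rewrite Z.opp_involutive, Nat2Z.id, pow_n_Cpow. reflexivity.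
Qed.

Lemma zpowC_0 z : zpowC z 0 = 1.
Proof. apply (zpowC_nat z 0). Qed.

Lemma zpowC_succ (z : C) k : z <> 0 -> zpowC z (k + 1) = zpowC z k * z.
Proof.
  intros Hz. destruct (Z_le_gt_dec 0 k) as [H|H].
  - replace k with (Z.of_nat (Z.to_nat k)) by lia.
    replace (Z.of_nat (Z.to_nat k) + 1)%Z with (Z.of_nat (S (Z.to_nat k))) by lia.
    rewrite !zpowC_nat. simpl. ring.
  - destruct (Z.to_nat (- k)) as [|m] eqn:E; [lia|].
    replace k with (- Z.of_nat (S m))%Z by lia.
    replace (- Z.of_nat (S m) + 1)%Z with (- Z.of_nat m)%Z by lia.
    rewrite !zpowC_neg. simpl. field. auto using Cpow_nz.
Qed.

(** The recursion determines a two-sided sequence up to its value at 0, so each law of integer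
    powers follows by checking that both sides obey it, with no case analysis on signs. *)
Lemma zpowC_unique (z : C) (g : Z -> C) :
  z <> 0 -> (forall k, g (k + 1)%Z = g k * z) -> forall k, g k = g 0%Z * zpowC z k.
Proof.
  intros Hz Hg. apply Z.peano_ind.
  - rewrite zpowC_0. ring.
  - intros k IH. unfold Z.succ. rewrite Hg, zpowC_succ, IH by auto. ring.
  - intros k IH. replace k with (Z.pred k + 1)%Z in IH by lia.
    rewrite Hg, zpowC_succ in IH by auto.
    apply (f_equal (fun x => x / z)) in IH.
    transitivity (g (Z.pred k) * z / z); [field; auto|]. rewrite IH. field; auto.
Qed.

Lemma zpowC_add (z : C) a b : z <> 0 -> zpowC z (a + b) = zpowC z a * zpowC z b.
Proof.
  intros Hz. rewrite (zpowC_unique z (fun b => zpowC z (a + b))) by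
    (auto; intros k; rewrite <- zpowC_succ by auto; f_equal; lia).
  rewrite Z.add_0_r. reflexivity.
Qed.

Lemma zpowC_1 (z : C) : z <> 0 -> zpowC z 1 = z.
Proof. intros Hz. change 1%Z with (0 + 1)%Z. rewrite zpowC_succ, zpowC_0 by auto. ring. Qed.

Lemma zpowC_m1 z : zpowC z (-1) = / z.
Proof. change (-1)%Z with (- Z.of_nat 1)%Z. rewrite zpowC_neg. f_equal. simpl. ring. Qed.

Lemma zpowC_one k : zpowC 1 k = 1.
Proof.
  rewrite <- (Cmult_1_l (zpowC 1 k)). symmetry.
  apply (zpowC_unique 1 (fun _ => 1)); [apply C1_nz|intros; ring].
Qed.

Lemma zpowC_mult (z w : C) k : z <> 0 -> w <> 0 -> zpowC (z * w) k = zpowC z k * zpowC w k.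
Proof.
  intros Hz Hw.
  rewrite (zpowC_unique (z * w) (fun k => zpowC z k * zpowC w k)).
  - rewrite !zpowC_0. ring.
  - apply Cmult_neq_0; auto.
  - intros j. rewrite !zpowC_succ by auto. ring.
Qed.

Lemma Cmod_zpowC (z z' : C) k : Cmod z = Cmod z' -> z <> 0 -> z' <> 0 ->
  Cmod (zpowC z k) = Cmod (zpowC z' k).
Proof.
  intros H Hz Hz'. destruct (Z_le_gt_dec 0 k) as [Hk|Hk].
  - replace k with (Z.of_nat (Z.to_nat k)) by lia.
    rewrite !zpowC_nat, !Cmod_pow, H. reflexivity.
  - replace k with (- Z.of_nat (Z.to_nat (- k)))%Z by lia.
    rewrite !zpowC_neg, !Cmod_inv, !Cmod_pow, H by auto using Cpow_nz. reflexivity.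
Qed.

Definition cis (x : R) : C := (cos x, sin x).

Lemma cis_plus x y : cis (x + y) = cis x * cis y.
Proof. unfold cis, Cmult; simpl. rewrite cos_plus, sin_plus. f_equal; ring. Qed.

Lemma Cmod_cis x : Cmod (cis x) = 1%R.
Proof.
  unfold Cmod, cis; simpl.
  replace (cos x * (cos x * 1) + sin x * (sin x * 1))%R with 1%R; [apply sqrt_1|].
  generalize (sin2_cos2 x). unfold Rsqr. lra.
Qed.

Lemma cis_nz x : cis x <> 0.
Proof. intros H. generalize (Cmod_cis x). rewrite H, Cmod_0. lra. Qed.

Lemma zpowC_cis x k : zpowC (cis x) k = cis (IZR k * x).
Proof.
  symmetry. transitivity (cis (IZR 0 * x) * zpowC (cis x) k).
  - apply (zpowC_unique (cis x) (fun k => cis (IZR k * x)) (cis_nz x)).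
    intros j. rewrite <- cis_plus, plus_IZR. f_equal. ring.
  - rewrite Rmult_0_l. unfold cis at 1. rewrite cos_0, sin_0.
    change (1%R, 0%R) with (RtoC 1). ring.
Qed.

Lemma cis_2PI : cis (2 * PI) = 1.
Proof. unfold cis. rewrite cos_2PI, sin_2PI. reflexivity. Qed.

Lemma RtoC_nz (x : R) : x <> 0%R -> RtoC x <> 0.
Proof. intros H E. apply H. apply (f_equal fst) in E. exact E. Qed.

Lemma is_RInt_derive_closed (f df : R -> R) a b :
  (forall x, is_derive f x (df x)) -> (forall x, continuous df x) -> f b = f a ->
  is_RInt df a b 0%R.
Proof.
  intros H1 H2 H3.
  assert (E : minus (f b) (f a) = 0%R) by (rewrite H3; apply (minus_eq_zero (G := R_AbelianGroup))).
  rewrite <- E. apply (is_RInt_derive (V := R_CompleteNormedModule)); auto.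
Qed.

(** With [z = r e^(i th)] the integrand is [d e^(i (k+1) th)]. For [k = -1] it is constant;
    otherwise its real and imaginary parts have explicit primitives taking equal values at both
    ends. *)
Lemma is_RInt_circle_monomial r c k : (0 < r)%R ->
  is_RInt (V := C_R_NormedModule)
    (fun th => c * zpowC (RtoC r * (cos th, sin th)) k * (Ci * (RtoC r * (cos th, sin th))))
    0 (2 * PI) (if (k =? -1)%Z then c * (RtoC (2 * PI) * Ci) else RtoC 0).
Proof.
  intros Hr. assert (Hr' : RtoC r <> 0) by (apply RtoC_nz; lra).
  set (d := c * Ci * zpowC r (k + 1)).
  apply (is_RInt_ext (V := C_R_NormedModule) (fun th => d * cis (IZR (k + 1) * th))).
  { intros th _. change (cos th, sin th) with (cis th).
    rewrite <- zpowC_cis. unfold d.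
    rewrite zpowC_mult, !zpowC_succ by auto using cis_nz. eqC. ring. }
  destruct (Z.eqb_spec k (-1)) as [->|Hk].
  - replace (c * (RtoC (2 * PI) * Ci))
      with (@scal R_AbsRing C_R_NormedModule (2 * PI - 0)%R d).
    + apply (is_RInt_ext (V := C_R_NormedModule) (fun th => d)).
      { intros th _. simpl. rewrite Rmult_0_l. unfold cis. rewrite cos_0, sin_0.
        change (1%R, 0%R) with (RtoC 1). eqC. ring. }
      apply is_RInt_const.
    + unfold d. change (-1 + 1)%Z with 0%Z. rewrite zpowC_0.
      change (@scal R_AbsRing C_R_NormedModule) with
        (fun (x : R) (z : C) => (x * fst z, x * snd z)%R).
      destruct c as [c1 c2]. unfold Ci, Cmult, RtoC; simpl. f_equal; ring.
  - set (m := IZR (k + 1)). assert (Hm : m <> 0%R) by (apply not_0_IZR; lia).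
    assert (E : cis (m * (2 * PI)) = 1).
    { unfold m. rewrite <- zpowC_cis, cis_2PI. apply zpowC_one. }
    assert (Ec := f_equal fst E). assert (Es := f_equal snd E). simpl in Ec, Es.
    destruct d as [d1 d2].
    apply is_RInt_fct_extend_pair; simpl.
    + apply (is_RInt_derive_closed (fun x => (d1 * sin (m * x) + d2 * cos (m * x)) / m)%R).
      * intros x. auto_derive; auto. field; auto.
      * intros x. apply (ex_derive_continuous (V := R_NormedModule)). auto_derive; auto.
      * rewrite Ec, Es, (Rmult_0_r m), sin_0, cos_0. reflexivity.
    + apply (is_RInt_derive_closed (fun x => (d2 * sin (m * x) - d1 * cos (m * x)) / m)%R).
      * intros x. auto_derive; auto. field; auto.
      * intros x. apply (ex_derive_continuous (V := R_NormedModule)). auto_derive; auto.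
      * rewrite Ec, Es, (Rmult_0_r m), sin_0, cos_0. reflexivity.
Qed.

Lemma norm_C_R (x : C) : @norm R_AbsRing C_R_NormedModule x = Cmod x.
Proof.
  destruct x as [a b]. unfold Cmod. simpl.
  unfold norm; simpl. unfold prod_norm; simpl. unfold norm; simpl. unfold abs; simpl.
  f_equal. rewrite !Rmult_1_r.
  rewrite <- !Rabs_mult, !Rabs_pos_eq; auto using Rle_0_sqr; apply Rle_0_sqr.
Qed.

Definition laurent1 (l : list (C * Z)) (z : C) : C :=
  csum l (fun t => fst t * zpowC z (snd t)).

Definition residue1 (l : list (C * Z)) : C :=
  csum l (fun t => if (snd t =? -1)%Z then fst t else 0).

Lemma is_RInt_laurent1 r l : (0 < r)%R ->
  is_RInt (V := C_R_NormedModule)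
    (fun th => laurent1 l (RtoC r * (cos th, sin th)) * (Ci * (RtoC r * (cos th, sin th))))
    0 (2 * PI) (residue1 l * (RtoC (2 * PI) * Ci)).
Proof.
  intros Hr. induction l as [|[c k] l IH].
  - apply (is_RInt_ext (V := C_R_NormedModule) (fun _ => RtoC 0)).
    { intros x _. unfold laurent1; simpl. eqC. ring. }
    replace (residue1 [] * (RtoC (2 * PI) * Ci))
      with (@scal R_AbsRing C_R_NormedModule (2 * PI - 0)%R (RtoC 0)).
    + apply (is_RInt_const (V := C_R_NormedModule)).
    + rewrite (@scal_zero_r R_AbsRing C_R_NormedModule). unfold residue1; simpl.
      rewrite Cmult_0_l. reflexivity.
  - replace (residue1 ((c, k) :: l) * (RtoC (2 * PI) * Ci))
      with (@plus C_R_NormedModule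
              (if (k =? -1)%Z then c * (RtoC (2 * PI) * Ci) else RtoC 0)
              (residue1 l * (RtoC (2 * PI) * Ci))).
    + eapply (is_RInt_ext (V := C_R_NormedModule));
        [|apply (is_RInt_plus (V := C_R_NormedModule));
          [apply (is_RInt_circle_monomial r c k Hr)|exact IH]].
      intros x _. unfold laurent1; simpl.
      change (@plus C_R_NormedModule) with Cplus. eqC. ring.
    + unfold residue1; simpl. change (@plus C_R_NormedModule) with Cplus.
      destruct (k =? -1)%Z; eqC; ring.
Qed.

Lemma Cmod_circle r th : (0 < r)%R -> Cmod (RtoC r * (cos th, sin th)) = r.
Proof.
  intros Hr. rewrite Cmod_mult, Cmod_R. change (cos th, sin th) with (cis th).
  rewrite Cmod_cis, Rabs_pos_eq; lra.
Qed.

(** The Riemann integral commutes with uniform limits. Approximability to every precision makes [h]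
    integrable; the estimate then holds for any single approximant [l], with [2 PI r] the length of
    the circle. *)
Lemma circle_int_approx r h : (0 < r)%R ->
  (forall eps, (0 < eps)%R -> exists l, forall z, Cmod z = r -> (Cmod (h z - laurent1 l z) <= eps)%R) ->
  forall l eps, (forall z, Cmod z = r -> (Cmod (h z - laurent1 l z) <= eps)%R) ->
  (Cmod (circle_int r h - residue1 l * (RtoC (2 * PI) * Ci)) <= 2 * PI * r * eps)%R.
Proof.
  intros Hr Happ l eps Hl.
  assert (Hpi := PI_RGT_0).
  (* Choice turns the existence of approximants into a sequence of precision [1/(m+1)], whose
     integrals are known. *)
  assert (HL : exists L : nat -> list (C * Z), forall m z, Cmod z = r ->
             (Cmod (h z - laurent1 (L m) z) <= / (INR m + 1))%R).
  { assert (H : forall m : nat, exists l, forall z, Cmod z = r ->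
             (Cmod (h z - laurent1 l z) <= / (INR m + 1))%R).
    { intros m. apply Happ. apply Rinv_0_lt_compat. generalize (pos_INR m); lra. }
    exists (fun m => proj1_sig (constructive_indefinite_description _ (H m))).
    intros m. apply (proj2_sig (constructive_indefinite_description _ (H m))). }
  destruct HL as [L HL].
  set (Z th := RtoC r * (cos th, sin th)).
  assert (HZ : forall th, Cmod (Z th) = r) by (intros; apply Cmod_circle; auto).
  destruct (@filterlim_RInt nat C_R_CompleteNormedModule
     (fun m th => laurent1 (L m) (Z th) * (Ci * Z th)) 0 (2 * PI) eventually _
     (fun th => h (Z th) * (Ci * Z th))
     (fun m => residue1 (L m) * (RtoC (2 * PI) * Ci))) as [If [_ HIf]].
  - intros m. apply is_RInt_laurent1; auto.
  - apply filterlim_locally. intros e.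
    destruct (nfloor_ex (r / e)) as [M HM].
    { apply Rlt_le, Rdiv_lt_0_compat; [lra|apply cond_pos]. }
    exists (M + 1)%nat. intros m Hm th.
    apply C_NormedModule_mixin_compat1.
    change (@minus C_AbelianGroup) with Cminus.
    replace (laurent1 (L m) (Z th) * (Ci * Z th) - h (Z th) * (Ci * Z th))
      with (- ((h (Z th) - laurent1 (L m) (Z th)) * (Ci * Z th))) by ring.
    rewrite Cmod_opp, !Cmod_mult, HZ, Cmod_Ci, Rmult_1_l.
    apply Rle_lt_trans with (/ (INR m + 1) * r)%R.
    + apply Rmult_le_compat_r; [lra|]. apply HL, HZ.
    + assert (He := cond_pos e).
      apply (le_INR (M + 1) m) in Hm. rewrite plus_INR in Hm. simpl in Hm.
      assert (H1 : (r < (INR m + 1) * e)%R).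
      { apply Rmult_lt_reg_r with (/ e)%R; [apply Rinv_0_lt_compat; lra|].
        rewrite Rmult_assoc, Rinv_r by lra. unfold Rdiv in HM. lra. }
      assert (H2 : (0 < INR m + 1)%R) by (generalize (pos_INR m); lra).
      apply Rmult_lt_reg_l with (INR m + 1)%R; auto.
      rewrite <- Rmult_assoc, Rinv_r by lra. lra.
  - replace (circle_int r h) with If.
    2:{ symmetry. unfold circle_int. apply is_RInt_unique. exact HIf. }
    rewrite <- norm_C_R.
    replace (2 * PI * r * eps)%R with ((2 * PI - 0) * (r * eps))%R by ring.
    apply (norm_RInt_le_const (V := C_R_NormedModule)
      (fun th => minus (h (Z th) * (Ci * Z th)) (laurent1 l (Z th) * (Ci * Z th)))).
    + lra.
    + intros th _. rewrite norm_C_R.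
      match goal with |- (Cmod ?a <= _)%R => change a with
        (h (Z th) * (Ci * Z th) - laurent1 l (Z th) * (Ci * Z th)) end.
      replace (h (Z th) * (Ci * Z th) - laurent1 l (Z th) * (Ci * Z th))
        with ((h (Z th) - laurent1 l (Z th)) * (Ci * Z th)) by ring.
      rewrite !Cmod_mult, HZ, Cmod_Ci, Rmult_1_l, Rmult_comm.
      apply Rmult_le_compat_l; [lra|]. apply Hl, HZ.
    + apply (is_RInt_minus (V := C_R_NormedModule)); [exact HIf|].
      apply is_RInt_laurent1; auto.
Qed.

(** * Laurent polynomials in several variables *)

(** A coefficient with its exponents. Only the exponents at [1..n] count in [n] variables, so a term
    can be kept as it is when its last variable is frozen. *)
Definition term := (C * (nat -> Z))%type.

Fixpoint mono (n : nat) (e : nat -> Z) (xi : nat -> C) : C :=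
  match n with
  | O => 1
  | S m => mono m e xi * zpowC (xi (S m)) (e (S m))
  end.

Definition laurent (n : nat) (L : list term) (xi : nat -> C) : C :=
  csum L (fun t => fst t * mono n (snd t) xi).

Fixpoint all_m1 (n : nat) (e : nat -> Z) : bool :=
  match n with
  | O => true
  | S m => (all_m1 m e && (e (S m) =? -1)%Z)%bool
  end.

Definition residue (n : nat) (L : list term) : C :=
  csum L (fun t => if all_m1 n (snd t) then fst t else 0).

Definition torus (r : R) (n : nat) (xi : nat -> C) : Prop :=
  forall j, (1 <= j <= n)%nat -> Cmod (xi j) = r.

Lemma torus_S r n xi : torus r (S n) xi -> torus r n xi /\ Cmod (xi (S n)) = r.
Proof. intros H; split; [intros j Hj|]; apply H; lia. Qed.

Definition freeze (n : nat) (z : C) (L : list term) : list term :=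
  map (fun t => (fst t * zpowC z (snd t (S n)), snd t)) L.

Lemma laurent_freeze n z L xi : xi (S n) = z -> laurent n (freeze n z L) xi = laurent (S n) L xi.
Proof.
  intros <-. unfold laurent, freeze. rewrite csum_map. apply csum_ext.
  intros [c e] _; simpl. ring.
Qed.

(** Induction on the number of variables, the outermost integral running over [xi_(n+1)]. The inner
    integral, as a function of that variable, is uniformly close to the one-variable polynomial
    whose coefficients are the inner residues; this is what allows it to be integrated again, and
    its continuity is never discussed. *)
Lemma circle_int_n_approx r n : (0 < r)%R -> forall f env,
  (forall eps, (0 < eps)%R -> exists L, forall xi, torus r n xi ->
     (forall j, (n < j)%nat -> xi j = env j) -> (Cmod (f xi - laurent n L xi) <= eps)%R) ->
  forall L eps, (forall xi, torus r n xi ->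
     (forall j, (n < j)%nat -> xi j = env j) -> (Cmod (f xi - laurent n L xi) <= eps)%R) ->
  (Cmod (circle_int_n r n f env - (RtoC (2 * PI) * Ci) ^ n * residue n L)
     <= (2 * PI * r) ^ n * eps)%R.
Proof.
  intros Hr. induction n as [|n IH]; intros f env Happ L eps HL.
  - simpl. rewrite Rmult_1_l.
    replace (1 * residue 0 L) with (laurent 0 L env).
    + apply HL; [intros j Hj; lia|reflexivity].
    + rewrite Cmult_1_l. apply csum_ext. intros; simpl. ring.
  - set (h z := circle_int_n r n f (upd_env env (S n) z)).
    set (w := RtoC (2 * PI) * Ci).
    set (one_var L := map (fun t : term =>
      (w ^ n * (if all_m1 n (snd t) then fst t else 0), snd t (S n))) L).
    assert (Hone : forall L z, laurent1 (one_var L) z = w ^ n * residue n (freeze n z L)).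
    { intros L' z. unfold laurent1, one_var, residue, freeze.
      rewrite !csum_map, <- csum_scal. apply csum_ext. intros [c e] _; simpl.
      destruct (all_m1 n e); ring. }
    assert (Hspec : forall z L eps, Cmod z = r ->
      (forall xi, torus r (S n) xi ->
        (forall j, (S n < j)%nat -> xi j = env j) -> (Cmod (f xi - laurent (S n) L xi) <= eps)%R) ->
      forall xi, torus r n xi -> (forall j, (n < j)%nat -> xi j = upd_env env (S n) z j) ->
        (Cmod (f xi - laurent n (freeze n z L) xi) <= eps)%R).
    { intros z L' e' Hz H xi Hxi Hagr.
      assert (E : xi (S n) = z).
      { rewrite Hagr by lia. unfold upd_env. rewrite Nat.eqb_refl. reflexivity. }
      rewrite (laurent_freeze n z L' xi E). apply H.
      - intros j Hj. destruct (Nat.eq_dec j (S n)) as [->|Hne]; [rewrite E; auto|].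
        apply Hxi; lia.
      - intros j Hj. rewrite Hagr by lia. unfold upd_env.
        destruct (Nat.eqb_spec j (S n)); [lia|reflexivity]. }
    assert (Hh : forall L eps, (forall xi, torus r (S n) xi ->
        (forall j, (S n < j)%nat -> xi j = env j) -> (Cmod (f xi - laurent (S n) L xi) <= eps)%R) ->
      forall z, Cmod z = r -> (Cmod (h z - laurent1 (one_var L) z) <= (2 * PI * r) ^ n * eps)%R).
    { intros L' e' H z Hz. rewrite Hone. apply IH.
      - intros e He. destruct (Happ e He) as [L0 HL0].
        exists (freeze n z L0). apply Hspec; auto.
      - apply Hspec; auto. }
    assert (Hpi := PI_RGT_0).
    assert (Hpos : (0 < (2 * PI * r) ^ n)%R) by (apply pow_lt, Rmult_lt_0_compat; lra).
    change (circle_int_n r (S n) f env) with (circle_int r h).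
    replace (w ^ S n * residue (S n) L) with (residue1 (one_var L) * w).
    + replace ((2 * PI * r) ^ S n * eps)%R with (2 * PI * r * ((2 * PI * r) ^ n * eps))%R
        by (simpl; ring).
      apply circle_int_approx; auto.
      intros e He. destruct (Happ (e / (2 * PI * r) ^ n)%R) as [L0 HL0].
      { apply Rdiv_lt_0_compat; lra. }
      exists (one_var L0). intros z Hz.
      replace e with ((2 * PI * r) ^ n * (e / (2 * PI * r) ^ n))%R by (field; lra).
      apply Hh; auto.
    + unfold residue1, residue, one_var. rewrite csum_map.
      rewrite Cmult_comm, <- !csum_scal. apply csum_ext. intros [c e] _; simpl.
      destruct (all_m1 n e), (e (S n) =? -1)%Z; simpl; ring.
Qed.

(** * Exchanging neighbouring coordinates *)

(** One operation serves variables, exponents and words alike: precomposition with the transposition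
    of [k] and [k+1]. *)
Definition sw {A} (k : nat) (f : nat -> A) : nat -> A :=
  fun j => if (j =? k)%nat then f (S k) else if (j =? S k)%nat then f k else f j.

Lemma sw_l {A} k (f : nat -> A) : sw k f k = f (S k).
Proof. unfold sw. rewrite Nat.eqb_refl. reflexivity. Qed.

Lemma sw_r {A} k (f : nat -> A) : sw k f (S k) = f k.
Proof. unfold sw. destruct (Nat.eqb_spec (S k) k); [lia|]. rewrite Nat.eqb_refl. reflexivity. Qed.

Lemma sw_other {A} k (f : nat -> A) j : j <> k -> j <> S k -> sw k f j = f j.
Proof. intros. unfold sw. destruct (Nat.eqb_spec j k), (Nat.eqb_spec j (S k)); congruence. Qed.

Ltac sw_cases := unfold sw; repeat match goal with
  | |- context [Nat.eqb ?a ?b] => destruct (Nat.eqb_spec a b) end; try lia.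

Lemma sw_sw {A} k (f : nat -> A) : sw k (sw k f) = f.
Proof. apply functional_extensionality; intros j. sw_cases; subst; reflexivity. Qed.

Lemma sw_braid {A} k (f : nat -> A) :
  sw k (sw (S k) (sw k f)) = sw (S k) (sw k (sw (S k) f)).
Proof. apply functional_extensionality; intros j. sw_cases; subst; reflexivity. Qed.

Lemma sw_comm {A} k l (f : nat -> A) : (S k < l)%nat -> sw k (sw l f) = sw l (sw k f).
Proof. intros. apply functional_extensionality; intros j. sw_cases; subst; reflexivity. Qed.

Lemma torus_sw r n k xi : (1 <= k < n)%nat -> torus r n xi -> torus r n (sw k xi).
Proof. intros Hk H j Hj. sw_cases; apply H; lia. Qed.

Lemma torus_nz r n xi j : (0 < r)%R -> torus r n xi -> (1 <= j <= n)%nat -> xi j <> 0.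
Proof. intros Hr H Hj E. specialize (H j Hj). rewrite E, Cmod_0 in H. lra. Qed.

Lemma mono_ext n e e' xi xi' :
  (forall j, (1 <= j <= n)%nat -> e j = e' j) -> (forall j, (1 <= j <= n)%nat -> xi j = xi' j) ->
  mono n e xi = mono n e' xi'.
Proof.
  induction n as [|n IH]; simpl; intros H H'; [reflexivity|].
  rewrite H, H', IH; auto with arith; intros; (apply H || apply H'); lia.
Qed.

Lemma mono_sw n k e xi : (1 <= k < n)%nat -> mono n e (sw k xi) = mono n (sw k e) xi.
Proof.
  induction n as [|n IH]; intros Hk; [lia|].
  destruct (Nat.eq_dec k n) as [->|Hn].
  - destruct n as [|n]; [lia|]. simpl. rewrite !sw_r, !sw_l.
    replace (mono n e (sw (S n) xi)) with (mono n (sw (S n) e) xi); [ring|].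
    apply mono_ext; intros; rewrite sw_other by lia; reflexivity.
  - simpl. rewrite IH by lia. rewrite !(sw_other k) by lia. reflexivity.
Qed.

Lemma mono_zero n xi : mono n (fun _ => 0%Z) xi = 1.
Proof. induction n as [|n IH]; simpl; [reflexivity|]. rewrite IH, zpowC_0. ring. Qed.

Lemma mono_add r n e e' xi : (0 < r)%R -> torus r n xi ->
  mono n (fun j => (e j + e' j)%Z) xi = mono n e xi * mono n e' xi.
Proof.
  intros Hr. induction n as [|n IH]; intros H; simpl; [ring|].
  rewrite IH by apply (torus_S _ _ _ H).
  rewrite zpowC_add by (apply (torus_nz r (S n)); auto; lia). ring.
Qed.

Lemma mono_unit n j (xi : nat -> C) : (1 <= j <= n)%nat -> xi j <> 0 ->
  mono n (fun i => if (i =? j)%nat then 1%Z else 0%Z) xi = xi j.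
Proof.
  induction n as [|n IH]; intros Hj Hxi; [lia|]. cbn [mono].
  destruct (Nat.eqb_spec (S n) j) as [<-|Hne].
  - rewrite zpowC_1 by auto.
    rewrite (mono_ext n _ (fun _ => 0%Z) xi xi), mono_zero; [ring| |reflexivity].
    intros i Hi. destruct (Nat.eqb_spec i (S n)); [lia|reflexivity].
  - rewrite IH, zpowC_0 by (auto; lia). ring.
Qed.

Lemma Cmod_mono r n e xi : (0 < r)%R -> torus r n xi ->
  Cmod (mono n e xi) = Cmod (mono n e (fun _ => RtoC r)).
Proof.
  intros Hr. induction n as [|n IH]; intros H; simpl; [reflexivity|].
  rewrite !Cmod_mult, IH by apply (torus_S _ _ _ H). f_equal.
  apply Cmod_zpowC.
  - rewrite H, Cmod_R, Rabs_pos_eq by (lia || lra). reflexivity.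
  - apply (torus_nz r (S n)); auto; lia.
  - apply RtoC_nz; lra.
Qed.

Lemma all_m1_spec n e : all_m1 n e = true <-> forall j, (1 <= j <= n)%nat -> e j = (-1)%Z.
Proof.
  induction n as [|n IH]; simpl.
  - split; [intros; lia|reflexivity].
  - rewrite andb_true_iff, IH, Z.eqb_eq. split.
    + intros [H1 H2] j Hj. destruct (Nat.eq_dec j (S n)) as [->|]; [auto|apply H1; lia].
    + intros H. split; [intros; apply H|apply H]; lia.
Qed.

Lemma all_m1_sw n k e : (1 <= k < n)%nat -> all_m1 n (sw k e) = all_m1 n e.
Proof.
  intros Hk. apply eq_true_iff_eq. rewrite !all_m1_spec. split; intros H j Hj.
  - rewrite <- (sw_sw k e). unfold sw at 1.
    destruct (j =? k)%nat eqn:E1; [|destruct (j =? S k)%nat eqn:E2]; apply H; lia.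
  - sw_cases; apply H; lia.
Qed.

(** * Uniform limits of Laurent polynomials on the torus *)

(* With [b = true] the exponents are nonnegative: these are the functions
   analytic in the polydisc, whose coefficients the contour integrals extract. *)
Definition approx (r : R) (b : bool) (n : nat) (f : (nat -> C) -> C) : Prop :=
  forall eps, (0 < eps)%R -> exists L : list term,
    (forall t, In t L -> b = true -> forall j, (0 <= snd t j)%Z) /\
    forall xi, torus r n xi -> (Cmod (f xi - laurent n L xi) <= eps)%R.

Definition contour (r : R) (n : nat) (f : (nat -> C) -> C) : C :=
  circle_int_n r n f (fun _ => RtoC 0) / (RtoC (2 * PI) * Ci) ^ n.

Lemma two_pi_i_nz : RtoC (2 * PI) * Ci <> 0.
Proof.
  apply Cmult_neq_0; [apply RtoC_nz; generalize PI_RGT_0; lra|].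
  intros H. apply (f_equal snd) in H. simpl in H. lra.
Qed.

Lemma Cmod_two_pi_i : Cmod (RtoC (2 * PI) * Ci) = (2 * PI)%R.
Proof.
  rewrite Cmod_mult, Cmod_R, Cmod_Ci, Rabs_pos_eq; generalize PI_RGT_0; lra.
Qed.

Lemma contour_approx r b n f : (0 < r)%R -> approx r b n f -> forall L eps,
  (forall xi, torus r n xi -> (Cmod (f xi - laurent n L xi) <= eps)%R) ->
  (Cmod (contour r n f - residue n L) <= r ^ n * eps)%R.
Proof.
  intros Hr Hf L eps HL. unfold contour. set (w := RtoC (2 * PI) * Ci).
  assert (Hw : w ^ n <> 0) by apply Cpow_nz, two_pi_i_nz.
  assert (Hpi := PI_RGT_0).
  assert (Hpos : (0 < (2 * PI) ^ n)%R) by (apply pow_lt; lra).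
  assert (Hw' : Cmod (w ^ n) = ((2 * PI) ^ n)%R)
    by (unfold w; rewrite Cmod_pow, Cmod_two_pi_i; reflexivity).
  apply Rmult_le_reg_l with ((2 * PI) ^ n)%R; auto.
  rewrite <- Hw' at 1. rewrite <- Cmod_mult.
  match goal with |- (Cmod ?x <= _)%R =>
    replace x with (circle_int_n r n f (fun _ => RtoC 0) - w ^ n * residue n L) by (field; auto) end.
  rewrite <- Rmult_assoc, <- Rpow_mult_distr.
  apply circle_int_n_approx; auto.
  intros e He. destruct (Hf e He) as [L0 [_ H]]. exists L0; auto.
Qed.

Lemma Cmod_eq_of_small (x y : C) K :
  (forall eps, (0 < eps)%R -> (Cmod (x - y) <= K * eps)%R) -> x = y.
Proof.
  intros H. assert (E : Cmod (x - y) = 0%R).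
  { apply Rle_antisym; [|apply Cmod_ge_0]. apply le_epsilon. intros e He.
    assert (HK : (0 < Rabs K + 1)%R) by (generalize (Rabs_pos K); lra).
    rewrite Rplus_0_l. apply Rle_trans with (K * (e / (Rabs K + 1)))%R.
    - apply H. apply Rdiv_lt_0_compat; lra.
    - apply Rmult_le_reg_r with (Rabs K + 1)%R; auto.
      replace (K * (e / (Rabs K + 1)) * (Rabs K + 1))%R with (K * e)%R by (field; lra).
      generalize (Rle_abs K). nra. }
  apply Cmod_eq_0 in E. replace x with (x - y + y) by ring. rewrite E. ring.
Qed.

(** Approximants of [f] whose residues also approach [v] pin the integral down; the rules for sums,
    multiples, exchanges and vanishing all reduce to this. *)
Lemma contour_unique r b n f v K : (0 < r)%R -> approx r b n f ->
  (forall eps, (0 < eps)%R -> exists L,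
     (forall xi, torus r n xi -> (Cmod (f xi - laurent n L xi) <= eps)%R) /\
     (Cmod (v - residue n L) <= K * eps)%R) ->
  contour r n f = v.
Proof.
  intros Hr Hf H. apply (Cmod_eq_of_small _ _ (r ^ n + K)%R). intros e He.
  destruct (H e He) as [L [H1 H2]].
  assert (H3 := contour_approx r b n f Hr Hf L e H1).
  replace (contour r n f - v) with ((contour r n f - residue n L) + - (v - residue n L)) by ring.
  eapply Rle_trans; [apply Cmod_triangle|]. rewrite Cmod_opp. lra.
Qed.

Lemma contour_ext r b n f g : (0 < r)%R -> approx r b n f ->
  (forall xi, torus r n xi -> f xi = g xi) -> contour r n g = contour r n f.
Proof.
  intros Hr Hf E.
  assert (Hg : approx r b n g).
  { intros e He. destruct (Hf e He) as [L [H1 H2]]. exists L. split; auto.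
    intros xi Hxi. rewrite <- E by auto. auto. }
  apply (contour_unique r b n g _ (r ^ n)%R Hr Hg). intros e He.
  destruct (Hf e He) as [L [_ H2]]. exists L. split.
  - intros xi Hxi. rewrite <- E by auto. auto.
  - apply (contour_approx r b n f); auto.
Qed.

Lemma laurent_app n L L' xi : laurent n (L ++ L') xi = laurent n L xi + laurent n L' xi.
Proof. apply csum_app. Qed.

Lemma residue_app n L L' : residue n (L ++ L') = residue n L + residue n L'.
Proof. apply csum_app. Qed.

Definition scale (c : C) : list term -> list term := map (fun t => (c * fst t, snd t)).

Lemma laurent_scale n c L xi : laurent n (scale c L) xi = c * laurent n L xi.
Proof.
  unfold laurent, scale. rewrite csum_map, <- csum_scal.
  apply csum_ext; intros; simpl; ring.
Qed.

Lemma residue_scale n c L : residue n (scale c L) = c * residue n L.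
Proof.
  unfold residue, scale. rewrite csum_map, <- csum_scal.
  apply csum_ext; intros [d e] _; simpl. destruct (all_m1 n e); ring.
Qed.

Lemma contour_plus r b n f g : (0 < r)%R -> approx r b n f -> approx r b n g ->
  approx r b n (fun xi => f xi + g xi) /\
  contour r n (fun xi => f xi + g xi) = contour r n f + contour r n g.
Proof.
  intros Hr Hf Hg.
  assert (K : forall e, (0 < e)%R -> exists L L' : list term,
    (forall t, In t (L ++ L') -> b = true -> forall j, (0 <= snd t j)%Z) /\
    (forall xi, torus r n xi -> (Cmod (f xi - laurent n L xi) <= e / 2)%R) /\
    (forall xi, torus r n xi -> (Cmod (g xi - laurent n L' xi) <= e / 2)%R) /\
    (forall xi, torus r n xi -> (Cmod (f xi + g xi - laurent n (L ++ L') xi) <= e)%R)).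
  { intros e He. destruct (Hf (e / 2)%R) as [L [H1 H2]]; [lra|].
    destruct (Hg (e / 2)%R) as [L' [H3 H4]]; [lra|].
    exists L, L'. split; [|split; [auto|split; [auto|]]].
    - intros t Ht. apply in_app_or in Ht. destruct Ht; auto.
    - intros xi Hxi. rewrite laurent_app.
      replace (f xi + g xi - (laurent n L xi + laurent n L' xi))
        with ((f xi - laurent n L xi) + (g xi - laurent n L' xi)) by ring.
      eapply Rle_trans; [apply Cmod_triangle|].
      generalize (H2 xi Hxi) (H4 xi Hxi). lra. }
  assert (Ha : approx r b n (fun xi => f xi + g xi)).
  { intros e He. destruct (K e He) as [L [L' [H1 [_ [_ H2]]]]]. exists (L ++ L'); auto. }
  split; auto.
  apply (contour_unique r b n _ _ (r ^ n)%R Hr Ha). intros e He.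
  destruct (K e He) as [L [L' [H1 [H2 [H3 H4]]]]]. exists (L ++ L'). split; auto.
  rewrite residue_app.
  replace (contour r n f + contour r n g - (residue n L + residue n L'))
    with ((contour r n f - residue n L) + (contour r n g - residue n L')) by ring.
  eapply Rle_trans; [apply Cmod_triangle|].
  generalize (contour_approx r b n f Hr Hf L _ H2) (contour_approx r b n g Hr Hg L' _ H3). lra.
Qed.

Lemma contour_scal r b n c f : (0 < r)%R -> approx r b n f ->
  approx r b n (fun xi => c * f xi) /\
  contour r n (fun xi => c * f xi) = c * contour r n f.
Proof.
  intros Hr Hf.
  assert (Hc : (0 < Cmod c + 1)%R) by (generalize (Cmod_ge_0 c); lra).
  assert (K : forall e, (0 < e)%R -> exists L : list term,
    (forall t, In t L -> b = true -> forall j, (0 <= snd t j)%Z) /\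
    (forall xi, torus r n xi -> (Cmod (f xi - laurent n L xi) <= e / (Cmod c + 1))%R) /\
    (forall xi, torus r n xi -> (Cmod (c * f xi - laurent n (scale c L) xi) <= e)%R)).
  { intros e He. assert (He' : (0 < e / (Cmod c + 1))%R) by (apply Rdiv_lt_0_compat; lra).
    destruct (Hf _ He') as [L [H1 H2]].
    exists L. split; [auto|split; [auto|]].
    intros xi Hxi. rewrite laurent_scale.
    replace (c * f xi - c * laurent n L xi) with (c * (f xi - laurent n L xi)) by ring.
    rewrite Cmod_mult. specialize (H2 xi Hxi).
    replace e with ((Cmod c + 1) * (e / (Cmod c + 1)))%R by (field; lra).
    generalize (Cmod_ge_0 c). nra. }
  assert (Ha : approx r b n (fun xi => c * f xi)).
  { intros e He. destruct (K e He) as [L [H1 [_ H2]]]. exists (scale c L). split; auto.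
    intros t Ht. unfold scale in Ht. apply in_map_iff in Ht. destruct Ht as [t' [<- Ht']].
    simpl. apply H1, Ht'. }
  split; auto.
  apply (contour_unique r b n _ _ (r ^ n)%R Hr Ha). intros e He.
  destruct (K e He) as [L [H1 [H2 H3]]]. exists (scale c L). split; auto.
  rewrite residue_scale.
  replace (c * contour r n f - c * residue n L) with (c * (contour r n f - residue n L)) by ring.
  rewrite Cmod_mult. assert (H4 := contour_approx r b n f Hr Hf L _ H2).
  assert (Hrn : (0 < r ^ n)%R) by (apply pow_lt; auto).
  apply Rle_trans with (Cmod c * (r ^ n * (e / (Cmod c + 1))))%R.
  - apply Rmult_le_compat_l; auto. apply Cmod_ge_0.
  - replace (r ^ n * e)%R with ((Cmod c + 1) * (r ^ n * (e / (Cmod c + 1))))%R by (field; lra).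
    apply Rmult_le_compat_r; [|lra]. apply Rlt_le, Rmult_lt_0_compat; auto.
    apply Rdiv_lt_0_compat; lra.
Qed.

(** Replaces Fubini's theorem: exchanging two variables permutes exponents, and the coefficient
    where all exponents are [-1] is unaffected. *)
Lemma contour_sw r b n k f : (0 < r)%R -> (1 <= k < n)%nat -> approx r b n f ->
  approx r b n (fun xi => f (sw k xi)) /\
  contour r n (fun xi => f (sw k xi)) = contour r n f.
Proof.
  intros Hr Hk Hf.
  set (S' := map (fun t : term => (fst t, sw k (snd t)))).
  assert (HS : forall L xi, laurent n (S' L) xi = laurent n L (sw k xi)).
  { intros L xi. unfold laurent, S'. rewrite csum_map. apply csum_ext.
    intros [c e] _; simpl. rewrite mono_sw by auto. reflexivity. }
  assert (Ha : approx r b n (fun xi => f (sw k xi))).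
  { intros e He. destruct (Hf e He) as [L [H1 H2]]. exists (S' L). split.
    - intros t Ht Hb j. unfold S' in Ht. apply in_map_iff in Ht. destruct Ht as [t' [<- Ht']].
      simpl. unfold sw. destruct (j =? k)%nat; [|destruct (j =? S k)%nat]; apply H1; auto.
    - intros xi Hxi. rewrite HS. apply H2, torus_sw; auto. }
  split; auto.
  apply (contour_unique r b n _ _ (r ^ n)%R Hr Ha). intros e He.
  destruct (Hf e He) as [L [_ H2]]. exists (S' L). split.
  - intros xi Hxi. rewrite HS. apply H2, torus_sw; auto.
  - replace (residue n (S' L)) with (residue n L); [apply (contour_approx r b n); auto|].
    unfold residue, S'. rewrite csum_map. apply csum_ext. intros [c e'] _; simpl.
    rewrite all_m1_sw by auto. reflexivity.
Qed.

Definition lmul (L L' : list term) : list term :=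
  flat_map (fun t => map (fun t' : term =>
    (fst t * fst t', fun j => (snd t j + snd t' j)%Z)) L') L.

Lemma laurent_lmul r n L L' xi : (0 < r)%R -> torus r n xi ->
  laurent n (lmul L L') xi = laurent n L xi * laurent n L' xi.
Proof.
  intros Hr Hxi. unfold laurent, lmul. rewrite csum_flat_map.
  rewrite Cmult_comm, <- csum_scal. apply csum_ext. intros [c e] _. simpl.
  rewrite csum_map, Cmult_comm, <- csum_scal. apply csum_ext. intros [c' e'] _. simpl.
  rewrite (mono_add r) by auto. ring.
Qed.

Lemma lmul_nonneg (b : bool) L L' :
  (forall t, In t L -> b = true -> forall j, (0 <= snd t j)%Z) ->
  (forall t, In t L' -> b = true -> forall j, (0 <= snd t j)%Z) ->
  forall t, In t (lmul L L') -> b = true -> forall j, (0 <= snd t j)%Z.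
Proof.
  intros H H' t Ht Hb j. unfold lmul in Ht. apply in_flat_map in Ht.
  destruct Ht as [t1 [Ht1 Ht]]. apply in_map_iff in Ht. destruct Ht as [t2 [<- Ht2]].
  simpl. specialize (H t1 Ht1 Hb j). specialize (H' t2 Ht2 Hb j). lia.
Qed.

Lemma laurent_bounded r n L : (0 < r)%R ->
  exists M, (0 < M)%R /\ forall xi, torus r n xi -> (Cmod (laurent n L xi) <= M)%R.
Proof.
  intros Hr. induction L as [|[c e] L [M [HM H]]].
  - exists 1%R. split; [lra|]. intros. unfold laurent; simpl. rewrite Cmod_0. lra.
  - set (m := Cmod (c * mono n e (fun _ => RtoC r))).
    assert (Hm : (0 <= m)%R) by apply Cmod_ge_0.
    exists (m + M)%R. split; [lra|]. intros xi Hxi.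
    unfold laurent; simpl. eapply Rle_trans; [apply Cmod_triangle|].
    apply Rplus_le_compat; [|apply H; auto].
    unfold m. rewrite !Cmod_mult, (Cmod_mono r) by auto. lra.
Qed.

Lemma approx_bounded r b n f : (0 < r)%R -> approx r b n f ->
  exists M, (0 < M)%R /\ forall xi, torus r n xi -> (Cmod (f xi) <= M)%R.
Proof.
  intros Hr Hf. destruct (Hf 1%R) as [L [_ HL]]; [lra|].
  destruct (laurent_bounded r n L Hr) as [M [HM H]].
  exists (1 + M)%R. split; [lra|]. intros xi Hxi.
  replace (f xi) with ((f xi - laurent n L xi) + laurent n L xi) by ring.
  eapply Rle_trans; [apply Cmod_triangle|]. generalize (HL xi Hxi) (H xi Hxi). lra.
Qed.

Lemma approx_mult r b n f g : (0 < r)%R -> approx r b n f -> approx r b n g ->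
  approx r b n (fun xi => f xi * g xi).
Proof.
  intros Hr Hf Hg e He.
  destruct (approx_bounded r b n f Hr Hf) as [Mf [HMf Bf]].
  destruct (approx_bounded r b n g Hr Hg) as [Mg [HMg Bg]].
  (* The three error terms add up to at most [d (Mf + Mg + 1)], the cap [d <= 1] taking care of the
     product of the two errors. *)
  set (d := Rmin 1 (e / (2 * (Mf + Mg + 1)))).
  assert (Hd : (0 < d)%R).
  { apply Rmin_pos; [lra|]. apply Rdiv_lt_0_compat; lra. }
  destruct (Hf d Hd) as [L [H1 H2]]. destruct (Hg d Hd) as [L' [H3 H4]].
  exists (lmul L L'). split; [apply lmul_nonneg; auto|].
  intros xi Hxi. rewrite (laurent_lmul r) by auto.
  specialize (H2 xi Hxi). specialize (H4 xi Hxi). specialize (Bf xi Hxi). specialize (Bg xi Hxi).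
  set (l := laurent n L xi) in *. set (l' := laurent n L' xi) in *.
  replace (f xi * g xi - l * l') with
    (f xi * (g xi - l') + (f xi - l) * g xi + - ((f xi - l) * (g xi - l'))) by ring.
  eapply Rle_trans; [eapply Rle_trans; [apply Cmod_triangle|]|].
  { apply Rplus_le_compat_r, Cmod_triangle. }
  rewrite Cmod_opp, !Cmod_mult.
  assert (Hd1 : (d <= 1)%R) by apply Rmin_l.
  assert (Hd2 : (d * (2 * (Mf + Mg + 1)) <= e)%R).
  { apply Rle_trans with (e / (2 * (Mf + Mg + 1)) * (2 * (Mf + Mg + 1)))%R.
    - apply Rmult_le_compat_r; [lra|]. apply Rmin_r.
    - right. field. lra. }
  generalize (Cmod_ge_0 (f xi)) (Cmod_ge_0 (g xi)) (Cmod_ge_0 (f xi - l)) (Cmod_ge_0 (g xi - l')).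
  intros P1 P2 P3 P4.
  assert (A1 : (Cmod (f xi) * Cmod (g xi - l') <= Mf * d)%R) by (apply Rmult_le_compat; auto).
  assert (A2 : (Cmod (f xi - l) * Cmod (g xi) <= d * Mg)%R) by (apply Rmult_le_compat; auto).
  assert (A3 : (Cmod (f xi - l) * Cmod (g xi - l') <= d * 1)%R)
    by (apply Rmult_le_compat; auto; lra).
  nra.
Qed.

Lemma approx_laurent r (b : bool) n L f :
  (forall t, In t L -> b = true -> forall j, (0 <= snd t j)%Z) ->
  (forall xi, torus r n xi -> f xi = laurent n L xi) -> approx r b n f.
Proof.
  intros HL H e He. exists L. split; auto. intros xi Hxi.
  rewrite H by auto. unfold Cminus. rewrite Cplus_opp_r, Cmod_0. lra.
Qed.

Lemma approx_ext r b n f g : approx r b n f ->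
  (forall xi, torus r n xi -> f xi = g xi) -> approx r b n g.
Proof.
  intros Hf E e He. destruct (Hf e He) as [L [H1 H2]]. exists L. split; auto.
  intros xi Hxi. rewrite <- E by auto. auto.
Qed.

Lemma approx_const r b n c : approx r b n (fun _ => c).
Proof.
  apply (approx_laurent r b n [(c, fun _ => 0%Z)]).
  - intros t [<-|[]] _ j. simpl. lia.
  - intros xi _. unfold laurent; simpl. rewrite mono_zero. ring.
Qed.

Lemma approx_mono r n e : approx r false n (mono n e).
Proof.
  apply (approx_laurent r false n [(RtoC 1, e)]).
  - discriminate.
  - intros xi _. unfold laurent; simpl. ring.
Qed.

Lemma approx_coord r b n j : (0 < r)%R -> (1 <= j <= n)%nat -> approx r b n (fun xi => xi j).
Proof.
  intros Hr Hj.
  apply (approx_laurent r b n [(RtoC 1, fun i => if (i =? j)%nat then 1%Z else 0%Z)]).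
  - intros t [<-|[]] _ i. simpl. destruct (i =? j)%nat; lia.
  - intros xi Hxi. unfold laurent; simpl. rewrite mono_unit; [ring|auto|].
    apply (torus_nz r n); auto.
Qed.

Lemma approx_weaken r b n f : approx r b n f -> approx r false n f.
Proof.
  intros Hf e He. destruct (Hf e He) as [L [_ H]]. exists L. split; [discriminate|auto].
Qed.

Lemma approx_limit r b n f :
  (forall eps, (0 < eps)%R -> exists g, approx r b n g /\
     forall xi, torus r n xi -> (Cmod (f xi - g xi) <= eps)%R) -> approx r b n f.
Proof.
  intros H e He. destruct (H (e / 2)%R) as [g [Hg E]]; [lra|].
  destruct (Hg (e / 2)%R) as [L [H1 H2]]; [lra|]. exists L. split; auto.
  intros xi Hxi. replace (f xi - laurent n L xi)
    with ((f xi - g xi) + (g xi - laurent n L xi)) by ring.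
  eapply Rle_trans; [apply Cmod_triangle|]. generalize (E xi Hxi) (H2 xi Hxi). lra.
Qed.

Lemma approx_plus r b n f g : (0 < r)%R -> approx r b n f -> approx r b n g ->
  approx r b n (fun xi => f xi + g xi).
Proof. intros. apply contour_plus; auto. Qed.

Lemma approx_opp r b n f : (0 < r)%R -> approx r b n f -> approx r b n (fun xi => - f xi).
Proof.
  intros Hr Hf. apply (approx_ext r b n (fun xi => - RtoC 1 * f xi)).
  - apply contour_scal; auto.
  - intros. ring.
Qed.

Lemma approx_minus r b n f g : (0 < r)%R -> approx r b n f -> approx r b n g ->
  approx r b n (fun xi => f xi - g xi).
Proof. intros. apply approx_plus; auto. apply approx_opp; auto. Qed.

Lemma approx_pow r b n f m : (0 < r)%R -> approx r b n f -> approx r b n (fun xi => f xi ^ m).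
Proof.
  intros Hr Hf. induction m as [|m IH]; simpl.
  - apply approx_const.
  - apply approx_mult; auto.
Qed.

Lemma approx_csum {A} r b n (l : list A) f : (0 < r)%R ->
  (forall a, In a l -> approx r b n (f a)) -> approx r b n (fun xi => csum l (fun a => f a xi)).
Proof.
  intros Hr. induction l as [|a l IH]; simpl; intros H.
  - apply approx_const.
  - apply approx_plus; auto.
Qed.

(** Uniform limit of the partial sums of the geometric series. The exponents stay nonnegative when
    those of [g] are, so analyticity survives this inversion. *)
Lemma approx_geometric r b n g rho : (0 < r)%R -> approx r b n g -> (0 <= rho < 1)%R ->
  (forall xi, torus r n xi -> (Cmod (g xi) <= rho)%R) ->
  approx r b n (fun xi => / (1 - g xi)).
Proof.
  intros Hr Hg Hrho Hb. apply approx_limit. intros e He.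
  destruct (pow_lt_1_zero rho) with (y := (e * (1 - rho))%R) as [M HM].
  { rewrite Rabs_pos_eq; lra. }
  { apply Rmult_lt_0_compat; lra. }
  specialize (HM M (le_n M)).
  exists (fun xi => csum (seq 0 M) (fun m => g xi ^ m)). split.
  - apply (approx_csum r b n (seq 0 M) (fun m xi => g xi ^ m)); auto.
    intros m _. apply approx_pow; auto.
  - intros xi Hxi. specialize (Hb xi Hxi). set (z := g xi) in *.
    assert (Hz : (1 - rho <= Cmod (1 - z))%R).
    { generalize (Cmod_triangle (1 - z) z). replace (1 - z + z) with (RtoC 1) by ring.
      rewrite Cmod_1. lra. }
    assert (Hnz : 1 - z <> 0) by (apply Cmod_gt_0; lra).
    assert (Hsum : forall m, csum (seq 0 m) (fun i => z ^ i) = (1 - z ^ m) / (1 - z)).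
    { induction m as [|m IH]; [simpl; field; auto|].
      rewrite seq_S, csum_app, IH. simpl. field. auto. }
    rewrite Hsum.
    replace (/ (1 - z) - (1 - z ^ M) / (1 - z)) with (z ^ M / (1 - z)) by (field; auto).
    rewrite Cmod_div, Cmod_pow by auto.
    apply Rmult_le_reg_r with (Cmod (1 - z)); [lra|].
    unfold Rdiv. rewrite Rmult_assoc, Rinv_l, Rmult_1_r by lra.
    apply Rle_trans with (rho ^ M)%R; [apply pow_incr; split; auto using Cmod_ge_0|].
    rewrite Rabs_pos_eq in HM by (apply pow_le; lra).
    apply Rlt_le. eapply Rlt_le_trans; [apply HM|]. apply Rmult_le_compat_l; lra.
Qed.

(** A Laurent polynomial within [eps] of [g] is within [2 eps] of [f], whence the factor 3. *)
Lemma contour_bound r b n f g eps : (0 < r)%R -> (0 < eps)%R ->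
  approx r b n f -> approx r b n g ->
  (forall xi, torus r n xi -> (Cmod (f xi - g xi) <= eps)%R) ->
  (Cmod (contour r n f - contour r n g) <= 3 * r ^ n * eps)%R.
Proof.
  intros Hr He Hf Hg H. destruct (Hg eps He) as [L [_ HL]].
  assert (H1 := contour_approx r b n g Hr Hg L eps HL).
  assert (H2 : (Cmod (contour r n f - residue n L) <= r ^ n * (2 * eps))%R).
  { apply (contour_approx r b n f Hr Hf). intros xi Hxi.
    replace (f xi - laurent n L xi) with ((f xi - g xi) + (g xi - laurent n L xi)) by ring.
    eapply Rle_trans; [apply Cmod_triangle|]. generalize (H xi Hxi) (HL xi Hxi). lra. }
  replace (contour r n f - contour r n g) with
    ((contour r n f - residue n L) + - (contour r n g - residue n L)) by ring.
  eapply Rle_trans; [apply Cmod_triangle|]. rewrite Cmod_opp. lra.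
Qed.

(** Cauchy's theorem in the variable [xi_j]: no approximant of the product contains [xi_j] to the
    power [-1]. *)
Lemma contour_vanish r n e g j : (0 < r)%R -> (1 <= j <= n)%nat -> (0 <= e j)%Z ->
  approx r true n g -> contour r n (fun xi => mono n e xi * g xi) = 0.
Proof.
  intros Hr Hj He Hg.
  assert (Ha : approx r false n (fun xi => mono n e xi * g xi)).
  { apply approx_mult; auto; [apply approx_mono|apply (approx_weaken r true); auto]. }
  apply (contour_unique r false n _ _ 1%R Hr Ha). intros d Hd.
  assert (HM := Cmod_mono r n e). set (M := Cmod (mono n e (fun _ => RtoC r))) in *.
  assert (HM0 : (0 <= M)%R) by apply Cmod_ge_0.
  destruct (Hg (d / (M + 1))%R) as [L [H1 H2]]; [apply Rdiv_lt_0_compat; lra|].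
  exists (lmul [(RtoC 1, e)] L). split.
  - intros xi Hxi. rewrite (laurent_lmul r) by auto.
    replace (laurent n [(RtoC 1, e)] xi) with (mono n e xi) by (unfold laurent; simpl; ring).
    replace (mono n e xi * g xi - mono n e xi * laurent n L xi)
      with (mono n e xi * (g xi - laurent n L xi)) by ring.
    rewrite Cmod_mult, HM by auto. specialize (H2 xi Hxi).
    replace d with ((M + 1) * (d / (M + 1)))%R by (field; lra).
    apply Rmult_le_compat; auto using Cmod_ge_0. lra.
  - replace (residue n (lmul [(RtoC 1, e)] L)) with (RtoC 0).
    + unfold Cminus. rewrite Cplus_opp_r, Cmod_0. lra.
    + symmetry. unfold residue. apply csum_zero. intros t Ht. unfold lmul in Ht. simpl in Ht.
      rewrite app_nil_r in Ht. apply in_map_iff in Ht. destruct Ht as [[c e'] [<- Ht]].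
      simpl. destruct (all_m1 n _) eqn:E; [|reflexivity].
      rewrite all_m1_spec in E. specialize (E j Hj). specialize (H1 _ Ht eq_refl j). simpl in *. lia.
Qed.

(** Membership of [g] in [approx r b n] leaves [xi_(n+1)] unconstrained while the approximants see
    only the first [n] variables; hence the last integral factors out. *)
Lemma contour_last r b n k g : (0 < r)%R -> approx r b n g ->
  contour r (S n) (fun xi => zpowC (xi (S n)) k * g xi) = if (k =? -1)%Z then contour r n g else 0.
Proof.
  intros Hr Hg. set (M := Cmod (zpowC (RtoC r) k)).
  assert (HM : (0 <= M)%R) by apply Cmod_ge_0.
  set (ext := fun L : list term =>
     map (fun t : term => (fst t, fun j => if (j =? S n)%nat then k else snd t j)) L).
  assert (Hn : forall j, (1 <= j <= n)%nat -> (j =? S n)%nat = false)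
    by (intros j Hj; apply Nat.eqb_neq; lia).
  assert (Hext : forall L xi, laurent (S n) (ext L) xi = zpowC (xi (S n)) k * laurent n L xi).
  { intros L xi. unfold laurent, ext. rewrite csum_map, <- csum_scal. apply csum_ext.
    intros [c e] _. simpl. rewrite Nat.eqb_refl.
    rewrite (mono_ext n _ e xi xi); [ring| |reflexivity].
    intros j Hj. rewrite Hn by auto. reflexivity. }
  assert (K : forall e, (0 < e)%R -> exists L,
    (forall xi, torus r n xi -> (Cmod (g xi - laurent n L xi) <= e / (M + 1))%R) /\
    forall xi, torus r (S n) xi ->
      (Cmod (zpowC (xi (S n)) k * g xi - laurent (S n) (ext L) xi) <= e)%R).
  { intros e He. destruct (Hg (e / (M + 1))%R) as [L [_ H2]]; [apply Rdiv_lt_0_compat; lra|].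
    exists L. split; auto. intros xi Hxi. rewrite Hext.
    replace (zpowC (xi (S n)) k * g xi - zpowC (xi (S n)) k * laurent n L xi)
      with (zpowC (xi (S n)) k * (g xi - laurent n L xi)) by ring.
    destruct (torus_S _ _ _ Hxi) as [Hxi' Hlast].
    rewrite Cmod_mult, (Cmod_zpowC _ (RtoC r)); fold M.
    - specialize (H2 xi Hxi'). replace e with ((M + 1) * (e / (M + 1)))%R by (field; lra).
      apply Rmult_le_compat; auto using Cmod_ge_0. lra.
    - rewrite Hlast, Cmod_R, Rabs_pos_eq; lra.
    - apply (torus_nz r (S n)); auto; lia.
    - apply RtoC_nz; lra. }
  assert (Ha : approx r false (S n) (fun xi => zpowC (xi (S n)) k * g xi)).
  { intros e He. destruct (K e He) as [L [_ H]]. exists (ext L). split; [discriminate|auto]. }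
  apply (contour_unique r false (S n) _ _ (r ^ n)%R Hr Ha). intros e He.
  destruct (K e He) as [L [H1 H2]]. exists (ext L). split; auto.
  replace (residue (S n) (ext L)) with (if (k =? -1)%Z then residue n L else RtoC 0).
  - destruct (k =? -1)%Z.
    + assert (H3 := contour_approx r b n g Hr Hg L _ H1).
      eapply Rle_trans; [apply H3|]. apply Rmult_le_compat_l; [apply pow_le; lra|].
      apply Rmult_le_reg_r with (M + 1)%R; [lra|].
      replace (e / (M + 1) * (M + 1))%R with e by (field; lra). nra.
    + unfold Cminus. rewrite Cplus_opp_r, Cmod_0. apply Rmult_le_pos; [apply pow_le|]; lra.
  - unfold residue, ext. rewrite csum_map. destruct (Z.eqb_spec k (-1)) as [Hk|Hk].
    + apply csum_ext. intros [c e'] _. simpl. rewrite Nat.eqb_refl.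
      rewrite (proj2 (Z.eqb_eq k (-1)) Hk), andb_true_r.
      replace (all_m1 n (fun j => if (j =? S n)%nat then k else e' j)) with (all_m1 n e'); auto.
      apply eq_true_iff_eq. rewrite !all_m1_spec. split; intros H j Hj; specialize (H j Hj);
        rewrite Hn in * by auto; auto.
    + symmetry. apply csum_zero. intros [c e'] _. simpl. rewrite Nat.eqb_refl.
      rewrite (proj2 (Z.eqb_neq k (-1)) Hk), andb_false_r. reflexivity.
Qed.

(** * The Hecke relations *)

(** The bound on the radius in the theorem is the positive root of [q r^2 + r = p]; below it
    [|a - q a b| < p] on the circle, which keeps every denominator away from zero. *)
Definition small_radius (p r : R) : Prop :=
  (0 < p < 1 /\ 0 < r /\ (1 - p) * (r * r) + r < p)%R.

(** The denominator [D] of the two-site matrix, with [a = xi_alpha] and [b = xi_beta]. The numerator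
    of its entry [S] is the same expression with the arguments exchanged. *)
Definition den (p : R) (a b : C) : C := RtoC p + RtoC (1 - p) * (a * b) - a.

Definition scat (p : R) (a b : C) : C := - (den p b a / den p a b).

Definition trans (p : R) (a b : C) : C := (b - a) / den p a b.

Definition word := nat -> nat.

Definition vec := (nat -> C) -> word -> C.

Definition rate (p : R) (k : nat) (w : word) : C :=
  if (w (S k) <? w k)%nat then RtoC p
  else if (w k <? w (S k))%nat then RtoC (1 - p) else 0.

(** Generator of the species exchange on the sites [k], [k+1] alone. It obeys Hecke relations: its
    square is its opposite ([hop_hop]), distant ones commute, and neighbours satisfy a deformed
    braid relation ([hop_braid]). *)
Definition hop (p : R) (k : nat) (v : word -> C) : word -> C :=
  fun w => rate p k w * (v (sw k w) - v w).

(* The right action of [T_k(k+1,k)] on row vectors, combined with the exchange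
   of the variables [k] and [k+1]: products of these operators compute the
   rows of [A_sigma]. *)
Definition rho (p : R) (k : nat) (Phi : vec) : vec :=
  fun xi w => scat p (xi k) (xi (S k)) * Phi (sw k xi) w
    + trans p (xi k) (xi (S k)) * hop p k (Phi (sw k xi)) w.

Definition rhos (p : R) (a : list nat) (Phi : vec) : vec := fold_right (rho p) Phi a.

Lemma small_radius_pos p r : small_radius p r -> (0 < r)%R.
Proof. intros H. apply H. Qed.

Lemma den_nz p r a b : small_radius p r -> Cmod a = r -> Cmod b = r -> den p a b <> 0.
Proof.
  intros [Hp [Hr H]] Ha Hb E.
  assert (K : RtoC p = a - RtoC (1 - p) * (a * b)).
  { replace (RtoC p) with (den p a b + (a - RtoC (1 - p) * (a * b))) by (unfold den; ring).
    rewrite E. ring. }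
  apply (f_equal Cmod) in K. rewrite Cmod_R, Rabs_pos_eq in K by lra.
  assert (T := Cmod_triangle a (- (RtoC (1 - p) * (a * b)))).
  rewrite Cmod_opp, !Cmod_mult, Cmod_R, Rabs_pos_eq, Ha, Hb in T by lra.
  unfold Cminus in K. lra.
Qed.

Lemma hop_lin p k a b (v u : word -> C) w :
  hop p k (fun w => a * v w + b * u w) w = a * hop p k v w + b * hop p k u w.
Proof. unfold hop. ring. Qed.

Lemma RtoC_1m p : RtoC (1 - p) = 1 - RtoC p.
Proof. rewrite RtoC_minus. reflexivity. Qed.

Lemma hop_hop p k v w : hop p k (hop p k v) w = - hop p k v w.
Proof.
  unfold hop, rate. rewrite sw_sw, sw_l, sw_r, RtoC_1m.
  destruct (Nat.ltb_spec (w (S k)) (w k)), (Nat.ltb_spec (w k) (w (S k))); try lia; ring.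
Qed.

Lemma hop_comm p k l v w : (S k < l)%nat -> hop p k (hop p l v) w = hop p l (hop p k v) w.
Proof.
  intros H. unfold hop, rate.
  rewrite !(sw_other k) by lia. rewrite !(sw_other l) by lia. rewrite (sw_comm k l) by lia.
  ring.
Qed.

(** For each relative order of the three letters the rates are known, and the claim is a polynomial
    identity in [p] and the values of [v] at the rearrangements of the letters. *)
Lemma hop_braid p k v w :
  hop p k (hop p (S k) (hop p k v)) w - RtoC p * RtoC (1 - p) * hop p k v w =
  hop p (S k) (hop p k (hop p (S k) v)) w - RtoC p * RtoC (1 - p) * hop p (S k) v w.
Proof.
  unfold hop, rate.
  rewrite (sw_braid k w). rewrite !sw_sw.
  repeat (rewrite sw_l || rewrite sw_r || (rewrite (sw_other k _ (S (S k))) by lia)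
    || (rewrite (sw_other (S k) _ k) by lia)).
  rewrite RtoC_1m.
  set (x := w k). set (y := w (S k)). set (z := w (S (S k))).
  (* Equal letters make some of the six rearrangements the same word, which has to be known before
     [ring] compares the two sides. *)
  assert (E1 : x = y -> sw k w = w /\
    sw (S k) (sw k (sw (S k) w)) = sw k (sw (S k) w)).
  { intros E. assert (F : sw k w = w).
    { apply functional_extensionality; intros j. unfold x, y in E. sw_cases; subst; congruence. }
    split; auto. rewrite <- sw_braid, F. reflexivity. }
  assert (E2 : y = z -> sw (S k) w = w /\
    sw (S k) (sw k (sw (S k) w)) = sw (S k) (sw k w)).
  { intros E. assert (F : sw (S k) w = w).
    { apply functional_extensionality; intros j. unfold y, z in E. sw_cases; subst; congruence. }
    split; auto. rewrite F. reflexivity. }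
  assert (E3 : x = z -> sw (S k) (sw k w) = sw k w /\ sw k (sw (S k) w) = sw (S k) w).
  { unfold x, z. intros E. split; apply functional_extensionality; intros j;
      sw_cases; subst; congruence. }
  destruct (Nat.ltb_spec x y), (Nat.ltb_spec y x), (Nat.ltb_spec y z), (Nat.ltb_spec z y),
    (Nat.ltb_spec x z), (Nat.ltb_spec z x); try lia;
  try (destruct E1 as [E1 E1']; [lia|]; rewrite ?E1', ?E1);
  try (destruct E2 as [E2 E2']; [lia|]; rewrite ?E2', ?E2);
  try (destruct E3 as [E3 E3']; [lia|]; rewrite ?E3, ?E3', ?sw_sw); try ring.
Qed.

Lemma hop_lin_fun p k a b (v u : word -> C) :
  hop p k (fun w => a * v w + b * u w) = fun w => a * hop p k v w + b * hop p k u w.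
Proof. apply functional_extensionality; intros w; apply hop_lin. Qed.

Lemma rho_at p k Phi e e' x y : e k = x -> e (S k) = y -> sw k e = e' ->
  rho p k Phi e = fun w => scat p x y * Phi e' w + trans p x y * hop p k (Phi e') w.
Proof. intros <- <- <-. reflexivity. Qed.

(** Equality is asked on the torus only, where the denominators do not vanish. *)
Definition eqv (r : R) (n : nat) (Phi Psi : vec) : Prop :=
  forall xi, torus r n xi -> forall w, Phi xi w = Psi xi w.

Lemma rho_eqv p r n k Phi Psi : (1 <= k < n)%nat ->
  eqv r n Phi Psi -> eqv r n (rho p k Phi) (rho p k Psi).
Proof.
  intros Hk H xi Hxi w. unfold rho, hop. rewrite !H by (apply torus_sw; auto). reflexivity.
Qed.

(** Unitarity of the two-site matrix: since [H^2 = -H], the composite is again a combination of [1]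
    and [H], and its coefficients become [1] and [0]. *)
Lemma rho_rho p r n k Phi : small_radius p r -> (1 <= k < n)%nat ->
  eqv r n (rho p k (rho p k Phi)) Phi.
Proof.
  intros Hp Hk xi Hxi w.
  assert (D1 : den p (xi k) (xi (S k)) <> 0) by (apply (den_nz p r); auto; apply Hxi; lia).
  assert (D2 : den p (xi (S k)) (xi k) <> 0) by (apply (den_nz p r); auto; apply Hxi; lia).
  unfold rho at 1.
  assert (E : rho p k Phi (sw k xi) = fun w => scat p (xi (S k)) (xi k) * Phi xi w
     + trans p (xi (S k)) (xi k) * hop p k (Phi xi) w).
  { apply functional_extensionality; intros u. unfold rho. rewrite sw_sw, sw_l, sw_r. reflexivity. }
  rewrite E, hop_lin, hop_hop. unfold scat, trans.
  generalize (hop p k (Phi xi) w). intros h.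
  generalize (Phi xi w). intros f.
  set (a := xi k) in *. set (b := xi (S k)) in *.
  (* The two denominators differ by [a - b], the only fact about them that [field] uses. *)
  assert (Dd : den p b a = den p a b + a - b) by (unfold den; ring).
  rewrite Dd in *. field. auto.
Qed.

Lemma rho_comm p r n k l Phi : small_radius p r -> (1 <= k)%nat -> (S k < l < n)%nat ->
  eqv r n (rho p k (rho p l Phi)) (rho p l (rho p k Phi)).
Proof.
  intros Hp Hk Hl xi Hxi w. unfold rho at 1 3.
  assert (E : rho p l Phi (sw k xi) = fun w => scat p (xi l) (xi (S l)) * Phi (sw k (sw l xi)) w
     + trans p (xi l) (xi (S l)) * hop p l (Phi (sw k (sw l xi))) w).
  { apply functional_extensionality; intros u. unfold rho.
    rewrite !(sw_other k) by lia. rewrite (sw_comm k l) by lia. reflexivity. }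
  assert (E' : rho p k Phi (sw l xi) = fun w => scat p (xi k) (xi (S k)) * Phi (sw k (sw l xi)) w
     + trans p (xi k) (xi (S k)) * hop p k (Phi (sw k (sw l xi))) w).
  { apply functional_extensionality; intros u. unfold rho.
    rewrite !(sw_other l) by lia. reflexivity. }
  rewrite E, E', !hop_lin, (hop_comm p k l) by lia. ring.
Qed.

Ltac sw_eval := first [reflexivity | symmetry; apply sw_braid |
  repeat (rewrite sw_l || rewrite sw_r || (rewrite sw_other by lia)); reflexivity].

(** Both sides read [Phi] at the same reversed triple of variables. Expanded in products of the two
    hops, they are compared after the product [h121] has been eliminated by [hop_braid]; what
    remains is an identity of rational functions in [a], [b], [c]. *)
Lemma rho_braid p r n k Phi : small_radius p r -> (1 <= k)%nat -> (S k < n)%nat ->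
  eqv r n (rho p k (rho p (S k) (rho p k Phi))) (rho p (S k) (rho p k (rho p (S k) Phi))).
Proof.
  intros Hp Hk Hn xi Hxi w.
  set (a := xi k). set (b := xi (S k)). set (c := xi (S (S k))).
  assert (Ha : Cmod a = r) by (apply Hxi; lia).
  assert (Hb : Cmod b = r) by (apply Hxi; lia).
  assert (Hc : Cmod c = r) by (apply Hxi; lia).
  assert (Dab := den_nz p r a b Hp Ha Hb).
  assert (Dac := den_nz p r a c Hp Ha Hc).
  assert (Dbc := den_nz p r b c Hp Hb Hc).
  set (xi0 := sw k (sw (S k) (sw k xi))).
  rewrite (rho_at p k (rho p (S k) (rho p k Phi)) xi (sw k xi) a b) by reflexivity.
  rewrite (rho_at p (S k) (rho p k Phi) (sw k xi) (sw (S k) (sw k xi)) a c) by sw_eval.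
  rewrite (rho_at p k Phi (sw (S k) (sw k xi)) xi0 b c) by sw_eval.
  rewrite (rho_at p (S k) (rho p k (rho p (S k) Phi)) xi (sw (S k) xi) b c) by reflexivity.
  rewrite (rho_at p k (rho p (S k) Phi) (sw (S k) xi) (sw k (sw (S k) xi)) a c) by sw_eval.
  rewrite (rho_at p (S k) Phi (sw k (sw (S k) xi)) xi0 a b) by sw_eval.
  set (F := Phi xi0).
  repeat rewrite hop_lin_fun.
  assert (HB := hop_braid p k F w).
  rewrite !hop_hop.
  set (h1 := hop p k F w) in *. set (h2 := hop p (S k) F w) in *.
  set (h12 := hop p k (hop p (S k) F) w) in *.
  set (h21 := hop p (S k) (hop p k F) w) in *.
  set (h121 := hop p k (hop p (S k) (hop p k F)) w) in *.
  set (h212 := hop p (S k) (hop p k (hop p (S k) F)) w) in *.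
  assert (E : h121 = h212 + RtoC p * RtoC (1 - p) * (h1 - h2)).
  { replace h121 with (h121 - RtoC p * RtoC (1 - p) * h1 + RtoC p * RtoC (1 - p) * h1) by ring.
    rewrite HB. ring. }
  rewrite E. clearbody h1 h2 h12 h21 h121 h212. generalize (F w). intros f.
  clear HB E. unfold scat, trans.
  unfold den in *. rewrite RtoC_1m in *. field. auto.
Qed.

(** * Words in the adjacent transpositions *)

Definition gens (n : nat) (a : list nat) : Prop := List.Forall (fun k => (1 <= k < n)%nat) a.

(** Congruence generated by the Coxeter relations. In a context the prefix [c] is kept in range
    because [rhos] applies it last, to vectors known to be equal on the torus only; the suffix is
    absorbed into the arbitrary vector. *)
Inductive cox (n : nat) : list nat -> list nat -> Prop :=
| cox_refl a : cox n a a
| cox_sym a b : cox n a b -> cox n b a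
| cox_trans a b c : cox n a b -> cox n b c -> cox n a c
| cox_ctx a b c d : gens n c -> cox n a b -> cox n (c ++ a ++ d) (c ++ b ++ d)
| cox_square k : (1 <= k < n)%nat -> cox n [k; k] []
| cox_braid k : (1 <= k)%nat -> (S k < n)%nat -> cox n [k; S k; k] [S k; k; S k]
| cox_comm k l : (1 <= k)%nat -> (S k < l < n)%nat -> cox n [k; l] [l; k].

Lemma rhos_app p a b Phi : rhos p (a ++ b) Phi = rhos p a (rhos p b Phi).
Proof. apply fold_right_app. Qed.

Lemma rhos_eqv p r n a Phi Psi : gens n a -> eqv r n Phi Psi ->
  eqv r n (rhos p a Phi) (rhos p a Psi).
Proof.
  intros Ha H. induction Ha as [|k a Hk Ha IH]; simpl; auto.
  apply rho_eqv; auto.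
Qed.

Lemma cox_rhos p r n a b : small_radius p r -> cox n a b ->
  forall Phi, eqv r n (rhos p a Phi) (rhos p b Phi).
Proof.
  intros Hp. induction 1 as [a|a b _ IH|a b c _ IH1 _ IH2|a b c d Hc _ IH|k Hk|k H1 H2|k l H1 H2];
    intros Phi.
  - intros xi _ w. reflexivity.
  - intros xi Hxi w. symmetry. apply IH; auto.
  - intros xi Hxi w. rewrite IH1 by auto. apply IH2; auto.
  - rewrite !rhos_app. apply rhos_eqv; auto.
  - apply rho_rho; auto.
  - apply rho_braid; auto.
  - apply rho_comm; auto.
Qed.

Definition act (a : list nat) (f : nat -> nat) : nat -> nat :=
  fold_left (fun g k => sw k g) a f.

Lemma act_app a b f : act (a ++ b) f = act b (act a f).
Proof. apply fold_left_app. Qed.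

Lemma cox_act n a b : cox n a b -> forall f, act a f = act b f.
Proof.
  induction 1 as [a|a b _ IH|a b c _ IH1 _ IH2|a b c d Hc _ IH|k Hk|k H1 H2|k l H1 H2];
    intros f; simpl; auto.
  - rewrite IH1. apply IH2.
  - rewrite !act_app, IH. reflexivity.
  - apply sw_sw.
  - apply sw_braid.
  - symmetry. apply sw_comm. lia.
Qed.

Lemma gens_app n a b : gens n (a ++ b) <-> gens n a /\ gens n b.
Proof. apply Forall_app. Qed.

Lemma cox_weaken n a b : cox n a b -> cox (S n) a b.
Proof.
  induction 1 as [a|a b _ IH|a b c _ IH1 _ IH2|a b c d Hc _ IH|k Hk|k H1 H2|k l H1 H2].
  - apply cox_refl.
  - apply cox_sym; auto.
  - eapply cox_trans; eauto.
  - apply cox_ctx; auto. eapply Forall_impl; [|apply Hc]. simpl; intros; lia.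
  - apply cox_square; lia.
  - apply cox_braid; lia.
  - apply cox_comm; lia.
Qed.

Lemma cox_app n a b c d : gens n a -> cox n a b -> cox n c d -> cox n (a ++ c) (b ++ d).
Proof.
  intros Ha H1 H2. apply cox_trans with (a ++ d).
  - rewrite <- (app_nil_r c), <- (app_nil_r d). apply cox_ctx; auto.
  - apply (cox_ctx n a b [] d); auto. constructor.
Qed.

Lemma cox_prefix n c a b : gens n c -> cox n a b -> cox n (c ++ a) (c ++ b).
Proof. intros Hc H. apply cox_app; auto. apply cox_refl. Qed.

Lemma cox_suffix n a b d : cox n a b -> cox n (a ++ d) (b ++ d).
Proof. intros H. apply (cox_ctx n a b [] d); auto. constructor. Qed.

(** The word [j+m-1, ..., j], which carries the entry at position [j+m] down to position [j]. For
    [j+m = n+1] these runs represent the cosets of the symmetric group on [n] letters in the one on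
    [n+1]. *)
Definition down (j m : nat) : list nat := rev (seq j m).

Lemma down_S j m : down j (S m) = down (S j) m ++ [j].
Proof. reflexivity. Qed.

Lemma gens_down n j m : (1 <= j)%nat -> (j + m <= n)%nat -> gens n (down j m).
Proof.
  intros Hj Hm. apply Forall_rev, Forall_forall. intros k Hk. apply in_seq in Hk. lia.
Qed.

Lemma cox_commute n k l : (1 <= k < n)%nat -> List.Forall (fun i => (S k < i < n)%nat) l ->
  cox n (l ++ [k]) (k :: l).
Proof.
  intros Hk Hl. induction Hl as [|i l Hi Hl IH]; simpl; [apply cox_refl|].
  apply cox_trans with (i :: k :: l).
  - apply (cox_prefix n [i]); auto. constructor; auto; lia.
  - apply (cox_suffix n [i; k] [k; i] l). apply cox_sym, cox_comm; lia.
Qed.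

(** The letter [l+1] commutes with the lower end of the run until it meets [l], is turned into [l]
    by a braid move, and commutes out on the left. *)
Lemma cox_down_braid n m : forall j l, (1 <= j <= l)%nat -> (S l < j + m)%nat -> (j + m <= n)%nat ->
  cox n (down j m ++ [S l]) (l :: down j m).
Proof.
  induction m as [|m IH]; intros j l Hj Hl Hn; [lia|].
  destruct (Nat.eq_dec l j) as [->|Hne].
  - destruct m as [|m]; [lia|].
    rewrite !down_S, <- !app_assoc. simpl.
    apply cox_trans with (down (S (S j)) m ++ [j; S j; j]).
    + apply cox_prefix; [apply gens_down; lia|]. apply cox_sym, cox_braid; lia.
    + apply (cox_trans _ _ ((down (S (S j)) m ++ [j]) ++ [S j; j])).
      { rewrite <- app_assoc. apply cox_refl. }
      apply (cox_suffix n _ (j :: down (S (S j)) m)). apply cox_commute; [lia|].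
      apply Forall_rev, Forall_forall. intros i Hi. apply in_seq in Hi. lia.
  - rewrite down_S, <- app_assoc. simpl.
    apply cox_trans with (down (S j) m ++ [S l; j]).
    + apply cox_prefix; [apply gens_down; lia|]. apply cox_comm; lia.
    + apply (cox_trans _ _ ((down (S j) m ++ [S l]) ++ [j])).
      { rewrite <- app_assoc. apply cox_refl. }
      apply (cox_suffix n _ (l :: down (S j) m)). apply IH; lia.
Qed.

(** One generator [k] is appended to a word already in normal form: it commutes with the run into
    the prefix, lengthens or shortens the run, or passes through it with its index lowered by
    one. *)
Lemma cox_normal_form n a : gens (S n) a ->
  exists u j m, gens n u /\ (1 <= j)%nat /\ (j + m = S n)%nat /\ cox (S n) a (u ++ down j m).
Proof.
  induction a as [|k a IH] using rev_ind; intros Ha.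
  - exists [], (S n), 0%nat. repeat split; try lia; [constructor|apply cox_refl].
  - apply gens_app in Ha. destruct Ha as [Ha Hk]. inversion Hk as [|? ? Hk' _]; subst.
    destruct (IH Ha) as [u [j [m [Hu [Hj [Hm Hc]]]]]].
    assert (Hu' : gens (S n) u) by (eapply Forall_impl; [|apply Hu]; simpl; intros; lia).
    assert (Hc' : cox (S n) (a ++ [k]) (u ++ down j m ++ [k])).
    { rewrite app_assoc. apply cox_suffix; auto. }
    destruct (lt_eq_lt_dec k j) as [[Hlt|Heq]|Hgt].
    + destruct (Nat.eq_dec (S k) j) as [<-|Hne].
      * exists u, k, (S m). repeat split; auto; lia.
      * exists (u ++ [k]), j, m. repeat split; auto; try lia.
        -- apply gens_app; split; auto. constructor; [lia|constructor].
        -- eapply cox_trans; [apply Hc'|]. rewrite <- app_assoc. apply cox_prefix; auto.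
           apply cox_commute; [lia|].
           apply Forall_rev, Forall_forall. intros i Hi. apply in_seq in Hi. lia.
    + subst k. destruct m as [|m]; [lia|].
      exists u, (S j), m. repeat split; auto; try lia.
      eapply cox_trans; [apply Hc'|]. apply cox_prefix; auto.
      rewrite down_S, <- app_assoc. simpl.
      eapply cox_trans; [apply cox_prefix; [apply gens_down; lia|apply cox_square; lia]|].
      rewrite app_nil_r. apply cox_refl.
    + destruct k as [|l]; [lia|].
      exists (u ++ [l]), j, m. repeat split; auto; try lia.
      * apply gens_app; split; auto. constructor; [lia|constructor].
      * eapply cox_trans; [apply Hc'|]. rewrite <- app_assoc. apply cox_prefix; auto.
        apply cox_down_braid; lia.
Qed.

Lemma act_down j m f : act (down j m) f j = f (j + m)%nat.
Proof.
  revert j. induction m as [|m IH]; intros j.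
  - rewrite Nat.add_0_r. reflexivity.
  - rewrite down_S, act_app. simpl. rewrite sw_l, IH. f_equal. lia.
Qed.

Lemma act_out n a f j : gens n a -> (j = 0 \/ n < j)%nat -> act a f j = f j.
Proof.
  intros Ha Hj. revert f. induction Ha as [|k a Hk Ha IH]; intros f; [reflexivity|].
  simpl. rewrite IH, sw_other by lia. reflexivity.
Qed.

(** The run of the normal form puts the letter [n+1] at position [j]. A word acting trivially
    therefore has an empty run, and its prefix is treated by induction. *)
Lemma cox_of_act_id n a : gens n a -> (forall j, act a (fun i => i) j = j) -> cox n a [].
Proof.
  revert a. induction n as [|n IH]; intros a Ha H.
  - destruct Ha as [|k a Hk Ha]; [apply cox_refl|lia].
  - destruct (cox_normal_form n a Ha) as [u [j [m [Hu [Hj [Hm Hc]]]]]].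
    assert (Hact := cox_act _ _ _ Hc (fun i => i)). rewrite act_app in Hact.
    assert (E : j = S n).
    { specialize (H j). rewrite Hact, act_down, (act_out n) in H by (auto; lia). lia. }
    subst j. replace m with 0%nat in * by lia.
    unfold down in Hc, Hact; simpl in Hc, Hact. rewrite app_nil_r in Hc.
    eapply cox_trans; [apply Hc|]. apply cox_weaken, IH; auto.
    intros i. rewrite <- Hact. auto.
Qed.

Lemma cox_rev_cancel n a : gens n a -> cox n (rev a ++ a) [].
Proof.
  intros Ha. induction Ha as [|k a Hk Ha IH]; simpl; [apply cox_refl|].
  rewrite <- app_assoc. simpl.
  eapply cox_trans; [|apply IH].
  apply (cox_ctx n [k; k] [] (rev a) a); [apply Forall_rev; auto|apply cox_square; auto].
Qed.

Lemma act_rev_cancel a f : act (rev a) (act a f) = f.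
Proof.
  revert f. induction a as [|k a IH]; intros f; simpl; [reflexivity|].
  rewrite act_app, IH. apply sw_sw.
Qed.

(** Completeness of the presentation: with [cox_rhos] it shows that the effect of a word on vectors
    depends only on the permutation. *)
Lemma cox_of_act n a b : gens n a -> gens n b ->
  (forall j, act a (fun i => i) j = act b (fun i => i) j) -> cox n a b.
Proof.
  intros Ha Hb H. apply functional_extensionality in H.
  apply cox_trans with ((a ++ rev b) ++ b).
  - rewrite <- app_assoc. rewrite <- (app_nil_r a) at 1.
    apply cox_prefix; auto. apply cox_sym, cox_rev_cancel; auto.
  - apply (cox_suffix n _ []). apply cox_of_act_id.
    + apply gens_app; split; auto. apply Forall_rev; auto.
    + intros j. rewrite act_app, H, act_rev_cancel. reflexivity.
Qed.

(** * Symmetrisation over the symmetric group *)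

(* Positions are counted from 1; every other argument gives [d]. *)
Definition fn {A} (d : A) (l : list A) : nat -> A := fun j => nth j (d :: l) d.

Lemma fn_ext {A} (d : A) l l' : length l = length l' ->
  (forall j, (1 <= j <= length l)%nat -> fn d l j = fn d l' j) -> l = l'.
Proof.
  intros Hl H. apply (nth_ext _ _ d d Hl). intros i Hi. apply (H (S i)). lia.
Qed.

Lemma swap_at_app l1 x y l2 :
  swap_at (S (length l1)) (l1 ++ x :: y :: l2) = l1 ++ y :: x :: l2.
Proof.
  unfold swap_at. simpl (S (length l1) - 1)%nat. rewrite Nat.sub_0_r.
  rewrite firstn_app, Nat.sub_diag, firstn_all, app_nil_r.
  rewrite !app_nth2 by lia. rewrite Nat.sub_diag.
  replace (S (length l1) - length l1)%nat with 1%nat by lia. simpl nth.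
  f_equal. rewrite skipn_app, skipn_all2 by lia.
  replace (S (S (length l1)) - length l1)%nat with 2%nat by lia. reflexivity.
Qed.

Lemma split_at k (l : list nat) : (1 <= k < length l)%nat ->
  exists l1 x y l2, l = l1 ++ x :: y :: l2 /\ k = S (length l1).
Proof.
  intros Hk. exists (firstn (k - 1) l).
  destruct (skipn (k - 1) l) as [|x [|y l2]] eqn:E.
  - apply (f_equal (@length nat)) in E. rewrite length_skipn in E. simpl in E. lia.
  - apply (f_equal (@length nat)) in E. rewrite length_skipn in E. simpl in E. lia.
  - exists x, y, l2. split.
    + rewrite <- E, firstn_skipn. reflexivity.
    + rewrite length_firstn. lia.
Qed.

Lemma fn_swap_at k l : (1 <= k < length l)%nat -> fn 0%nat (swap_at k l) = sw k (fn 0%nat l).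
Proof.
  intros Hk. destruct (split_at k l Hk) as [l1 [x [y [l2 [-> ->]]]]].
  rewrite swap_at_app. apply functional_extensionality. intros [|i]; [reflexivity|].
  unfold sw, fn. simpl nth.
  destruct (Nat.eqb_spec (S i) (S (length l1))), (Nat.eqb_spec (S i) (S (S (length l1)))); try lia.
  - replace i with (length l1) by lia.
    rewrite !app_nth2 by lia. rewrite Nat.sub_diag.
    replace (S (length l1) - length l1)%nat with 1%nat by lia. reflexivity.
  - replace i with (S (length l1)) by lia. rewrite !app_nth2 by lia. rewrite Nat.sub_diag.
    replace (S (length l1) - length l1)%nat with 1%nat by lia. reflexivity.
  - destruct (Nat.lt_ge_cases i (length l1)).
    + rewrite !app_nth1 by lia. reflexivity.
    + rewrite !app_nth2 by lia. destruct (i - length l1)%nat as [|[|m]] eqn:E; try lia.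
      reflexivity.
Qed.

Lemma Permutation_swap_at k l : (1 <= k < length l)%nat -> Permutation l (swap_at k l).
Proof.
  intros Hk. destruct (split_at k l Hk) as [l1 [x [y [l2 [-> ->]]]]].
  rewrite swap_at_app. apply Permutation_app_head, perm_swap.
Qed.

Lemma length_swap_at k l : (1 <= k < length l)%nat -> length (swap_at k l) = length l.
Proof. intros H. symmetry. apply Permutation_length, Permutation_swap_at, H. Qed.

Lemma in_words_len m n w : In w (words_len m n) <->
  length w = m /\ forall a, In a w -> (1 <= a <= n)%nat.
Proof.
  revert w. induction m as [|m IH]; intros w; simpl.
  - split.
    + intros [<-|[]]. split; [reflexivity|intros a []].
    + intros [H _]. destruct w; [auto|discriminate].
  - rewrite in_flat_map. split.
    + intros [a [Ha Hw]]. apply in_map_iff in Hw. destruct Hw as [w' [<- Hw']].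
      apply IH in Hw'. destruct Hw' as [H1 H2]. apply in_seq in Ha. simpl. split; [lia|].
      intros b [<-|Hb]; [lia|auto].
    + intros [H1 H2]. destruct w as [|a w]; [discriminate|]. exists a. split.
      * apply in_seq. specialize (H2 a (or_introl eq_refl)). lia.
      * apply in_map, IH. split; [simpl in H1; lia|]. intros b Hb. apply H2. right; auto.
Qed.

Lemma NoDup_words_len m n : NoDup (words_len m n).
Proof.
  induction m as [|m IH]; simpl; [constructor; [intros []|constructor]|].
  assert (G : forall l, NoDup l -> NoDup (flat_map (fun a : nat => map (cons a) (words_len m n)) l)).
  { induction l as [|a l IHl]; simpl; intros Hl; [constructor|].
    inversion Hl as [|? ? Ha Hl']; subst. apply NoDup_app; auto.
    - apply FinFun.Injective_map_NoDup; auto. intros x y E. congruence.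
    - intros w Hw Hw'. apply in_map_iff in Hw. destruct Hw as [w1 [<- _]].
      apply in_flat_map in Hw'. destruct Hw' as [b [Hb Hw']].
      apply in_map_iff in Hw'. destruct Hw' as [w2 [E _]]. congruence. }
  apply G, seq_NoDup.
Qed.

Lemma in_perms n s : In s (perms n) <-> Permutation (seq 1 n) s.
Proof.
  unfold perms, words, is_permb. rewrite filter_In, in_words_len, forallb_forall. split.
  - intros [[H1 H2] H3]. apply NoDup_Permutation_bis.
    + apply seq_NoDup.
    + rewrite H1, length_seq. lia.
    + intros a Ha. specialize (H3 a Ha). apply existsb_exists in H3.
      destruct H3 as [b [Hb E]]. apply Nat.eqb_eq in E. subst; auto.
  - intros H. split; [split|].
    + rewrite <- (Permutation_length H). apply length_seq.
    + intros a Ha. apply (Permutation_in _ (Permutation_sym H)), in_seq in Ha. lia.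
    + intros a Ha. apply existsb_exists. exists a. split; [|apply Nat.eqb_refl].
      apply (Permutation_in _ H); auto.
Qed.

Lemma NoDup_perms n : NoDup (perms n).
Proof. apply NoDup_filter, NoDup_words_len. Qed.

Lemma apply_seq_app a b s : apply_seq (a ++ b) s = apply_seq b (apply_seq a s).
Proof. apply fold_left_app. Qed.

Lemma Permutation_apply_seq a s : gens (length s) a -> Permutation s (apply_seq a s).
Proof.
  intros Ha. remember (length s) as n eqn:E. revert s E.
  induction Ha as [|k a Hk Ha IH]; intros s E; simpl; [reflexivity|].
  subst n. transitivity (swap_at k s); [apply Permutation_swap_at; auto|].
  apply IH. symmetry. apply length_swap_at; auto.
Qed.

Lemma fn_apply_seq a s : gens (length s) a -> fn 0%nat (apply_seq a s) = act a (fn 0%nat s).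
Proof.
  intros Ha. remember (length s) as n eqn:E. revert s E.
  induction Ha as [|k a Hk Ha IH]; intros s E; simpl; [reflexivity|].
  subst n. rewrite <- fn_swap_at by auto. apply IH. symmetry. apply length_swap_at; auto.
Qed.

Lemma fn_seq n j : fn 0%nat (seq 1 n) j = if (j <=? n)%nat then j else 0%nat.
Proof.
  destruct j as [|j]; [reflexivity|]. unfold fn. simpl nth.
  destruct (Nat.leb_spec (S j) n).
  - rewrite seq_nth by lia. lia.
  - apply nth_overflow. rewrite length_seq. lia.
Qed.

Lemma act_agree n a f g : gens n a -> (forall j, (j <= n)%nat -> f j = g j) ->
  forall j, (j <= n)%nat -> act a f j = act a g j.
Proof.
  intros Ha. revert f g. induction Ha as [|k a Hk Ha IH]; intros f g H j Hj; simpl; auto.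
  apply IH; auto. intros i Hi. unfold sw. destruct (i =? k)%nat; [apply H; lia|].
  destruct (i =? S k)%nat; apply H; lia.
Qed.

Definition perm_of (n : nat) (a : list nat) : list nat := apply_seq a (seq 1 n).

Lemma perm_of_perms n a : gens n a -> In (perm_of n a) (perms n).
Proof.
  intros Ha. apply in_perms, Permutation_apply_seq. rewrite length_seq. auto.
Qed.

Lemma length_perm n s : In s (perms n) -> length s = n.
Proof. intros H. apply in_perms, Permutation_length in H. rewrite length_seq in H. auto. Qed.

Lemma fn_perm_of n a j : gens n a -> (j <= n)%nat -> fn 0%nat (perm_of n a) j = act a (fun i => i) j.
Proof.
  intros Ha Hj. unfold perm_of. rewrite fn_apply_seq by (rewrite length_seq; auto).
  apply (act_agree n); auto. intros i Hi. rewrite fn_seq.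
  destruct (Nat.leb_spec i n); [reflexivity|lia].
Qed.

Lemma perm_of_cox n a b : gens n a -> gens n b -> (perm_of n a = perm_of n b <-> cox n a b).
Proof.
  intros Ha Hb. split; intros H.
  - apply cox_of_act; auto. intros j. destruct (Nat.le_gt_cases j n) as [Hj|Hj].
    + rewrite <- !(fn_perm_of n) by auto. rewrite H. reflexivity.
    + rewrite !(act_out n) by auto. reflexivity.
  - apply (fn_ext 0%nat).
    + rewrite !(length_perm n) by (apply perm_of_perms; auto). reflexivity.
    + rewrite (length_perm n) by (apply perm_of_perms; auto). intros j Hj.
      rewrite !fn_perm_of by (auto; lia). rewrite (cox_act n a b H). reflexivity.
Qed.

Lemma swap_at_app_l k l l' : (1 <= k < length l)%nat -> swap_at k (l ++ l') = swap_at k l ++ l'.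
Proof.
  intros Hk. destruct (split_at k l Hk) as [l1 [x [y [l2 [-> ->]]]]].
  rewrite <- app_assoc. simpl. rewrite !swap_at_app, <- app_assoc. reflexivity.
Qed.

Lemma apply_seq_app_l a l l' : gens (length l) a -> apply_seq a (l ++ l') = apply_seq a l ++ l'.
Proof.
  intros Ha. remember (length l) as n eqn:E. revert l E.
  induction Ha as [|k a Hk Ha IH]; intros l E; simpl; [reflexivity|].
  subst n. rewrite swap_at_app_l by auto. apply IH. symmetry. apply length_swap_at; auto.
Qed.

Lemma apply_seq_down l2 : forall l1 x,
  apply_seq (down (S (length l1)) (length l2)) (l1 ++ l2 ++ [x]) = l1 ++ x :: l2.
Proof.
  induction l2 as [|y l2 IH]; intros l1 x; simpl length; [reflexivity|].
  rewrite down_S, apply_seq_app.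
  specialize (IH (l1 ++ [y]) x). rewrite length_app, Nat.add_1_r, <- !app_assoc in IH.
  simpl in IH |- *. rewrite IH. apply swap_at_app.
Qed.

(** Delete the letter [n+1], decompose the remaining permutation, and bring [n+1] back from the last
    position with a descending run. *)
Lemma perm_decomposition n s : In s (perms n) -> exists a, gens n a /\ perm_of n a = s.
Proof.
  revert s. induction n as [|n IH]; intros s Hs.
  - exists []. split; [constructor|]. apply length_perm in Hs. destruct s; [reflexivity|discriminate].
  - apply in_perms in Hs. rewrite seq_S in Hs.
    assert (Hin : In (S n) s) by (apply (Permutation_in _ Hs), in_or_app; right; left; reflexivity).
    destruct (in_split _ _ Hin) as [l1 [l2 ->]].
    assert (Hs' : In (l1 ++ l2) (perms n)).
    { apply in_perms. rewrite <- (app_nil_r (seq 1 n)).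
      apply (Permutation_app_inv _ _ _ _ (S n)). exact Hs. }
    destruct (IH _ Hs') as [a [Ha E]]. assert (Hl := length_perm _ _ Hs').
    rewrite length_app in Hl.
    exists (a ++ down (S (length l1)) (length l2)). split.
    + apply gens_app. split; [eapply Forall_impl; [|apply Ha]; simpl; intros; lia|].
      apply gens_down; lia.
    + unfold perm_of in *. rewrite seq_S, apply_seq_app, apply_seq_app_l
        by (rewrite length_seq; auto).
      rewrite E, <- app_assoc. apply apply_seq_down.
Qed.

Definition decomp (n : nat) (dec : list nat -> list nat) : Prop :=
  forall s, In s (perms n) -> gens n (dec s) /\ perm_of n (dec s) = s.

(** Serves the smaller systems met in the induction on the number of particles, for which the
    theorem supplies no decomposition. *)
Lemma decomp_exists n : exists dec, decomp n dec.
Proof.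
  exists (fun s => epsilon (inhabits []) (fun a => gens n a /\ perm_of n a = s)).
  intros s Hs. apply epsilon_spec, perm_decomposition, Hs.
Qed.

Definition sym (p : R) (n : nat) (dec : list nat -> list nat) (Phi : vec) : vec :=
  fun xi w => csum (perms n) (fun s => rhos p (dec s) Phi xi w).

(** An injective map of the finite set of permutations into itself is a bijection, so any family [b]
    of words, inequivalent for distinct permutations, may index the sum. *)
Lemma sym_reindex p r n dec (b : list nat -> list nat) Phi :
  small_radius p r -> decomp n dec ->
  (forall s, In s (perms n) -> gens n (b s)) ->
  (forall s s', In s (perms n) -> In s' (perms n) -> cox n (b s) (b s') -> cox n (dec s) (dec s')) ->
  eqv r n (fun xi w => csum (perms n) (fun s => rhos p (b s) Phi xi w)) (sym p n dec Phi).
Proof.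
  intros Hp Hd Hb Hinj xi Hxi w. unfold sym.
  set (phi s := perm_of n (b s)).
  transitivity (csum (perms n) (fun s => rhos p (dec (phi s)) Phi xi w)).
  - apply csum_ext. intros s Hs. apply (cox_rhos p r n); auto.
    assert (Hphi : In (phi s) (perms n)) by (apply perm_of_perms; auto).
    destruct (Hd _ Hphi) as [H1 H2]. apply perm_of_cox; auto.
  - rewrite <- (csum_map phi (perms n) (fun s => rhos p (dec s) Phi xi w)).
    apply csum_Permutation. apply NoDup_Permutation_bis.
    + apply FinFun.Injective_map_NoDup_in; [|apply NoDup_perms].
      intros s s' Hs Hs' E. apply perm_of_cox in E; auto.
      apply Hinj in E; auto. destruct (Hd _ Hs) as [H1 H2]. destruct (Hd _ Hs') as [H3 H4].
      apply perm_of_cox in E; auto. congruence.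
    + rewrite length_map. lia.
    + intros s Hs. apply in_map_iff in Hs. destruct Hs as [s' [<- Hs']]. apply perm_of_perms; auto.
Qed.

(** Appending [k] to every word is translation by a transposition, undone by appending [k] again. *)
Lemma sym_rho p r n dec k Phi : small_radius p r -> decomp n dec -> (1 <= k < n)%nat ->
  eqv r n (sym p n dec (rho p k Phi)) (sym p n dec Phi).
Proof.
  intros Hp Hd Hk xi Hxi w.
  rewrite <- (sym_reindex p r n dec (fun s => dec s ++ [k]) Phi); auto.
  - apply csum_ext. intros s _. rewrite rhos_app. reflexivity.
  - intros s Hs. apply gens_app. split; [apply Hd, Hs|constructor; [auto|constructor]].
  - intros s s' Hs Hs' E. apply (cox_suffix n _ _ [k]) in E. rewrite <- !app_assoc in E.
    destruct (Hd _ Hs) as [H1 _]. destruct (Hd _ Hs') as [H2 _].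
    assert (C : forall a, gens n a -> cox n (a ++ [k] ++ [k]) a).
    { intros a Ha. rewrite <- (app_nil_r a) at 2. apply cox_prefix; auto. apply cox_square; auto. }
    eapply cox_trans; [apply cox_sym, C; auto|]. eapply cox_trans; [apply E|]. apply C; auto.
Qed.

Lemma hop_csum {A} p k (l : list A) (F : A -> word -> C) w :
  hop p k (fun w => csum l (fun s => F s w)) w = csum l (fun s => hop p k (F s) w).
Proof.
  induction l as [|a l IH]; simpl; [unfold hop; ring|].
  rewrite <- IH. unfold hop. ring.
Qed.

Lemma rho_sym p r n dec k Phi : small_radius p r -> decomp n dec -> (1 <= k < n)%nat ->
  eqv r n (rho p k (sym p n dec Phi)) (sym p n dec Phi).
Proof.
  intros Hp Hd Hk xi Hxi w.
  rewrite <- (sym_reindex p r n dec (fun s => k :: dec s) Phi); auto.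
  - unfold rho, sym. rewrite hop_csum, <- !csum_scal, <- csum_plus. reflexivity.
  - intros s Hs. constructor; auto. apply Hd, Hs.
  - intros s s' Hs Hs' E.
    apply (cox_prefix n [k]) in E; [|constructor; [auto|constructor]].
    assert (C : forall a, cox n ([k] ++ k :: a) a).
    { intros a. apply (cox_suffix n [k; k] [] a). apply cox_square; auto. }
    eapply cox_trans; [apply cox_sym, C|]. eapply cox_trans; [apply E|]. apply C.
Qed.

Lemma sym_eqv p r n dec Phi Psi : decomp n dec -> eqv r n Phi Psi ->
  eqv r n (sym p n dec Phi) (sym p n dec Psi).
Proof.
  intros Hd H xi Hxi w. apply csum_ext. intros s Hs. apply (rhos_eqv p r n); auto. apply Hd, Hs.
Qed.

Lemma rhos_plus p a Phi Psi xi w :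
  rhos p a (fun xi w => Phi xi w + Psi xi w) xi w = rhos p a Phi xi w + rhos p a Psi xi w.
Proof.
  revert xi w. induction a as [|k a IH]; intros xi w; simpl; [reflexivity|].
  unfold rho, hop. rewrite !IH. ring.
Qed.

(** Among the ingredients of [rho] only the exchange of variables touches [g], so a symmetric factor
    passes through. *)
Lemma rhos_scal p n a g Phi xi w : gens n a ->
  (forall k xi, (1 <= k < n)%nat -> g (sw k xi) = g xi) ->
  rhos p a (fun xi w => g xi * Phi xi w) xi w = g xi * rhos p a Phi xi w.
Proof.
  intros Ha Hg. revert xi w. induction Ha as [|k a Hk Ha IH]; intros xi w; simpl; [reflexivity|].
  unfold rho, hop. rewrite !IH, !Hg by auto. ring.
Qed.

Lemma sym_plus p n dec Phi Psi xi w :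
  sym p n dec (fun xi w => Phi xi w + Psi xi w) xi w = sym p n dec Phi xi w + sym p n dec Psi xi w.
Proof.
  unfold sym. rewrite <- csum_plus. apply csum_ext. intros s _. apply rhos_plus.
Qed.

Lemma sym_scal p n dec g Phi xi w : decomp n dec ->
  (forall k xi, (1 <= k < n)%nat -> g (sw k xi) = g xi) ->
  sym p n dec (fun xi w => g xi * Phi xi w) xi w = g xi * sym p n dec Phi xi w.
Proof.
  intros Hd Hg. unfold sym. rewrite <- csum_scal. apply csum_ext. intros s Hs.
  apply (rhos_scal p n); auto. apply Hd, Hs.
Qed.

(** * Analyticity of the symmetrised rows *)

Definition approx_vec (r : R) (b : bool) (n : nat) (Phi : vec) : Prop :=
  forall w, approx r b n (fun xi => Phi xi w).

Lemma approx_den p r b n i j : (0 < r)%R -> (1 <= i <= n)%nat -> (1 <= j <= n)%nat ->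
  approx r b n (fun xi => den p (xi i) (xi j)).
Proof.
  intros Hr Hi Hj. unfold den.
  apply approx_minus; auto; [apply approx_plus; auto; [apply approx_const|]|];
    repeat (apply approx_mult; auto); auto using approx_const, approx_coord.
Qed.

Lemma approx_inv_den p r b n i j : small_radius p r -> (1 <= i <= n)%nat -> (1 <= j <= n)%nat ->
  approx r b n (fun xi => / den p (xi i) (xi j)).
Proof.
  intros Hp Hi Hj. assert (Hr := small_radius_pos p r Hp). destruct Hp as [Hp [_ H]].
  assert (Hp0 : RtoC p <> 0) by (apply RtoC_nz; lra).
  (* [1/D = (1/p) / (1 - g)] with [g = (a - q a b)/p]; [rho] bounds [|g|] and is below 1 by the
     choice of the radius. *)
  set (rho := (((1 - p) * (r * r) + r) / p)%R).
  assert (Hrho : (0 <= rho < 1)%R).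
  { unfold rho. split; [apply Rlt_le, Rdiv_lt_0_compat; nra|].
    apply Rmult_lt_reg_r with p; [lra|]. unfold Rdiv.
    rewrite Rmult_assoc, Rinv_l, Rmult_1_r, Rmult_1_l; lra. }
  set (g (xi : nat -> C) := / RtoC p * (xi i - RtoC (1 - p) * (xi i * xi j))).
  apply (approx_ext r b n (fun xi => / RtoC p * / (1 - g xi))).
  - apply approx_mult; auto; [apply approx_const|].
    apply (approx_geometric r b n g rho); auto.
    + unfold g. apply approx_mult; auto; [apply approx_const|].
      apply approx_minus; auto; [apply approx_coord; auto|].
      repeat (apply approx_mult; auto); auto using approx_const, approx_coord.
    + intros xi Hxi. unfold g, rho.
      rewrite Cmod_mult, Cmod_inv, Cmod_R, Rabs_pos_eq by (auto; lra).
      rewrite Rmult_comm. apply Rmult_le_compat_r; [apply Rlt_le, Rinv_0_lt_compat; lra|].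
      eapply Rle_trans; [apply Cmod_triangle|].
      rewrite Cmod_opp, !Cmod_mult, Cmod_R, Rabs_pos_eq, !Hxi by (auto; lra). lra.
  - intros xi Hxi.
    assert (E : den p (xi i) (xi j) = RtoC p * (1 - g xi)) by (unfold den, g; field; auto).
    assert (D : den p (xi i) (xi j) <> 0).
    { apply (den_nz p r); [repeat split; auto; lra|apply Hxi; auto..]. }
    rewrite E in D |- *.
    assert (1 - g xi <> 0) by (intros Z; apply D; rewrite Z; ring).
    field. auto.
Qed.

Lemma approx_rho p r b n k Phi : small_radius p r -> (1 <= k < n)%nat ->
  approx_vec r b n Phi -> approx_vec r b n (rho p k Phi).
Proof.
  intros Hp Hk H w. assert (Hr := small_radius_pos p r Hp). unfold rho, hop, scat, trans.
  assert (H' : forall u, approx r b n (fun xi => Phi (sw k xi) u)).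
  { intros u. apply (contour_sw r b n k (fun xi => Phi xi u)); auto. }
  apply approx_plus; auto; apply approx_mult; auto.
  - apply approx_opp; auto. unfold Cdiv. apply approx_mult; auto.
    + apply approx_den; auto; lia.
    + apply approx_inv_den; auto; lia.
  - unfold Cdiv. apply approx_mult; auto.
    + apply approx_minus; auto; apply approx_coord; auto; lia.
    + apply approx_inv_den; auto; lia.
  - apply approx_mult; auto; [apply approx_const|]. apply approx_minus; auto.
Qed.

Lemma approx_rhos p r b n a Phi : small_radius p r -> gens n a ->
  approx_vec r b n Phi -> approx_vec r b n (rhos p a Phi).
Proof. intros Hp Ha H. induction Ha; simpl; auto. apply approx_rho; auto. Qed.

Lemma approx_sym p r b n dec Phi : small_radius p r -> decomp n dec ->
  approx_vec r b n Phi -> approx_vec r b n (sym p n dec Phi).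
Proof.
  intros Hp Hd H w. unfold sym.
  apply (approx_csum r b n (perms n) (fun s xi => rhos p (dec s) Phi xi w));
    [apply (small_radius_pos p r Hp)|].
  intros s Hs. apply (approx_rhos p r b n (dec s)); auto. apply Hd, Hs.
Qed.

Lemma contour_csum {A} r b n (l : list A) (f : A -> (nat -> C) -> C) : (0 < r)%R ->
  (forall a, In a l -> approx r b n (f a)) ->
  contour r n (fun xi => csum l (fun a => f a xi)) = csum l (fun a => contour r n (f a)).
Proof.
  intros Hr. induction l as [|a l IH]; simpl; intros H.
  - destruct (contour_scal r b n 0 (fun _ => RtoC 0) Hr (approx_const r b n 0)) as [_ E].
    rewrite Cmult_0_l, Cmult_0_l in E. exact E.
  - rewrite <- IH by auto. apply (contour_plus r b n (f a)); auto.
    apply (approx_csum r b n l f); auto.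
Qed.

Lemma contour_lin3 r b n a f c g d h : (0 < r)%R ->
  approx r b n f -> approx r b n g -> approx r b n h ->
  contour r n (fun xi => a * f xi + c * g xi + d * h xi) =
  a * contour r n f + c * contour r n g + d * contour r n h.
Proof.
  intros Hr Hf Hg Hh.
  destruct (contour_scal r b n a f Hr Hf) as [A1 <-].
  destruct (contour_scal r b n c g Hr Hg) as [A2 <-].
  destruct (contour_scal r b n d h Hr Hh) as [A3 <-].
  destruct (contour_plus r b n _ _ Hr A1 A2) as [A4 <-].
  destruct (contour_plus r b n _ _ Hr A4 A3) as [A5 <-].
  reflexivity.
Qed.

Lemma contour_antisym r b n k f : (0 < r)%R -> (1 <= k < n)%nat -> approx r b n f ->
  (forall xi, torus r n xi -> f xi + f (sw k xi) = 0) -> contour r n f = 0.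
Proof.
  intros Hr Hk Hf H. destruct (contour_sw r b n k f Hr Hk Hf) as [Ha E].
  assert (K : contour r n f + contour r n f = 0).
  { rewrite <- E at 2. rewrite <- (proj2 (contour_plus r b n _ _ Hr Hf Ha)).
    rewrite (contour_ext r b n (fun _ => RtoC 0)); auto using approx_const.
    - apply (contour_csum r b n (@nil nat) (fun _ _ => RtoC 0)); auto. intros a [].
    - intros xi Hxi. symmetry. apply H; auto. }
  set (c := contour r n f) in *.
  assert (H2 : RtoC 2 <> 0) by (apply RtoC_nz; lra).
  transitivity (/ 2 * (c + c)); [field; auto|]. rewrite K. ring.
Qed.

(** * Shifted exponents and the energy *)

Definition bump (i : nat) (d : Z) (e : nat -> Z) : nat -> Z :=
  fun j => if (j =? i)%nat then (e j + d)%Z else e j.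

Lemma bump_same i d e : bump i d e i = (e i + d)%Z.
Proof. unfold bump. rewrite Nat.eqb_refl. reflexivity. Qed.

Lemma bump_other i d e j : j <> i -> bump i d e j = e j.
Proof. intros H. unfold bump. destruct (Nat.eqb_spec j i); congruence. Qed.

Lemma mono_bump r n i d e xi : (0 < r)%R -> torus r n xi -> (1 <= i <= n)%nat ->
  mono n (bump i d e) xi = zpowC (xi i) d * mono n e xi.
Proof.
  intros Hr. induction n as [|n IH]; intros Hxi Hi; [lia|]. cbn [mono].
  destruct (Nat.eq_dec i (S n)) as [->|Hne].
  - rewrite bump_same, zpowC_add by (apply (torus_nz r (S n)); auto; lia).
    rewrite (mono_ext n (bump (S n) d e) e xi xi); [ring| |reflexivity].
    intros j Hj. apply bump_other. lia.
  - rewrite bump_other, IH by (auto; try lia; apply (torus_S _ _ _ Hxi)). ring.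
Qed.

Definition energy (p : R) (n : nat) (xi : nat -> C) : C :=
  csum (seq 1 n) (fun i => epsC p (xi i)).

Lemma csum_seq_sw n k (f : nat -> C) : (1 <= k < n)%nat ->
  csum (seq 1 n) (sw k f) = csum (seq 1 n) f.
Proof.
  intros Hk.
  replace (seq 1 n) with (seq 1 (k - 1) ++ k :: S k :: seq (S (S k)) (n - k - 1)).
  - rewrite !csum_app. simpl. rewrite sw_l, sw_r.
    rewrite (csum_ext (seq 1 (k - 1)) (sw k f) f), (csum_ext (seq (S (S k)) _) (sw k f) f).
    + ring.
    + intros a Ha. apply in_seq in Ha. apply sw_other; lia.
    + intros a Ha. apply in_seq in Ha. apply sw_other; lia.
  - replace n with (k - 1 + (2 + (n - k - 1)))%nat at 2 by lia.
    rewrite seq_app. f_equal. replace (1 + (k - 1))%nat with k by lia. reflexivity.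
Qed.

Lemma energy_sw p n k xi : (1 <= k < n)%nat -> energy p n (sw k xi) = energy p n xi.
Proof.
  intros Hk. unfold energy. rewrite <- (csum_seq_sw n k (fun i => epsC p (xi i)) Hk).
  apply csum_ext. intros i _. unfold sw.
  destruct (i =? k)%nat; [|destruct (i =? S k)%nat]; reflexivity.
Qed.

Lemma approx_zpow r n i d : (0 < r)%R -> (1 <= i <= n)%nat ->
  approx r false n (fun xi => zpowC (xi i) d).
Proof.
  intros Hr Hi.
  apply (approx_ext r false n (mono n (bump i d (fun _ => 0%Z)))); [apply approx_mono|].
  intros xi Hxi. rewrite (mono_bump r), mono_zero by auto. ring.
Qed.

Lemma epsC_zpow p (x : C) : x <> 0 ->
  epsC p x = RtoC p * zpowC x (-1) + RtoC (1 - p) * zpowC x 1 - 1.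
Proof. intros Hx. rewrite zpowC_m1, zpowC_1 by auto. unfold epsC. field. auto. Qed.

Lemma approx_energy p r n : (0 < r)%R -> approx r false n (energy p n).
Proof.
  intros Hr. apply (approx_csum r false n (seq 1 n) (fun i xi => epsC p (xi i)) Hr).
  intros i Hi. apply in_seq in Hi.
  apply (approx_ext r false n
    (fun xi => RtoC p * zpowC (xi i) (-1) + RtoC (1 - p) * zpowC (xi i) 1 - 1)).
  - apply approx_minus; auto using approx_const.
    apply approx_plus; auto; apply approx_mult; auto using approx_const;
      apply approx_zpow; auto; lia.
  - intros xi Hxi. symmetry. apply epsC_zpow, (torus_nz r n); auto; lia.
Qed.

(** The normalised integral with a free multiplier [h], to be taken as [1], a power of the energy,
    its exponential or a partial sum of the latter. The initial positions enter only through the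
    monomial, so moving one of them multiplies by a power of one variable. *)
Definition kern (r : R) (n : nat) (h : (nat -> C) -> C) (Psi : vec) (Y : nat -> Z) (w : word) : C :=
  contour r n (fun xi => mono n (fun j => (- Y j - 1)%Z) xi * (h xi * Psi xi w)).

Lemma approx_kern r n h Psi Y w : (0 < r)%R -> approx r false n h -> approx_vec r false n Psi ->
  approx r false n (fun xi => mono n Y xi * (h xi * Psi xi w)).
Proof.
  intros Hr Hh HP. repeat apply approx_mult; auto using approx_mono.
Qed.

Lemma mono_neg_bump r n i d Y xi : (0 < r)%R -> torus r n xi -> (1 <= i <= n)%nat ->
  mono n (fun j => (- bump i d Y j - 1)%Z) xi =
  zpowC (xi i) (- d) * mono n (fun j => (- Y j - 1)%Z) xi.
Proof.
  intros Hr Hxi Hi. rewrite <- (mono_bump r) by auto. apply mono_ext; auto.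
  intros j _. unfold bump. destruct (j =? i)%nat; lia.
Qed.

(** * Boundary conditions and the energy *)

Definition symmetric (n : nat) (h : (nat -> C) -> C) : Prop :=
  forall k xi, (1 <= k < n)%nat -> h (sw k xi) = h xi.

(** The exponents at [k] and [k+1] differ by [d]; shifting one of them evens them out, which makes
    the monomial symmetric in the two variables. *)
Lemma bump_collision k d e : e (S k) = (e k - d)%Z -> sw k (bump (S k) d e) = bump (S k) d e.
Proof.
  intros H. apply functional_extensionality; intros j.
  unfold bump; sw_cases; subst; lia.
Qed.

Lemma kern_lin3 r n h Y w a c d P1 P2 P3 w1 w2 w3 Psi : (0 < r)%R -> approx r false n h ->
  approx_vec r false n P1 -> approx_vec r false n P2 -> approx_vec r false n P3 ->
  (forall xi, torus r n xi -> Psi xi w = a * P1 xi w1 + c * P2 xi w2 + d * P3 xi w3) ->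
  kern r n h Psi Y w = a * kern r n h P1 Y w1 + c * kern r n h P2 Y w2 + d * kern r n h P3 Y w3.
Proof.
  intros Hr Hh H1 H2 H3 E. unfold kern.
  rewrite <- (contour_lin3 r false n) by (auto using approx_kern).
  apply (contour_ext r false n); auto.
  - repeat apply approx_plus; auto; apply approx_mult; auto using approx_const, approx_kern.
  - intros xi Hxi. rewrite E by auto. ring.
Qed.

(* The two-particle boundary condition: the integrand is antisymmetric under the
   exchange of [xi_i] and [xi_(i+1)]. *)
Lemma kern_boundary p r n i h Psi Y w : small_radius p r -> (1 <= i < n)%nat ->
  approx r false n h -> symmetric n h -> approx_vec r false n Psi ->
  eqv r n (rho p i Psi) Psi -> Y (S i) = (Y i + 1)%Z ->
  RtoC p * kern r n h Psi (bump i 1 Y) w + RtoC (1 - p) * kern r n h Psi (bump (S i) (-1) Y) w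
    - kern r n h Psi Y w = hop p i (kern r n h Psi Y) w.
Proof.
  intros Hp Hi Hh Hsym HP Hrho HY. assert (Hr := small_radius_pos p r Hp).
  (* Adding [hop] to [Psi] brings the right-hand side under the integral: the claim becomes the
     vanishing of the single integral of [G]. *)
  set (Psi' := fun xi u => Psi xi u + hop p i (Psi xi) u).
  assert (HP' : approx_vec r false n Psi').
  { intros u. unfold Psi', hop. apply approx_plus; auto.
    apply approx_mult; auto using approx_const. apply approx_minus; auto. }
  assert (E1 : kern r n h Psi' Y w = kern r n h Psi Y w + hop p i (kern r n h Psi Y) w).
  { rewrite (kern_lin3 r n h Y w 1 (rate p i w) (- rate p i w) Psi Psi Psi w (sw i w) w) by
      (auto; intros; unfold Psi', hop; ring).
    unfold hop. ring. }
  set (G := fun xi =>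
    RtoC p * (mono n (fun j => (- bump i 1 Y j - 1)%Z) xi * (h xi * Psi xi w)) +
    RtoC (1 - p) * (mono n (fun j => (- bump (S i) (-1) Y j - 1)%Z) xi * (h xi * Psi xi w)) +
    (- RtoC 1) * (mono n (fun j => (- Y j - 1)%Z) xi * (h xi * Psi' xi w))).
  assert (EG : contour r n G = RtoC p * kern r n h Psi (bump i 1 Y) w
    + RtoC (1 - p) * kern r n h Psi (bump (S i) (-1) Y) w + (- RtoC 1) * kern r n h Psi' Y w).
  { apply (contour_lin3 r false n); auto using approx_kern. }
  assert (Z : contour r n G = 0).
  { apply (contour_antisym r false n i); auto.
    - unfold G. repeat apply approx_plus; auto; apply approx_mult; auto using approx_const, approx_kern.
    - intros xi Hxi. unfold G.
      assert (Hxi' := torus_sw r n i xi Hi Hxi).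
      rewrite !(mono_neg_bump r) by (auto; lia). rewrite sw_l, sw_r, (Hsym i xi Hi).
      (* For [y_(i+1) = y_i + 1] the exponent of [xi_(i+1)] is one less than that of [xi_i]; hence
         the monomial at [xi] is [a / b] times the one at the exchanged point. *)
      assert (Hs : (fun j : nat => (- Y j - 1)%Z) (S i) = ((fun j : nat => (- Y j - 1)%Z) i - 1)%Z)
        by (simpl; lia).
      apply bump_collision in Hs. set (e := fun j : nat => (- Y j - 1)%Z) in *.
      assert (HM : mono n (bump (S i) 1 e) (sw i xi) = mono n (bump (S i) 1 e) xi)
        by (rewrite mono_sw, Hs; auto).
      rewrite !(mono_bump r) in HM by (auto; lia). rewrite sw_r in HM.
      assert (Ha : xi i <> 0) by (apply (torus_nz r n); auto; lia).
      assert (Hb : xi (S i) <> 0) by (apply (torus_nz r n); auto; lia).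
      assert (D : den p (xi i) (xi (S i)) <> 0) by (apply (den_nz p r); auto; apply Hxi; lia).
      (* Invariance under [rho] expresses [Psi xi] by its value at the exchanged point; antisymmetry
         is then a rational identity for independent [f] and [g]. *)
      assert (EP : Psi xi = fun u => scat p (xi i) (xi (S i)) * Psi (sw i xi) u
        + trans p (xi i) (xi (S i)) * hop p i (Psi (sw i xi)) u).
      { apply functional_extensionality. intros u. symmetry. apply Hrho; auto. }
      unfold Psi'. rewrite EP. rewrite hop_lin, hop_hop.
      change (- (1))%Z with (-1)%Z. change (- (-1))%Z with 1%Z.
      rewrite !zpowC_m1. rewrite !zpowC_1 in * by auto.
      set (a := xi i) in *. set (b := xi (S i)) in *.
      set (m := mono n e xi) in *. set (m' := mono n e (sw i xi)) in *.
      assert (Em : m = a * m' / b) by (rewrite HM; field; auto).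
      rewrite Em. generalize (Psi (sw i xi) w) (hop p i (Psi (sw i xi)) w). intros f g.
      unfold scat, trans.
      unfold den in *. rewrite RtoC_1m in *. field. auto. }
  rewrite EG, E1 in Z.
  match goal with |- ?x = ?y => replace x with ((x - y) + y) by ring;
    replace (x - y) with (RtoC 0); [ring|] end.
  rewrite <- Z. ring.
Qed.

(** Since [eps(xi) = p/xi + q xi - 1] and the exponents are [- y_i - 1], the factor [1/xi_i] is a
    step of particle [i] to the right. These are free particles: no exclusion has entered yet. *)
Lemma kern_energy p r n h Psi Y w : small_radius p r ->
  approx r false n h -> approx_vec r false n Psi ->
  kern r n (fun xi => h xi * energy p n xi) Psi Y w =
  csum (seq 1 n) (fun i => RtoC p * kern r n h Psi (bump i 1 Y) w
    + RtoC (1 - p) * kern r n h Psi (bump i (-1) Y) w + (- RtoC 1) * kern r n h Psi Y w).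
Proof.
  intros Hp Hh HP. assert (Hr := small_radius_pos p r Hp). unfold kern.
  rewrite (csum_ext (seq 1 n) _ (fun i => contour r n (fun xi =>
    RtoC p * (mono n (fun j => (- bump i 1 Y j - 1)%Z) xi * (h xi * Psi xi w)) +
    RtoC (1 - p) * (mono n (fun j => (- bump i (-1) Y j - 1)%Z) xi * (h xi * Psi xi w)) +
    (- RtoC 1) * (mono n (fun j => (- Y j - 1)%Z) xi * (h xi * Psi xi w))))).
  2:{ intros i _. symmetry. apply (contour_lin3 r false n); auto using approx_kern. }
  assert (Ha : forall i, approx r false n (fun xi =>
    RtoC p * (mono n (fun j => (- bump i 1 Y j - 1)%Z) xi * (h xi * Psi xi w)) +
    RtoC (1 - p) * (mono n (fun j => (- bump i (-1) Y j - 1)%Z) xi * (h xi * Psi xi w)) +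
    (- RtoC 1) * (mono n (fun j => (- Y j - 1)%Z) xi * (h xi * Psi xi w)))).
  { intros i. repeat apply approx_plus; auto; apply approx_mult; auto using approx_const, approx_kern. }
  rewrite <- (contour_csum r false n (seq 1 n) (fun i xi =>
    RtoC p * (mono n (fun j => (- bump i 1 Y j - 1)%Z) xi * (h xi * Psi xi w)) +
    RtoC (1 - p) * (mono n (fun j => (- bump i (-1) Y j - 1)%Z) xi * (h xi * Psi xi w)) +
    (- RtoC 1) * (mono n (fun j => (- Y j - 1)%Z) xi * (h xi * Psi xi w)))) by auto.
  symmetry. apply (contour_ext r false n); auto.
  - apply approx_kern; auto. apply approx_mult; auto. apply approx_energy; auto.
  - intros xi Hxi. unfold energy.
    rewrite <- Cmult_assoc, (Cmult_comm _ (Psi xi w)), <- !csum_scal.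
    apply csum_ext. intros i Hi. apply in_seq in Hi.
    rewrite !(mono_neg_bump r), epsC_zpow by (auto; try lia; apply (torus_nz r n); auto; lia).
    change (- (1))%Z with (-1)%Z. change (- (-1))%Z with 1%Z. ring.
Qed.

(** For [v] the point mass at [pi] this is the row [pi] of the sum over permutations; a general [v]
    lets exchanges in the final configuration act. *)
Definition smono (p : R) (n : nat) (dec : list nat -> list nat) (X : nat -> Z) (v : word -> C) : vec :=
  sym p n dec (fun xi w => mono n X xi * v w).

Lemma sym_csum {A} p n dec (l : list A) (Phi : A -> vec) xi w : decomp n dec ->
  sym p n dec (fun xi w => csum l (fun a => Phi a xi w)) xi w =
  csum l (fun a => sym p n dec (Phi a) xi w).
Proof.
  intros Hd. induction l as [|a l IH]; simpl.
  - assert (E := sym_scal p n dec (fun _ => RtoC 0) (fun _ _ => RtoC 0) xi w Hd (fun _ _ _ => eq_refl)).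
    simpl in E. rewrite !Cmult_0_l in E. exact E.
  - rewrite sym_plus, IH. reflexivity.
Qed.

Lemma sym_lin3 p n dec a c d (P1 P2 P3 : vec) xi w : decomp n dec ->
  sym p n dec (fun xi w => a * P1 xi w + c * P2 xi w + d * P3 xi w) xi w =
  a * sym p n dec P1 xi w + c * sym p n dec P2 xi w + d * sym p n dec P3 xi w.
Proof.
  intros Hd.
  rewrite (sym_plus p n dec (fun xi w => a * P1 xi w + c * P2 xi w) (fun xi w => d * P3 xi w)).
  rewrite (sym_plus p n dec (fun xi w => a * P1 xi w) (fun xi w => c * P2 xi w)).
  rewrite (sym_scal p n dec (fun _ => a)), (sym_scal p n dec (fun _ => c)),
    (sym_scal p n dec (fun _ => d)) by auto. reflexivity.
Qed.

(** The unsymmetrised defect [Phi] satisfies [Phi + rho_i Phi = 0]. As [Phi] and [rho_i Phi] have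
    the same symmetrisation, twice the symmetrised defect is zero. *)
Lemma smono_boundary p r n dec i X v : small_radius p r -> decomp n dec -> (1 <= i < n)%nat ->
  X (S i) = (X i + 1)%Z ->
  eqv r n (fun xi w => RtoC p * smono p n dec (bump (S i) (-1) X) v xi w
    + RtoC (1 - p) * smono p n dec (bump i 1 X) v xi w + (- RtoC 1) * smono p n dec X v xi w)
    (smono p n dec X (hop p i v)).
Proof.
  intros Hp Hd Hi HX xi Hxi w. assert (Hr := small_radius_pos p r Hp).
  set (Phi := fun (xi : nat -> C) u =>
    (mono n X xi * (RtoC p * / xi (S i) + RtoC (1 - p) * xi i - 1)) * v u
      + (- mono n X xi) * hop p i v u).
  assert (E : eqv r n (fun xi u => 1 * Phi xi u + 1 * rho p i Phi xi u + 0 * Phi xi u)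
     (fun _ _ => RtoC 0)).
  { clear xi Hxi w. intros xi Hxi w. unfold rho.
    assert (EP : Phi (sw i xi) = fun u =>
      (mono n X (sw i xi) * (RtoC p * / xi i + RtoC (1 - p) * xi (S i) - 1)) * v u
      + (- mono n X (sw i xi)) * hop p i v u).
    { unfold Phi. rewrite sw_l, sw_r. reflexivity. }
    rewrite EP, hop_lin, hop_hop. unfold Phi.
    assert (Hxi' := torus_sw r n i xi Hi Hxi).
    assert (Hs : sw i (bump i 1 X) = bump i 1 X).
    { apply functional_extensionality; intros j. unfold bump; sw_cases; subst; lia. }
    assert (HM : mono n (bump i 1 X) (sw i xi) = mono n (bump i 1 X) xi)
      by (rewrite mono_sw, Hs; auto).
    assert (Ha : xi i <> 0) by (apply (torus_nz r n); auto; lia).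
    assert (Hb : xi (S i) <> 0) by (apply (torus_nz r n); auto; lia).
    assert (D : den p (xi i) (xi (S i)) <> 0) by (apply (den_nz p r); auto; apply Hxi; lia).
    rewrite !(mono_bump r) in HM by (auto; lia). rewrite sw_l, !zpowC_1 in HM by auto.
    set (a := xi i) in *. set (b := xi (S i)) in *.
    set (m := mono n X xi) in *. set (m' := mono n X (sw i xi)) in *.
    assert (Em : m = b * m' / a) by (rewrite HM; field; auto).
    rewrite Em. generalize (v w) (hop p i v w). intros f g.
    unfold scat, trans, den in *. rewrite RtoC_1m in *. field. auto. }
  assert (Z : sym p n dec Phi xi w = 0).
  { assert (E' := sym_eqv p r n dec _ _ Hd E xi Hxi w). rewrite sym_lin3 in E' by auto.
    rewrite (sym_rho p r n dec i Phi Hp Hd Hi xi Hxi w) in E'.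
    assert (Z0 := sym_csum p n dec (@nil nat) (fun _ _ _ => RtoC 0) xi w Hd). simpl in Z0.
    rewrite Z0 in E'. set (c := sym p n dec Phi xi w) in *.
    assert (H2 : RtoC 2 <> 0) by (apply RtoC_nz; lra).
    transitivity (/ 2 * (1 * c + 1 * c + 0 * c)); [field; auto|]. rewrite E'. ring. }
  set (A := fun (xi : nat -> C) u => 1 * (RtoC p * (mono n (bump (S i) (-1) X) xi * v u)
     + RtoC (1 - p) * (mono n (bump i 1 X) xi * v u) + (- RtoC 1) * (mono n X xi * v u))
     + (- RtoC 1) * (mono n X xi * hop p i v u) + 0 * Phi xi u).
  assert (EA : eqv r n Phi A).
  { clear xi Hxi w Z. intros xi Hxi w. unfold A, Phi.
    rewrite !(mono_bump r), zpowC_m1, zpowC_1 by (auto; try lia; apply (torus_nz r n); auto; lia).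
    ring. }
  rewrite (sym_eqv p r n dec _ _ Hd EA xi Hxi w) in Z. unfold A in Z.
  rewrite sym_lin3 in Z by auto. rewrite sym_lin3 in Z by auto.
  unfold smono.
  match goal with |- ?x = ?y => replace x with ((x - y) + y) by ring;
    replace (x - y) with (RtoC 0); [ring|] end.
  rewrite <- Z. ring.
Qed.

Lemma smono_energy p r n dec X v : small_radius p r -> decomp n dec ->
  eqv r n (fun xi w => energy p n xi * smono p n dec X v xi w)
    (fun xi w => csum (seq 1 n) (fun i => RtoC p * smono p n dec (bump i (-1) X) v xi w
    + RtoC (1 - p) * smono p n dec (bump i 1 X) v xi w + (- RtoC 1) * smono p n dec X v xi w)).
Proof.
  intros Hp Hd xi Hxi w. assert (Hr := small_radius_pos p r Hp). unfold smono.
  rewrite <- (sym_scal p n dec (energy p n)) by (auto using energy_sw).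
  rewrite (csum_ext (seq 1 n) _ (fun i => sym p n dec (fun xi w =>
    RtoC p * (mono n (bump i (-1) X) xi * v w) + RtoC (1 - p) * (mono n (bump i 1 X) xi * v w)
    + (- RtoC 1) * (mono n X xi * v w)) xi w)).
  2:{ intros i _. symmetry. apply sym_lin3; auto. }
  rewrite <- (sym_csum p n dec (seq 1 n) (fun i xi w =>
    RtoC p * (mono n (bump i (-1) X) xi * v w) + RtoC (1 - p) * (mono n (bump i 1 X) xi * v w)
    + (- RtoC 1) * (mono n X xi * v w))) by auto.
  apply (sym_eqv p r n dec); auto. clear xi Hxi w. intros xi Hxi w. unfold energy.
  rewrite (Cmult_comm (csum _ _)), <- csum_scal. apply csum_ext. intros i Hi. apply in_seq in Hi.
  rewrite !(mono_bump r), epsC_zpow by (auto; try lia; apply (torus_nz r n); auto; lia).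
  ring.
Qed.

(** * The backward and forward equations *)

Definition adj (n : nat) (Y : nat -> Z) (i : nat) : bool :=
  ((1 <=? i)%nat && (i <? n)%nat && (Y (S i) =? Y i + 1)%Z)%bool.

Lemma adj_spec n Y i : adj n Y i = true <-> (1 <= i < n)%nat /\ Y (S i) = (Y i + 1)%Z.
Proof.
  unfold adj. rewrite !andb_true_iff, Nat.leb_le, Nat.ltb_lt, Z.eqb_eq. tauto.
Qed.

Definition gen (p : R) (n : nat) (G : (nat -> Z) -> word -> C) (Y : nat -> Z) (w : word) : C :=
  csum (seq 1 n) (fun i =>
    (if adj n Y i then
       (if (w (S i) <? w i)%nat then RtoC p * (G Y (sw i w) - G Y w) else 0)
     else RtoC p * (G (bump i 1 Y) w - G Y w)) +
    (if adj n Y (i - 1) then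
       (if (w (i - 1) <? w i)%nat then RtoC (1 - p) * (G Y (sw (i - 1) w) - G Y w) else 0)
     else RtoC (1 - p) * (G (bump i (-1) Y) w - G Y w))).

(** The same generator summed over bonds: the two exchanges possible between blocked neighbours [i],
    [i+1] have mutually exclusive conditions and form one [hop]. *)
Definition gen_hop (p : R) (n : nat) (G : (nat -> Z) -> word -> C) (Y : nat -> Z) (w : word) : C :=
  csum (seq 1 n) (fun i =>
    (if adj n Y i then 0 else RtoC p * (G (bump i 1 Y) w - G Y w)) +
    (if adj n Y (i - 1) then 0 else RtoC (1 - p) * (G (bump i (-1) Y) w - G Y w)) +
    (if adj n Y i then hop p i (G Y) w else 0)).

(* The generator acting on the final state; final words enter through a test
   function [v], on which exchanges act by [hop]. *)
Definition gen_forward (p : R) (n : nat) (G : (nat -> Z) -> (word -> C) -> C)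
    (X : nat -> Z) (v : word -> C) : C :=
  csum (seq 1 n) (fun i =>
    RtoC p * ((if adj n X (i - 1) then 0 else G (bump i (-1) X) v)
              - (if adj n X i then 0 else G X v)) +
    RtoC (1 - p) * ((if adj n X i then 0 else G (bump i 1 X) v)
              - (if adj n X (i - 1) then 0 else G X v)) +
    (if adj n X i then G X (hop p i v) else 0)).

(** A blocked left neighbour of [i+1] is a blocked right neighbour of [i]; the end terms vanish
    because [adj] is false at [0] and [n]. *)
Lemma csum_adj_shift n Y (A : nat -> C) :
  csum (seq 1 n) (fun i => if adj n Y (i - 1) then A i else 0) =
  csum (seq 1 n) (fun i => if adj n Y i then A (S i) else 0).
Proof.
  set (f := fun i => if adj n Y i then A (S i) else RtoC 0).
  transitivity (csum (seq 0 n) f).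
  - rewrite <- seq_shift, csum_map. apply csum_ext. intros i _. unfold f.
    simpl. rewrite Nat.sub_0_r. reflexivity.
  - assert (E : csum (seq 0 (S n)) f = csum (seq 0 n) f + f n).
    { rewrite seq_S, csum_app. simpl. ring. }
    simpl in E.
    assert (E0 : f 0%nat = 0).
    { unfold f. destruct (adj n Y 0) eqn:H; [apply adj_spec in H; lia|reflexivity]. }
    assert (En : f n = 0).
    { unfold f. destruct (adj n Y n) eqn:H; [apply adj_spec in H; lia|reflexivity]. }
    rewrite E0, En in E. rewrite Cplus_0_l, Cplus_0_r in E. auto.
Qed.

Lemma csum_split2 (l : list nat) (f g h : nat -> C) :
  (forall i, In i l -> f i = g i + h i) -> csum l f = csum l g + csum l h.
Proof. intros H. rewrite <- csum_plus. apply csum_ext, H. Qed.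

Lemma gen_gen_hop p n G Y w : gen p n G Y w = gen_hop p n G Y w.
Proof.
  unfold gen, gen_hop.
  rewrite (csum_split2 _ _ (fun i =>
    (if adj n Y i then
       (if (w (S i) <? w i)%nat then RtoC p * (G Y (sw i w) - G Y w) else 0)
     else RtoC p * (G (bump i 1 Y) w - G Y w)) +
    (if adj n Y (i - 1) then 0 else RtoC (1 - p) * (G (bump i (-1) Y) w - G Y w)))
    (fun i => if adj n Y (i - 1) then
      (if (w (i - 1) <? w i)%nat then RtoC (1 - p) * (G Y (sw (i - 1) w) - G Y w) else 0) else 0))
    by (intros i _; destruct (adj n Y i), (adj n Y (i - 1)); ring).
  rewrite csum_adj_shift, <- csum_plus. apply csum_ext. intros i _. simpl (S i - 1)%nat.
  rewrite Nat.sub_0_r. unfold hop, rate.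
  destruct (adj n Y i), (adj n Y (i - 1)); try ring;
    destruct (Nat.ltb_spec (w (S i)) (w i)), (Nat.ltb_spec (w i) (w (S i))); try lia; ring.
Qed.

(** On a blocked bond the two forbidden jumps of the free generator contribute, by [p + q = 1], the
    left side of the boundary condition, hence exactly the [hop] of that bond. *)
Lemma gen_free p n G Y w :
  (forall i, (1 <= i < n)%nat -> Y (S i) = (Y i + 1)%Z ->
     RtoC p * G (bump i 1 Y) w + RtoC (1 - p) * G (bump (S i) (-1) Y) w - G Y w
     = hop p i (G Y) w) ->
  gen_hop p n G Y w = csum (seq 1 n) (fun i => RtoC p * G (bump i 1 Y) w
    + RtoC (1 - p) * G (bump i (-1) Y) w + (- RtoC 1) * G Y w).
Proof.
  intros H. unfold gen_hop. symmetry.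
  rewrite (csum_split2 _ _ (fun i =>
    RtoC p * (G (bump i 1 Y) w - G Y w) +
    (if adj n Y (i - 1) then 0 else RtoC (1 - p) * (G (bump i (-1) Y) w - G Y w)))
    (fun i => if adj n Y (i - 1) then RtoC (1 - p) * (G (bump i (-1) Y) w - G Y w) else 0))
    by (intros i _; destruct (adj n Y (i - 1)); rewrite RtoC_1m; ring).
  rewrite csum_adj_shift, <- csum_plus. apply csum_ext. intros i _.
  destruct (adj n Y i) eqn:E; [|ring]. apply adj_spec in E. destruct E as [E1 E2].
  rewrite <- H by auto. rewrite RtoC_1m. ring.
Qed.

Lemma gen_forward_free p n G X v :
  (forall i, (1 <= i < n)%nat -> X (S i) = (X i + 1)%Z ->
     RtoC p * G (bump (S i) (-1) X) v + RtoC (1 - p) * G (bump i 1 X) v + (- RtoC 1) * G X v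
     = G X (hop p i v)) ->
  gen_forward p n G X v = csum (seq 1 n) (fun i => RtoC p * G (bump i (-1) X) v
    + RtoC (1 - p) * G (bump i 1 X) v + (- RtoC 1) * G X v).
Proof.
  intros H. unfold gen_forward. symmetry.
  rewrite (csum_split2 _ _ (fun i =>
    RtoC p * (if adj n X (i - 1) then 0 else G (bump i (-1) X) v) - RtoC p * G X v
    + RtoC (1 - p) * G (bump i 1 X) v - RtoC (1 - p) * (if adj n X (i - 1) then 0 else G X v))
    (fun i => if adj n X (i - 1) then
       RtoC p * G (bump i (-1) X) v - RtoC (1 - p) * G X v else 0))
    by (intros i _; destruct (adj n X (i - 1)); rewrite RtoC_1m; ring).
  rewrite csum_adj_shift, <- csum_plus. apply csum_ext. intros i _.
  destruct (adj n X i) eqn:E; [|ring]. apply adj_spec in E. destruct E as [E1 E2].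
  rewrite <- H by auto. rewrite RtoC_1m. ring.
Qed.

Lemma kern_backward p r n h Psi Y w : small_radius p r ->
  approx r false n h -> symmetric n h -> approx_vec r false n Psi ->
  (forall k, (1 <= k < n)%nat -> eqv r n (rho p k Psi) Psi) ->
  gen_hop p n (kern r n h Psi) Y w = kern r n (fun xi => h xi * energy p n xi) Psi Y w.
Proof.
  intros Hp Hh Hs HP Hrho. rewrite kern_energy by auto. apply gen_free.
  intros i Hi HY. apply kern_boundary; auto.
Qed.

Lemma approx_smono p r n dec X v : small_radius p r -> decomp n dec ->
  approx_vec r false n (smono p n dec X v).
Proof.
  intros Hp Hd. apply approx_sym; auto. intros w.
  apply approx_mult; auto using approx_mono, approx_const, (small_radius_pos p r Hp).
Qed.

Lemma kern_forward p r n dec h Y w X v : small_radius p r -> decomp n dec ->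
  approx r false n h ->
  gen_forward p n (fun X v => kern r n h (smono p n dec X v) Y w) X v =
  kern r n (fun xi => h xi * energy p n xi) (smono p n dec X v) Y w.
Proof.
  intros Hp Hd Hh. assert (Hr := small_radius_pos p r Hp).
  rewrite gen_forward_free.
  - set (Psi i xi w := RtoC p * smono p n dec (bump i (-1) X) v xi w
      + RtoC (1 - p) * smono p n dec (bump i 1 X) v xi w + (- RtoC 1) * smono p n dec X v xi w).
    assert (HPsi : forall i, approx_vec r false n (Psi i)).
    { intros i u. unfold Psi. repeat apply approx_plus; auto; apply approx_mult;
        auto using approx_const; apply approx_smono; auto. }
    rewrite (csum_ext (seq 1 n) _ (fun i => kern r n h (Psi i) Y w)).
    2:{ intros i _. symmetry. apply kern_lin3; auto using approx_smono. }
    unfold kern. rewrite <- (contour_csum r false n (seq 1 n) (fun i xi =>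
      mono n (fun j => (- Y j - 1)%Z) xi * (h xi * Psi i xi w))) by auto using approx_kern.
    apply (contour_ext r false n); auto.
    + apply approx_kern; auto using approx_smono. apply approx_mult; auto. apply approx_energy; auto.
    + intros xi Hxi.
      rewrite (csum_ext _ _ (fun i => (mono n (fun j => (- Y j - 1)%Z) xi * h xi) * Psi i xi w))
        by (intros; ring).
      rewrite csum_scal. unfold Psi.
      rewrite <- (smono_energy p r n dec X v Hp Hd xi Hxi w). ring.
  - intros i Hi HX. symmetry. apply kern_lin3; auto using approx_smono.
    intros xi Hxi. symmetry. apply (smono_boundary p r n dec i X v); auto.
Qed.

(** * The initial condition *)

Fixpoint zsum (n : nat) (e : nat -> Z) : Z :=
  match n with O => 0%Z | S m => (zsum m e + e (S m))%Z end.

Lemma zsum_ext n e e' : (forall j, (1 <= j <= n)%nat -> e j = e' j) -> zsum n e = zsum n e'.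
Proof.
  induction n as [|n IH]; simpl; intros H; [reflexivity|].
  rewrite H, IH; auto with arith; intros; apply H; lia.
Qed.

Lemma zsum_sw n k e : (1 <= k < n)%nat -> zsum n (sw k e) = zsum n e.
Proof.
  induction n as [|n IH]; intros Hk; [lia|].
  destruct (Nat.eq_dec k n) as [->|Hn].
  - destruct n as [|n]; [lia|]. simpl. rewrite sw_r, sw_l.
    rewrite (zsum_ext n (sw (S n) e) e); [lia|].
    intros; apply sw_other; lia.
  - simpl. rewrite IH, (sw_other k) by lia. reflexivity.
Qed.

Lemma zsum_bump n i d e : (1 <= i <= n)%nat -> zsum n (bump i d e) = (zsum n e + d)%Z.
Proof.
  induction n as [|n IH]; intros Hi; [lia|]. simpl.
  destruct (Nat.eq_dec i (S n)) as [->|Hne].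
  - rewrite bump_same, (zsum_ext n _ e); [lia|]. intros; apply bump_other; lia.
  - rewrite IH, bump_other by lia. lia.
Qed.

Lemma zsum_lt n e e' : (zsum n e < zsum n e')%Z -> exists j, (1 <= j <= n)%nat /\ (e j < e' j)%Z.
Proof.
  induction n as [|n IH]; simpl; intros H; [lia|].
  destruct (Z_lt_ge_dec (e (S n)) (e' (S n))) as [Hl|Hl].
  - exists (S n). split; [lia|auto].
  - destruct IH as [j [Hj Hj']]; [lia|]. exists j. split; [lia|auto].
Qed.

Lemma act_comp {A} a (f : nat -> A) i :
  fold_left (fun g k => sw k g) a f i = f (act a (fun j => j) i).
Proof.
  revert f i. induction a as [|k a IH] using rev_ind; intros f i; [reflexivity|].
  unfold act. rewrite !fold_left_app. simpl. unfold sw.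
  destruct (i =? k)%nat; [|destruct (i =? S k)%nat]; apply IH.
Qed.

(** Exponents once the monomial has been pulled through [rhos]: the entry at [sigma(i)] is [x_i], as
    in [xi_(sigma(i))^(x_i)]. *)
Definition final_exps (a : list nat) (X : nat -> Z) : nat -> Z := fold_right (fun k e => sw k e) X a.

Lemma rhos_mono p n a X v xi w : gens n a ->
  rhos p a (fun xi w => mono n X xi * v w) xi w =
  mono n (final_exps a X) xi * rhos p a (fun _ w => v w) xi w.
Proof.
  intros Ha. revert xi w. induction Ha as [|k a Hk Ha IH]; intros xi w; simpl; [reflexivity|].
  unfold rho, hop. rewrite !IH, mono_sw by auto. ring.
Qed.

Lemma sw_sw_id {A} k (f : nat -> A) j : sw k f (sw k (fun i => i) j) = f j.
Proof.
  unfold sw at 2. destruct (Nat.eqb_spec j k) as [->|H1]; [apply sw_r|].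
  destruct (Nat.eqb_spec j (S k)) as [->|H2]; [apply sw_l|apply sw_other; auto].
Qed.

Lemma final_exps_act a X i : final_exps a X (act a (fun j => j) i) = X i.
Proof.
  revert i. induction a as [|k a IH]; intros i; [reflexivity|]. simpl.
  unfold act; simpl. rewrite (act_comp a).
  rewrite sw_sw_id. apply IH.
Qed.

Lemma zsum_final_exps n a X : gens n a -> zsum n (final_exps a X) = zsum n X.
Proof.
  intros Ha. induction Ha as [|k a Hk Ha IH]; simpl; [reflexivity|].
  rewrite zsum_sw; auto.
Qed.

Definition increasing (n : nat) (Y : nat -> Z) : Prop :=
  forall i, (1 <= i < n)%nat -> (Y i < Y (S i))%Z.

Lemma increasing_le n Y : increasing n Y -> forall i j, (1 <= i <= j)%nat -> (j <= n)%nat -> (Y i <= Y j)%Z.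
Proof.
  intros H i j Hij. induction j as [|j IH]; intros Hj; [lia|].
  destruct (Nat.eq_dec i (S j)) as [->|Hne]; [lia|].
  specialize (IH ltac:(lia) ltac:(lia)). specialize (H j ltac:(lia)). lia.
Qed.

Definition kern_one (p r : R) (n : nat) (dec : list nat -> list nat) (Y : nat -> Z) (w : word)
    (X : nat -> Z) (v : word -> C) : C :=
  kern r n (fun _ => RtoC 1) (smono p n dec X v) Y w.

Lemma kern_one_expand p r n dec Y w X v : small_radius p r -> decomp n dec ->
  kern_one p r n dec Y w X v = csum (perms n) (fun s => contour r n (fun xi =>
    mono n (fun j => (final_exps (dec s) X j - Y j - 1)%Z) xi * rhos p (dec s) (fun _ w => v w) xi w)).
Proof.
  intros Hp Hd. assert (Hr := small_radius_pos p r Hp).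
  rewrite <- (contour_csum r false n (perms n) (fun s xi =>
    mono n (fun j => (final_exps (dec s) X j - Y j - 1)%Z) xi * rhos p (dec s) (fun _ w => v w) xi w)).
  - unfold kern_one, kern. symmetry. apply (contour_ext r false n); auto.
    + apply approx_kern; auto using approx_const, approx_smono.
    + intros xi Hxi. unfold smono, sym. rewrite Cmult_1_l, <- csum_scal.
      apply csum_ext. intros s Hs. rewrite rhos_mono by apply Hd, Hs.
      rewrite Cmult_assoc, <- (mono_add r) by auto. f_equal.
      apply mono_ext; auto. intros; lia.
  - auto.
  - intros s Hs. apply approx_mult; auto using approx_mono.
    apply (approx_rhos p r false n); auto; [apply Hd, Hs|]. intros u. apply approx_const.
Qed.

Lemma kern_one_term_vanish p r n dec Y X v w s j : small_radius p r -> decomp n dec -> In s (perms n) ->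
  (1 <= j <= n)%nat -> (Y j < final_exps (dec s) X j)%Z ->
  contour r n (fun xi => mono n (fun j => (final_exps (dec s) X j - Y j - 1)%Z) xi
    * rhos p (dec s) (fun _ w => v w) xi w) = 0.
Proof.
  intros Hp Hd Hs Hj H. assert (Hr := small_radius_pos p r Hp).
  apply (contour_vanish r n _ _ j); auto; [lia|].
  apply (approx_rhos p r true n); auto; [apply Hd, Hs|]. intros u. apply approx_const.
Qed.

Lemma perm_range n s i : In s (perms n) -> (1 <= i <= n)%nat -> (1 <= fn 0%nat s i <= n)%nat.
Proof.
  intros Hs Hi. assert (Hl := length_perm _ _ Hs). apply in_perms in Hs.
  assert (H : In (fn 0%nat s i) s).
  { destruct i as [|i]; [lia|]. unfold fn. simpl. apply nth_In. lia. }
  apply (Permutation_in _ (Permutation_sym Hs)), in_seq in H. lia.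
Qed.

Lemma final_exps_perm n dec s X i : decomp n dec -> In s (perms n) -> (i <= n)%nat ->
  final_exps (dec s) X (fn 0%nat s i) = X i.
Proof.
  intros Hd Hs Hi. destruct (Hd s Hs) as [H1 H2].
  rewrite <- H2 at 2. rewrite fn_perm_of by auto. apply final_exps_act.
Qed.

(** In the term of [s] one of the exponents [x_i - y_(s(i)) - 1] is nonnegative: by comparing sums
    in the first case, at [i = n] in the second since [y_(s(n)) <= y_n]. *)
Lemma kern_one_vanish p r n dec Y w X v : small_radius p r -> decomp n dec -> increasing n Y ->
  (zsum n Y < zsum n X)%Z \/ (1 <= n)%nat /\ (Y n < X n)%Z ->
  kern_one p r n dec Y w X v = 0.
Proof.
  intros Hp Hd HY H. rewrite kern_one_expand by auto. apply csum_zero. intros s Hs.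
  destruct H as [H|[Hn H]].
  - rewrite <- (zsum_final_exps n (dec s) X) in H by apply Hd, Hs.
    apply zsum_lt in H. destruct H as [j [Hj H]]. apply (kern_one_term_vanish p r n dec Y X v w s j); auto.
  - assert (Hj := perm_range n s n Hs ltac:(lia)).
    apply (kern_one_term_vanish p r n dec Y X v w s (fn 0%nat s n)); auto.
    rewrite (final_exps_perm n) by auto.
    assert (HL := increasing_le n Y HY (fn 0%nat s n) n ltac:(lia) ltac:(lia)). lia.
Qed.

(* When [X (S m) > Y m] only the permutations fixing the last index survive. *)
Lemma kern_one_last p r m dec dec' Y w X v : small_radius p r -> decomp (S m) dec -> decomp m dec' ->
  increasing (S m) Y -> ((1 <= m)%nat -> (Y m < X (S m))%Z) ->
  kern_one p r (S m) dec Y w X v = if (Y (S m) =? X (S m))%Z then kern_one p r m dec' Y w X v else 0.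
Proof.
  intros Hp Hd Hd' HY HX. assert (Hr := small_radius_pos p r Hp).
  rewrite kern_one_expand by auto.
  rewrite (csum_filter _ (fun s => fn 0%nat s (S m) =? S m)%nat).
  rewrite (csum_zero (filter (fun a => negb _) _)), Cplus_0_r.
  2:{ intros s Hs. apply filter_In in Hs. destruct Hs as [Hs E].
      apply negb_true_iff, Nat.eqb_neq in E.
      assert (Hj := perm_range (S m) s (S m) Hs ltac:(lia)).
      apply (kern_one_term_vanish p r (S m) dec Y X v w s (fn 0%nat s (S m))); auto.
      rewrite (final_exps_perm (S m)) by auto.
      assert (HL := increasing_le (S m) Y HY (fn 0%nat s (S m)) m ltac:(lia) ltac:(lia)).
      specialize (HX ltac:(lia)). lia. }
  assert (HP : Permutation (filter (fun s => fn 0%nat s (S m) =? S m)%nat (perms (S m)))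
     (map (fun s => s ++ [S m]) (perms m))).
  { apply NoDup_Permutation.
    - apply NoDup_filter, NoDup_perms.
    - apply FinFun.Injective_map_NoDup; [|apply NoDup_perms].
      intros x y E. apply app_inj_tail in E. apply E.
    - intros s. rewrite filter_In, in_map_iff. split.
      + intros [Hs E]. apply Nat.eqb_eq in E. assert (Hl := length_perm _ _ Hs).
        destruct (exists_last (l := s)) as [s' [z ->]]; [intros ->; discriminate|].
        rewrite length_app in Hl. simpl in Hl.
        unfold fn in E. simpl in E. rewrite app_nth2 in E by lia.
        replace (m - length s')%nat with 0%nat in E by lia. simpl in E. subst z.
        exists s'. split; [reflexivity|]. apply in_perms in Hs. rewrite seq_S in Hs.
        apply in_perms. apply (Permutation_app_inv_r [S m]). exact Hs.
      + intros [s' [<- Hs']]. split.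
        * apply in_perms. rewrite seq_S. apply Permutation_app_tail. apply in_perms, Hs'.
        * apply Nat.eqb_eq. assert (Hl := length_perm _ _ Hs').
          unfold fn. simpl. rewrite app_nth2 by lia.
          replace (m - length s')%nat with 0%nat by lia. reflexivity. }
  rewrite (csum_Permutation _ _ _ HP), csum_map.
  set (g s xi := mono m (fun j => (- Y j - 1)%Z) xi *
    (1 * rhos p (dec' s) (fun xi w => mono m X xi * v w) xi w)).
  assert (Hg : forall s, In s (perms m) -> approx r false m (g s)).
  { intros s Hs. apply (approx_kern r m (fun _ => RtoC 1)); auto using approx_const.
    apply approx_rhos; auto; [apply Hd', Hs|]. intros u.
    apply approx_mult; auto using approx_mono, approx_const. }
  assert (E : forall s, In s (perms m) -> contour r (S m) (fun xi =>
    mono (S m) (fun j => (final_exps (dec (s ++ [S m])) X j - Y j - 1)%Z) xi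
      * rhos p (dec (s ++ [S m])) (fun _ w => v w) xi w) =
    if (X (S m) - Y (S m) - 1 =? -1)%Z then contour r m (g s) else 0).
  { intros s Hs. rewrite <- (contour_last r false m (X (S m) - Y (S m) - 1)%Z (g s)) by auto.
    assert (Hs1 : In (s ++ [S m]) (perms (S m))).
    { apply in_perms. rewrite seq_S. apply Permutation_app_tail, in_perms, Hs. }
    destruct (Hd _ Hs1) as [G1 G2]. destruct (Hd' _ Hs) as [G3 G4].
    assert (G5 : gens (S m) (dec' s)) by (eapply Forall_impl; [|apply G3]; simpl; intros; lia).
    (* The two words, chosen independently, give the same permutation and are therefore congruent;
       the generators in [dec' s] leave [xi_(m+1)] alone. *)
    assert (Hc : cox (S m) (dec (s ++ [S m])) (dec' s)).
    { apply perm_of_cox; auto. rewrite G2. unfold perm_of in *. rewrite seq_S.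
      rewrite apply_seq_app_l by (rewrite length_seq; auto). rewrite G4. reflexivity. }
    symmetry. apply (contour_ext r false (S m)); auto.
    - apply approx_mult; auto using approx_mono.
      apply (approx_rhos p r false (S m)); auto. intros u. apply approx_const.
    - intros xi Hxi.
      assert (E1 := cox_rhos p r (S m) _ _ Hp Hc (fun xi w => mono (S m) X xi * v w) xi Hxi w).
      rewrite (rhos_mono p (S m) (dec (s ++ [S m])) X v xi w G1) in E1.
      assert (E2 : rhos p (dec' s) (fun xi w => mono (S m) X xi * v w) xi w =
        zpowC (xi (S m)) (X (S m)) * rhos p (dec' s) (fun xi w => mono m X xi * v w) xi w).
      { rewrite <- (rhos_scal p m (dec' s) (fun xi => zpowC (xi (S m)) (X (S m)))); auto.
        - f_equal. apply functional_extensionality; intros x.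
          apply functional_extensionality; intros u. simpl. ring.
        - intros k x Hk. rewrite sw_other by lia. reflexivity. }
      rewrite E2 in E1.
      transitivity (mono (S m) (fun j => (- Y j - 1)%Z) xi *
        (mono (S m) (final_exps (dec (s ++ [S m])) X) xi *
           rhos p (dec (s ++ [S m])) (fun _ w => v w) xi w)).
      + rewrite Cmult_assoc, <- (mono_add r) by auto. f_equal.
        apply mono_ext; auto. intros; lia.
      + rewrite E1. cbn [mono]. unfold g.
        replace (X (S m) - Y (S m) - 1)%Z with (X (S m) + (- Y (S m) - 1))%Z by lia.
        rewrite zpowC_add by (apply (torus_nz r (S m)); auto; lia). ring. }
  rewrite (csum_ext _ _ _ E).
  replace (X (S m) - Y (S m) - 1 =? -1)%Z with (Y (S m) =? X (S m))%Z
    by (apply eq_true_iff_eq; rewrite !Z.eqb_eq; lia).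
  destruct (Y (S m) =? X (S m))%Z; [|apply csum_zero; reflexivity].
  rewrite <- (contour_csum r false m (perms m) g) by auto.
  unfold kern_one, kern, smono, sym. f_equal. apply functional_extensionality; intros xi.
  unfold g. rewrite csum_scal. f_equal. rewrite csum_scal. reflexivity.
Qed.

(** * Identification with the identity kernel *)

Fixpoint pos_eqb (n : nat) (Y X : nat -> Z) : bool :=
  match n with
  | O => true
  | S m => (pos_eqb m Y X && (Y (S m) =? X (S m))%Z)%bool
  end.

Lemma pos_eqb_spec n Y X : pos_eqb n Y X = true <-> forall j, (1 <= j <= n)%nat -> Y j = X j.
Proof.
  induction n as [|n IH]; simpl.
  - split; [intros; lia|reflexivity].
  - rewrite andb_true_iff, IH, Z.eqb_eq. split.
    + intros [H1 H2] j Hj. destruct (Nat.eq_dec j (S n)) as [->|]; [auto|apply H1; lia].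
    + intros H. split; [intros; apply H|apply H]; lia.
Qed.

Definition delta (n : nat) (Y : nat -> Z) (w : word) (X : nat -> Z) (v : word -> C) : C :=
  if pos_eqb n Y X then v w else 0.

Lemma pos_eqb_bump n i d Y X : pos_eqb n (bump i d Y) X = pos_eqb n Y (bump i (- d) X).
Proof.
  apply eq_true_iff_eq. rewrite !pos_eqb_spec.
  split; intros H j Hj; specialize (H j Hj); unfold bump in *; destruct (j =? i)%nat; lia.
Qed.

Lemma pos_eqb_adj n Y X i : pos_eqb n Y X = true -> adj n Y i = adj n X i.
Proof.
  rewrite pos_eqb_spec. intros H. apply eq_true_iff_eq. rewrite !adj_spec.
  split; intros [H1 H2]; split; auto; [rewrite <- !H by lia|rewrite !H by lia]; auto.
Qed.

(** The identity commutes with the generator. A jump from [Y] to [X] is read from either end, and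
    both readings must agree on what is blocked: for increasing configurations one step apart, the
    blocking conditions of that jump fail at both ends. *)
Lemma delta_gen p n Y X w v : increasing n Y -> increasing n X ->
  gen_hop p n (fun Y w => delta n Y w X v) Y w = gen_forward p n (delta n Y w) X v.
Proof.
  intros HY HX. unfold gen_hop, gen_forward. apply csum_ext. intros i Hi. apply in_seq in Hi.
  assert (A1 : pos_eqb n Y (bump i (-1) X) = true ->
    adj n Y i = false /\ adj n X (i - 1) = false /\ pos_eqb n Y X = false).
  { rewrite pos_eqb_spec. intros H. assert (Hii := H i ltac:(lia)). rewrite bump_same in Hii.
    repeat split; apply not_true_is_false.
    - rewrite adj_spec. intros [E1 E2]. assert (Hs := H (S i) ltac:(lia)).
      rewrite bump_other in Hs by lia. specialize (HX i ltac:(lia)). lia.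
    - rewrite adj_spec. intros [E1 E2]. assert (Hs := H (i - 1)%nat ltac:(lia)).
      rewrite bump_other in Hs by lia. specialize (HY (i - 1)%nat ltac:(lia)).
      replace (S (i - 1)) with i in * by lia. lia.
    - rewrite pos_eqb_spec. intros E. specialize (E i ltac:(lia)). lia. }
  assert (A2 : pos_eqb n Y (bump i 1 X) = true ->
    adj n Y (i - 1) = false /\ adj n X i = false /\ pos_eqb n Y X = false).
  { rewrite pos_eqb_spec. intros H. assert (Hii := H i ltac:(lia)). rewrite bump_same in Hii.
    repeat split; apply not_true_is_false.
    - rewrite adj_spec. intros [E1 E2]. assert (Hs := H (i - 1)%nat ltac:(lia)).
      rewrite bump_other in Hs by lia. specialize (HX (i - 1)%nat ltac:(lia)).
      replace (S (i - 1)) with i in * by lia. lia.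
    - rewrite adj_spec. intros [E1 E2]. assert (Hs := H (S i) ltac:(lia)).
      rewrite bump_other in Hs by lia. specialize (HY i ltac:(lia)). lia.
    - rewrite pos_eqb_spec. intros E. specialize (E i ltac:(lia)). lia. }
  assert (A3 := fun H => pos_eqb_adj n Y X i H). assert (A4 := fun H => pos_eqb_adj n Y X (i - 1) H).
  unfold delta, hop. rewrite !pos_eqb_bump. change (- (1))%Z with (-1)%Z. change (- (-1))%Z with 1%Z.
  destruct (pos_eqb n Y (bump i (-1) X)) eqn:E1, (pos_eqb n Y (bump i 1 X)) eqn:E2,
    (pos_eqb n Y X) eqn:E3;
  try (destruct A1 as [B1 [B2 B3]]; [reflexivity|]; try discriminate; rewrite ?B1, ?B2);
  try (destruct A2 as [C1 [C2 C3]]; [reflexivity|]; try discriminate; rewrite ?C1, ?C2);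
  try (rewrite A3, A4 by reflexivity);
  repeat match goal with |- context [adj ?a ?b ?c] => destruct (adj a b c) end; try discriminate; ring.
Qed.

(** The last displacement counts twice. Raising [x_n] lowers the weight by 2; raising another [y_i]
    or lowering another [x_i] restores only 1, while raising [y_n] or lowering [x_n] restores 2.
    This singles out one term on each side of the commutation relation. *)
Definition weight (n : nat) (Y X : nat -> Z) : Z := (zsum n Y - zsum n X + Y n - X n)%Z.

Lemma csum_last n (f : nat -> C) : (forall i, (1 <= i <= n)%nat -> f i = 0) ->
  csum (seq 1 (S n)) f = f (S n).
Proof.
  intros H. rewrite seq_S, csum_app, csum_zero.
  - simpl. ring.
  - intros i Hi. apply in_seq in Hi. apply H. lia.
Qed.

Lemma increasing_bump_up n i Y : increasing n Y -> adj n Y i = false -> increasing n (bump i 1 Y).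
Proof.
  intros H E j Hj. specialize (H j Hj). unfold bump.
  destruct (Nat.eqb_spec j i), (Nat.eqb_spec (S j) i); try lia.
  subst j. apply not_true_iff_false in E. rewrite adj_spec in E. lia.
Qed.

Lemma increasing_bump_down n i Y : increasing n Y -> adj n Y (i - 1) = false ->
  increasing n (bump i (-1) Y).
Proof.
  intros H E j Hj. specialize (H j Hj). unfold bump.
  destruct (Nat.eqb_spec j i), (Nat.eqb_spec (S j) i); try lia.
  subst i. replace (S j - 1)%nat with j in E by lia.
  apply not_true_iff_false in E. rewrite adj_spec in E. lia.
Qed.

Lemma adj_top n Y : adj n Y n = false.
Proof. apply not_true_iff_false. rewrite adj_spec. lia. Qed.

Lemma bump_bump i d d' e : bump i d (bump i d' e) = bump i (d' + d) e.
Proof.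
  apply functional_extensionality; intros j. unfold bump. destruct (j =? i)%nat; lia.
Qed.

Lemma bump_0 i e : bump i 0 e = e.
Proof. apply functional_extensionality; intros j. unfold bump. destruct (j =? i)%nat; lia. Qed.

(* Evaluating the commutation of the two generators at [(Y, X + e_n)] moves the
   last particle of both configurations one step to the right. *)
Lemma commute_step p m (K : (nat -> Z) -> word -> (nat -> Z) -> (word -> C) -> C) Y X :
  RtoC p <> 0 ->
  (forall Y X w v, increasing (S m) Y -> increasing (S m) X ->
     gen_hop p (S m) (fun Y w => K Y w X v) Y w = gen_forward p (S m) (K Y w) X v) ->
  increasing (S m) Y -> increasing (S m) X ->
  (forall Y' X', increasing (S m) Y' -> increasing (S m) X' ->
     (weight (S m) Y' X' < weight (S m) Y X)%Z -> forall w v, K Y' w X' v = 0) ->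
  forall w v, K Y w X v = K (bump (S m) 1 Y) w (bump (S m) 1 X) v.
Proof.
  intros Hp Hcomm HY HX IH w v. set (X' := bump (S m) 1 X).
  assert (HX' : increasing (S m) X') by (apply increasing_bump_up; auto using adj_top).
  (* After the shift the last particle of [X'] has an empty site on its left, so the step back to
     [X] is allowed. *)
  assert (Hadj : adj (S m) X' m = false).
  { apply not_true_iff_false. rewrite adj_spec. unfold X'. intros [H1 H2].
    rewrite bump_same, bump_other in H2 by lia. specialize (HX m ltac:(lia)). lia. }
  assert (HW : weight (S m) Y X' = (weight (S m) Y X - 2)%Z).
  { unfold weight, X'. rewrite zsum_bump, bump_same by lia. lia. }
  assert (Z0 : forall w v, K Y w X' v = 0) by (intros; apply IH; auto; lia).
  assert (E := Hcomm Y X' w v HY HX'). unfold gen_hop, gen_forward in E.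
  assert (wt_up : forall Y X i, (1 <= i <= m)%nat ->
    weight (S m) (bump i 1 Y) X = (weight (S m) Y X + 1)%Z).
  { intros. unfold weight. rewrite zsum_bump, bump_other by lia. lia. }
  rewrite csum_last in E.
  2:{ intros i Hi. unfold hop. rewrite !Z0.
      replace (if adj (S m) Y i then RtoC 0 else RtoC p * (K (bump i 1 Y) w X' v - 0)) with (RtoC 0).
      2:{ destruct (adj (S m) Y i) eqn:A; [reflexivity|].
          rewrite IH; [ring|apply increasing_bump_up; auto|auto|].
          rewrite wt_up by auto. lia. }
      replace (if adj (S m) Y (i - 1) then RtoC 0 else RtoC (1 - p) * (K (bump i (-1) Y) w X' v - 0))
        with (RtoC 0).
      2:{ destruct (adj (S m) Y (i - 1)) eqn:A; [reflexivity|].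
          rewrite IH; [ring|apply increasing_bump_down; auto|auto|].
          unfold weight in *. rewrite zsum_bump, bump_other by lia. lia. }
      destruct (adj (S m) Y i); ring. }
  rewrite csum_last in E.
  2:{ intros i Hi. rewrite !Z0.
      replace (if adj (S m) X' (i - 1) then RtoC 0 else K Y w (bump i (-1) X') v) with (RtoC 0).
      2:{ destruct (adj (S m) X' (i - 1)) eqn:A; [reflexivity|].
          rewrite IH; [reflexivity|auto|apply increasing_bump_down; auto|].
          unfold weight in *. rewrite zsum_bump, bump_other by lia. lia. }
      replace (if adj (S m) X' i then RtoC 0 else K Y w (bump i 1 X') v) with (RtoC 0).
      2:{ destruct (adj (S m) X' i) eqn:A; [reflexivity|].
          rewrite IH; [reflexivity|auto|apply increasing_bump_up; auto|].
          unfold weight in *. rewrite zsum_bump, bump_other by lia. lia. }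
      destruct (adj (S m) X' (i - 1)), (adj (S m) X' i); ring. }
  replace (S m - 1)%nat with m in E by lia.
  rewrite !adj_top, Hadj, !Z0 in E.
  replace (if adj (S m) Y m then RtoC 0 else RtoC (1 - p) * (K (bump (S m) (-1) Y) w X' v - 0))
    with (RtoC 0) in E.
  2:{ destruct (adj (S m) Y m) eqn:A; [reflexivity|].
      rewrite IH; [ring|apply increasing_bump_down; auto|auto|].
      - replace (S m - 1)%nat with m by lia. auto.
      - unfold weight in *. rewrite zsum_bump, bump_same by lia. lia. }
  rewrite (IH Y (bump (S m) 1 X')) in E.
  2: auto. 2: apply increasing_bump_up; auto using adj_top.
  2:{ unfold weight in *. rewrite zsum_bump, bump_same by lia. lia. }
  unfold X' at 2 in E. rewrite bump_bump in E. change (1 + -1)%Z with 0%Z in E. rewrite bump_0 in E.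
  assert (E' : RtoC p * K (bump (S m) 1 Y) w X' v = RtoC p * K Y w X v).
  { transitivity (RtoC p * (K (bump (S m) 1 Y) w X' v - 0) + 0 + 0); [ring|].
    rewrite E. ring. }
  transitivity (/ RtoC p * (RtoC p * K Y w X v)); [field; auto|].
  rewrite <- E'. field; auto.
Qed.

(** Outer induction on the number of particles, inner induction on a bound for the weight, starting
    from negative weights. *)
Lemma kern_one_delta p r n dec : small_radius p r -> decomp n dec ->
  forall Y X w v, increasing n Y -> increasing n X -> kern_one p r n dec Y w X v = delta n Y w X v.
Proof.
  intros Hp. assert (Hr := small_radius_pos p r Hp).
  assert (Hp0 : RtoC p <> 0) by (apply RtoC_nz; destruct Hp; lra).
  revert dec. induction n as [|m IHn]; intros dec Hd Y X w v HY HX.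
  - assert (Hg : dec [] = []).
    { destruct (Hd []) as [H _]; [left; reflexivity|].
      destruct (dec []) as [|k a]; [reflexivity|]. inversion H; lia. }
    unfold kern_one, kern, contour, smono, sym, delta. simpl. rewrite Hg. simpl. field.
  - set (K := fun Y w X v => kern_one p r (S m) dec Y w X v - delta (S m) Y w X v).
    assert (Hcomm : forall Y X w v, increasing (S m) Y -> increasing (S m) X ->
      gen_hop p (S m) (fun Y w => K Y w X v) Y w = gen_forward p (S m) (K Y w) X v).
    { intros Y' X' w' v' HY' HX'.
      assert (E1 : gen_hop p (S m) (fun Y w => kern_one p r (S m) dec Y w X' v') Y' w' =
                   gen_forward p (S m) (kern_one p r (S m) dec Y' w') X' v').
      { unfold kern_one. rewrite (kern_forward p r (S m) dec (fun _ => RtoC 1) Y' w' X' v')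
          by auto using approx_const.
        rewrite <- kern_backward; auto using approx_const, approx_smono.
        - intros k xi Hk. reflexivity.
        - intros k Hk. apply rho_sym; auto. }
      assert (E2 := delta_gen p (S m) Y' X' w' v' HY' HX').
      transitivity (gen_hop p (S m) (fun Y w => kern_one p r (S m) dec Y w X' v') Y' w' +
        (- RtoC 1) * gen_hop p (S m) (fun Y w => delta (S m) Y w X' v') Y' w').
      - unfold gen_hop. rewrite <- csum_scal, <- csum_plus. apply csum_ext. intros i _.
        unfold K, hop. destruct (adj (S m) Y' i), (adj (S m) Y' (i - 1)); ring.
      - rewrite E1, E2.
        unfold gen_forward. rewrite <- csum_scal, <- csum_plus. apply csum_ext. intros i _.
        unfold K. destruct (adj (S m) X' i), (adj (S m) X' (i - 1)); ring. }
    assert (HK : forall (b : nat) Y X, increasing (S m) Y -> increasing (S m) X ->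
      (weight (S m) Y X < Z.of_nat b)%Z -> forall w v, K Y w X v = 0).
    { clear Y X w v HY HX. induction b as [|b IHb]; intros Y X HY HX HW w v.
      (* A negative weight means that the sum of the positions of [X] or its last position exceeds
         that of [Y]. *)
      - assert (EF : kern_one p r (S m) dec Y w X v = 0).
        { apply kern_one_vanish; auto. unfold weight in HW.
          destruct (Z_lt_ge_dec (zsum (S m) Y) (zsum (S m) X)); [left; auto|right; lia]. }
        unfold K. rewrite EF. unfold delta. destruct (pos_eqb (S m) Y X) eqn:Eq; [|ring].
        rewrite pos_eqb_spec in Eq. unfold weight in HW.
        rewrite (zsum_ext (S m) Y X Eq), Eq in HW by lia. lia.
      (* Shifting both last particles keeps the weight, so [commute_step] can be iterated. *)
      - assert (Hstep : forall k, K Y w X v =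
          K (bump (S m) (Z.of_nat k) Y) w (bump (S m) (Z.of_nat k) X) v).
        { induction k as [|k IHk]; [rewrite !bump_0; reflexivity|].
          assert (U : forall k Y, increasing (S m) Y ->
            increasing (S m) (bump (S m) (Z.of_nat k) Y)).
          { intros k0 Y0 H0 j Hj. specialize (H0 j Hj). unfold bump.
            destruct (Nat.eqb_spec j (S m)), (Nat.eqb_spec (S j) (S m)); lia. }
          rewrite IHk. rewrite (commute_step p m K); auto.
          - rewrite !bump_bump. replace (Z.of_nat k + 1)%Z with (Z.of_nat (S k)) by lia. reflexivity.
          - intros Y' X' HY' HX' HW'. apply IHb; auto.
            unfold weight in *. rewrite !zsum_bump, !bump_same in HW' by lia. lia. }
        (* Enough shifts to bring the last position of [X] beyond [y_m], where the last particle
           decouples. *)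
        set (k := Z.to_nat (Y m - X (S m) + 1)). rewrite (Hstep k).
        set (Y' := bump (S m) (Z.of_nat k) Y). set (X' := bump (S m) (Z.of_nat k) X).
        assert (HY' : increasing (S m) Y').
        { intros j Hj. specialize (HY j Hj). unfold Y', bump.
          destruct (Nat.eqb_spec j (S m)), (Nat.eqb_spec (S j) (S m)); lia. }
        destruct (decomp_exists m) as [dec' Hd'].
        unfold K. rewrite (kern_one_last p r m dec dec'); auto.
        + rewrite IHn; auto.
          * unfold delta. simpl. destruct (pos_eqb m Y' X'), (Y' (S m) =? X' (S m))%Z; simpl; ring.
          * intros j Hj. apply HY'. lia.
          * intros j Hj. unfold X'. rewrite !bump_other by lia. apply HX. lia.
        + intros Hm. unfold Y', X'. rewrite bump_other, bump_same by lia. lia. }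
    specialize (HK (S (Z.to_nat (weight (S m) Y X))) Y X HY HX ltac:(lia) w v).
    unfold K in HK.
    replace (kern_one p r (S m) dec Y w X v) with
      (kern_one p r (S m) dec Y w X v - delta (S m) Y w X v + delta (S m) Y w X v) by ring.
    rewrite HK. ring.
Qed.

(** * Powers of the generator *)

Definition point_mass (n : nat) (pi : list nat) : word -> C :=
  fun w => if list_eq_dec Nat.eq_dec (map w (seq 1 n)) pi then 1 else 0.

Lemma map_fn {A} (d : A) l : map (fn d l) (seq 1 (length l)) = l.
Proof.
  apply (nth_ext _ _ d d).
  - rewrite length_map, length_seq. reflexivity.
  - rewrite length_map, length_seq. intros i Hi.
    rewrite (nth_indep _ d (fn d l 0%nat)) by (rewrite length_map, length_seq; auto).
    rewrite map_nth, seq_nth by auto. reflexivity.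
Qed.

Lemma point_mass_fn n pi w : length w = n ->
  point_mass n pi (fn 0%nat w) = if list_eq_dec Nat.eq_dec w pi then 1 else 0.
Proof. intros <-. unfold point_mass. rewrite map_fn. reflexivity. Qed.

Lemma fn_replace_at k d X : (k < length X)%nat ->
  fn 0%Z (replace_at k (nth k X 0%Z + d)%Z X) = bump (S k) d (fn 0%Z X).
Proof.
  intros Hk. apply functional_extensionality. intros [|j]; [reflexivity|].
  unfold fn, bump, replace_at. simpl nth.
  destruct (Nat.eqb_spec (S j) (S k)) as [E|E].
  - replace j with k by lia. rewrite app_nth2; rewrite length_firstn, Nat.min_l by lia; [|lia].
    rewrite Nat.sub_diag. reflexivity.
  - destruct (Nat.lt_ge_cases j k).
    + rewrite app_nth1 by (rewrite length_firstn; lia).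
      rewrite <- (firstn_skipn k X) at 2. rewrite app_nth1 by (rewrite length_firstn; lia).
      reflexivity.
    + rewrite app_nth2; rewrite length_firstn, Nat.min_l by lia; [|lia].
      destruct (j - k)%nat as [|i] eqn:Ei; [lia|].
      change (nth i (skipn (S k) X) 0%Z = nth j X 0%Z).
      rewrite nth_skipn. f_equal. lia.
Qed.

Lemma length_replace_at {A} k (x : A) X : (k < length X)%nat -> length (replace_at k x X) = length X.
Proof.
  intros Hk. unfold replace_at. rewrite length_app, length_firstn. cbn [length].
  rewrite length_skipn. lia.
Qed.

Lemma Sorted_increasing X : Sorted Z.lt X -> increasing (length X) (fn 0%Z X).
Proof.
  intros H [|i] Hi; [lia|]. unfold fn; simpl nth. revert i Hi.
  induction H as [|x X HX IH Hx]; intros i Hi; simpl in Hi; [lia|].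
  destruct i as [|i].
  - destruct Hx; simpl in *; [lia|auto].
  - apply (IH i). lia.
Qed.

Lemma RtoC_fold_right (l : list (R * state)) (f : state -> R) (c : R) :
  RtoC (fold_right (fun (mv : R * state) acc => fst mv * (f (snd mv) - c) + acc)%R 0%R l) =
  csum l (fun mv => RtoC (fst mv) * (RtoC (f (snd mv)) - RtoC c)).
Proof.
  induction l as [|mv l IH]; simpl; [reflexivity|].
  rewrite RtoC_plus, RtoC_mult, RtoC_minus, IH. reflexivity.
Qed.

(** Legal moves preserve the strict order, so [f] and [G] are compared on increasing configurations
    only. List index [k] is particle [k+1], whence the shift of the range. *)
Lemma csum_moves p n (G : (nat -> Z) -> word -> C) (f : state -> R) Y w :
  length Y = n -> length w = n -> increasing n (fn 0%Z Y) ->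
  (forall Y w, length Y = n -> length w = n -> increasing n (fn 0%Z Y) ->
     RtoC (f (Y, w)) = G (fn 0%Z Y) (fn 0%nat w)) ->
  csum (moves p (Y, w)) (fun mv => RtoC (fst mv) * (RtoC (f (snd mv)) - RtoC (f (Y, w)))) =
  gen p n G (fn 0%Z Y) (fn 0%nat w).
Proof.
  intros HY Hw Hinc H. unfold moves, gen. rewrite csum_flat_map, HY.
  rewrite <- seq_shift, csum_map. apply csum_ext. intros k Hk. apply in_seq in Hk.
  rewrite csum_app. replace (S k - 1)%nat with k by lia. f_equal.
  - assert (E : ((S k <? n)%nat && (nth (S k) Y 0%Z =? nth k Y 0 + 1)%Z)%bool
               = adj n (fn 0%Z Y) (S k)) by reflexivity.
    rewrite E. destruct (adj n (fn 0%Z Y) (S k)) eqn:A.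
    + apply adj_spec in A.
      change (fn 0%nat w (S (S k))) with (nth (S k) w 0%nat).
      change (fn 0%nat w (S k)) with (nth k w 0%nat).
      destruct (nth (S k) w 0 <? nth k w 0)%nat; simpl; [|reflexivity].
      rewrite !H by (auto; rewrite length_swap_at; lia).
      rewrite fn_swap_at by lia. ring.
    + simpl. rewrite !H; auto.
      * rewrite fn_replace_at by lia. ring.
      * rewrite length_replace_at; lia.
      * rewrite fn_replace_at by lia. apply increasing_bump_up; auto.
  - assert (E : ((0 <? k)%nat && (nth (k - 1) Y 0%Z =? nth k Y 0 - 1)%Z)%bool
               = adj n (fn 0%Z Y) k).
    { destruct k as [|k]; [reflexivity|]. apply eq_true_iff_eq. rewrite adj_spec.
      rewrite andb_true_iff, Nat.ltb_lt, Z.eqb_eq. unfold fn. simpl. rewrite Nat.sub_0_r. lia. }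
    rewrite E. destruct (adj n (fn 0%Z Y) k) eqn:A.
    + apply adj_spec in A. destruct k as [|k]; [lia|].
      replace (S k - 1)%nat with k by lia.
      change (fn 0%nat w (S (S k))) with (nth (S k) w 0%nat).
      change (fn 0%nat w (S k)) with (nth k w 0%nat).
      destruct (nth k w 0 <? nth (S k) w 0)%nat; simpl; [|reflexivity].
      rewrite !H by (auto; rewrite length_swap_at; lia).
      rewrite fn_swap_at by lia. ring.
    + simpl. unfold Z.sub. change (- (1))%Z with (-1)%Z. rewrite !H; auto.
      * rewrite fn_replace_at by lia. ring.
      * rewrite length_replace_at; lia.
      * rewrite fn_replace_at by lia. apply increasing_bump_down; auto.
        replace (S k - 1)%nat with k by lia. auto.
Qed.

Lemma approx_energy_pow p r n m : (0 < r)%R -> approx r false n (fun xi => energy p n xi ^ m).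
Proof. intros Hr. apply approx_pow; auto. apply approx_energy; auto. Qed.

(** [Qpow] peels off the first jump, which changes the initial state: this is the backward equation,
    each use of which inserts one factor of the energy. The base case is the initial condition. *)
Lemma Qpow_kern p r n dec X pi : small_radius p r -> decomp n dec ->
  length X = n -> increasing n (fn 0%Z X) ->
  forall m Y w, length Y = n -> length w = n -> increasing n (fn 0%Z Y) ->
  RtoC (Qpow p m (Y, w) (X, pi)) =
  kern r n (fun xi => energy p n xi ^ m) (smono p n dec (fn 0%Z X) (point_mass n pi))
    (fn 0%Z Y) (fn 0%nat w).
Proof.
  intros Hp Hd HX HXi m. assert (Hr := small_radius_pos p r Hp).
  induction m as [|m IH]; intros Y w HY Hw HYi.
  - change (fun xi : nat -> C => energy p n xi ^ 0) with (fun _ : nat -> C => RtoC 1).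
    fold (kern_one p r n dec (fn 0%Z Y) (fn 0%nat w) (fn 0%Z X) (point_mass n pi)).
    rewrite kern_one_delta by auto. unfold delta. rewrite point_mass_fn by auto.
    simpl. unfold state_eqb. simpl.
    destruct (list_eq_dec Z.eq_dec Y X) as [->|HYX].
    + rewrite (proj2 (pos_eqb_spec n _ _)) by auto. destruct (list_eq_dec _ w pi); reflexivity.
    + destruct (pos_eqb n _ _) eqn:E; [|reflexivity]. exfalso. apply HYX.
      apply (fn_ext 0%Z); [congruence|]. rewrite pos_eqb_spec in E. rewrite HY. auto.
  - change (Qpow p (S m) (Y, w) (X, pi)) with
      (fold_right (fun (mv : R * state) acc =>
        fst mv * (Qpow p m (snd mv) (X, pi) - Qpow p m (Y, w) (X, pi)) + acc)%R 0%R (moves p (Y, w))).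
    rewrite (RtoC_fold_right _ (fun s => Qpow p m s (X, pi))).
    rewrite (csum_moves p n _ (fun s => Qpow p m s (X, pi)) Y w HY Hw HYi IH).
    rewrite gen_gen_hop, (kern_backward p r n); auto using approx_energy_pow, approx_smono.
    + unfold kern. f_equal. apply functional_extensionality; intros xi. simpl. ring.
    + intros k xi Hk. rewrite energy_sw by auto. reflexivity.
    + intros k Hk. apply rho_sym; auto.
Qed.

(** * The matrices A_sigma *)

Lemma csum_single {A} (l : list A) a (f : A -> C) : NoDup l -> In a l ->
  (forall x, In x l -> x <> a -> f x = 0) -> csum l f = f a.
Proof.
  intros Hl Ha H. destruct (in_split _ _ Ha) as [l1 [l2 ->]].
  apply NoDup_remove_2 in Hl.
  rewrite csum_app. simpl. rewrite !csum_zero; [ring| |];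
    intros x Hx; apply H; try (intros ->; apply Hl); apply in_or_app; simpl; auto.
Qed.

Lemma list_nat_eq_dec (u w : list nat) : {u = w} + {u <> w}.
Proof. apply list_eq_dec, Nat.eq_dec. Qed.

Lemma csum_pair (l : list (list nat)) a b (f : list nat -> C) : NoDup l -> In a l -> In b l -> a <> b ->
  (forall x, In x l -> x <> a -> x <> b -> f x = 0) -> csum l f = f a + f b.
Proof.
  intros Hl Ha Hb Hab H.
  rewrite (csum_ext l f (fun x => (if list_nat_eq_dec x a then f x else 0)
    + (if list_nat_eq_dec x a then 0 else f x)))
    by (intros x _; destruct (list_nat_eq_dec x a); ring).
  rewrite csum_plus, (csum_single l a), (csum_single l b); auto;
    try (intros x Hx Hne; destruct (list_nat_eq_dec x a); auto; congruence).
  destruct (list_nat_eq_dec a a), (list_nat_eq_dec b a); congruence.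
Qed.

Lemma in_words n w : In w (words n) <-> length w = n /\ forall a, In a w -> (1 <= a <= n)%nat.
Proof. apply in_words_len. Qed.

Lemma words_swap_at n k w : (1 <= k < n)%nat -> In w (words n) -> In (swap_at k w) (words n).
Proof.
  rewrite !in_words. intros Hk [H1 H2]. rewrite length_swap_at by lia. split; auto.
  intros a Ha. apply H2. apply (Permutation_in _ (Permutation_sym (Permutation_swap_at k w ltac:(lia)))). auto.
Qed.

Definition others_eqb (n k : nat) (u w : list nat) : bool :=
  forallb (fun j => orb (orb (Nat.eqb j (k - 1)) (Nat.eqb j k))
                        (Nat.eqb (nth j u 0%nat) (nth j w 0%nat))) (seq 0 n).

Lemma others_eqb_spec n k u w : (1 <= k)%nat -> others_eqb n k u w = true <->
  forall j, (1 <= j <= n)%nat -> j <> k -> j <> S k -> fn 0%nat u j = fn 0%nat w j.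
Proof.
  intros Hk. unfold others_eqb. rewrite forallb_forall. split.
  - intros H [|j] Hj H1 H2; [lia|]. specialize (H j). rewrite in_seq in H.
    specialize (H ltac:(lia)). apply orb_true_iff in H. destruct H as [H|H].
    + apply orb_true_iff in H. rewrite !Nat.eqb_eq in H. lia.
    + apply Nat.eqb_eq, H.
  - intros H j Hj. apply in_seq in Hj.
    destruct (Nat.eqb_spec j (k - 1)), (Nat.eqb_spec j k); auto. simpl.
    apply Nat.eqb_eq. apply (H (S j)); lia.
Qed.

(** Only [w] and its exchange contribute. The three diagonal entries share one form, because
    [P = S - q T], [Q = S - p T] and the rate vanishes on equal letters; the off-diagonal ones are
    [T] times the rate. *)
Lemma Tmat_row p N xi k beta alpha (f : list nat -> C) w : (1 <= k < N)%nat -> In w (words N) ->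
  csum (words N) (fun u => f u * Tmat p N xi k beta alpha u w) =
  scat p (xi alpha) (xi beta) * f w +
  trans p (xi alpha) (xi beta) * (rate p k (fn 0%nat w) * (f (swap_at k w) - f w)).
Proof.
  intros Hk Hw. assert (Hw' := words_swap_at N k w Hk Hw).
  assert (Hl : length w = N) by (apply in_words in Hw; apply Hw).
  assert (HT : forall u, Tmat p N xi k beta alpha u w =
    Rentry p (xi beta) (xi alpha) (fn 0%nat u k) (fn 0%nat u (S k)) (fn 0%nat w k) (fn 0%nat w (S k))
      * if others_eqb N k u w then 1 else 0).
  { intros u. destruct k as [|k]; [lia|]. unfold Tmat. simpl (S k - 1)%nat. rewrite Nat.sub_0_r.
    unfold others_eqb. simpl (S k - 1)%nat. rewrite Nat.sub_0_r. reflexivity. }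
  assert (Hnd : NoDup (words N)) by apply NoDup_words_len.
  assert (Hself : others_eqb N k w w = true) by (apply others_eqb_spec; [lia|reflexivity]).
  assert (Hsw : others_eqb N k (swap_at k w) w = true).
  { apply others_eqb_spec; [lia|]. intros j Hj H1 H2. rewrite fn_swap_at by lia. apply sw_other; auto. }
  assert (Hfn : fn 0%nat (swap_at k w) = sw k (fn 0%nat w)) by (apply fn_swap_at; lia).
  set (a := xi alpha). set (b := xi beta).
  assert (Hz : forall u, In u (words N) -> u <> w -> u <> swap_at k w ->
    f u * Tmat p N xi k beta alpha u w = 0).
  { intros u Hu H1 H2. rewrite HT. destruct (others_eqb N k u w) eqn:E; [|ring].
    rewrite others_eqb_spec in E by lia. apply in_words in Hu. destruct Hu as [Hlu _].
    unfold Rentry.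
    destruct ((fn 0 w k =? fn 0 u k) && (fn 0 w (S k) =? fn 0 u (S k)))%nat eqn:C1.
    - apply andb_true_iff in C1. rewrite !Nat.eqb_eq in C1. exfalso. apply H1.
      apply (fn_ext 0%nat); [congruence|]. rewrite Hlu. intros j Hj.
      destruct (Nat.eq_dec j k) as [->|]; [symmetry; apply C1|].
      destruct (Nat.eq_dec j (S k)) as [->|]; [symmetry; apply C1|]. auto.
    - destruct ((fn 0 w k =? fn 0 u (S k)) && (fn 0 w (S k) =? fn 0 u k))%nat eqn:C2; [|ring].
      apply andb_true_iff in C2. rewrite !Nat.eqb_eq in C2. exfalso. apply H2.
      apply (fn_ext 0%nat); [rewrite length_swap_at; lia|]. rewrite Hlu, Hfn. intros j Hj.
      destruct (Nat.eq_dec j k) as [->|]; [rewrite sw_l; symmetry; apply C2|].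
      destruct (Nat.eq_dec j (S k)) as [->|]; [rewrite sw_r; symmetry; apply C2|].
      rewrite sw_other by auto. auto. }
  assert (Hdiag : Tmat p N xi k beta alpha w w =
     scat p a b - trans p a b * rate p k (fn 0%nat w)).
  { rewrite HT, Hself. unfold Rentry. rewrite !Nat.eqb_refl. simpl andb. cbv iota.
    unfold rate, scat, trans, den. fold a b. rewrite RtoC_1m.
    destruct (Nat.eqb_spec (fn 0%nat w k) (fn 0%nat w (S k))) as [->|E].
    - rewrite !Nat.ltb_irrefl. unfold Cdiv. ring_simplify.
      replace (b * a) with (a * b) by ring. ring.
    - destruct (Nat.ltb_spec (fn 0%nat w k) (fn 0%nat w (S k))),
        (Nat.ltb_spec (fn 0%nat w (S k)) (fn 0%nat w k)); try lia; unfold Cdiv; ring. }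
  destruct (Nat.eq_dec (fn 0%nat w k) (fn 0%nat w (S k))) as [E|E].
  - rewrite (csum_single _ w); auto.
    + rewrite Hdiag. unfold rate. rewrite E, Nat.ltb_irrefl. ring.
    + intros u Hu Hne. apply Hz; auto. intros ->. apply Hne.
      apply (fn_ext 0%nat); [apply length_swap_at; lia|]. intros j Hj. rewrite Hfn.
      unfold sw. destruct (Nat.eqb_spec j k) as [->|]; auto.
      destruct (Nat.eqb_spec j (S k)) as [->|]; auto.
  - rewrite (csum_pair _ w (swap_at k w)); auto.
    + rewrite Hdiag.
      assert (Hoff : Tmat p N xi k beta alpha (swap_at k w) w = trans p a b * rate p k (fn 0%nat w)).
      { rewrite HT, Hsw, Hfn, sw_l, sw_r. unfold Rentry.
        destruct (Nat.eqb_spec (fn 0%nat w k) (fn 0%nat w (S k))); [congruence|].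
        rewrite !Nat.eqb_refl. simpl andb. cbv iota. unfold rate, trans, den. fold a b.
        destruct (Nat.ltb_spec (fn 0%nat w (S k)) (fn 0%nat w k)),
          (Nat.ltb_spec (fn 0%nat w k) (fn 0%nat w (S k))); try lia; ring. }
      rewrite Hoff. fold a b. ring.
    + intros H. apply (f_equal (fun l => fn 0%nat l k)) in H. rewrite Hfn, sw_l in H. auto.
Qed.

Lemma rhos_agree p n a v xi xi' w : gens n a ->
  (forall j, (1 <= j <= n)%nat -> xi j = xi' j) ->
  rhos p a (fun _ w => v w) xi w = rhos p a (fun _ w => v w) xi' w.
Proof.
  intros Ha. revert xi xi' w. induction Ha as [|k a Hk Ha IH]; intros xi xi' w H; simpl; auto.
  assert (H' : forall u, rhos p a (fun _ w => v w) (sw k xi) u = rhos p a (fun _ w => v w) (sw k xi') u).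
  { intros u. apply IH. intros j Hj. unfold sw. destruct (j =? k)%nat; [apply H; lia|].
    destruct (j =? S k)%nat; apply H; lia. }
  unfold rho, hop. rewrite !H', !H by lia. reflexivity.
Qed.

(** Later factors multiply on the left, so the row [pi] meets the end of [a] first. The invariant,
    for arbitrary [tau] and [M], is that the remaining word acts by [rhos] on the variables
    reordered by [tau]. *)
Lemma Amat_fold p N xi pi nu a : gens N a -> forall tau M, length tau = N ->
  In pi (words N) -> In nu (words N) ->
  snd (fold_left (fun (st : list nat * mat) ak =>
         let (tau, M) := st in
         (swap_at ak tau,
          mmul N (Tmat p N xi ak (nth ak tau 0%nat) (nth (ak - 1) tau 0%nat)) M))
       a (tau, M)) pi nu =
  csum (words N) (fun u => rhos p a (fun _ w => point_mass N pi w)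
    (fun j => xi (fn 0%nat tau j)) (fn 0%nat u) * M u nu).
Proof.
  intros Ha. induction Ha as [|k a Hk Ha IH]; intros tau M Htau Hpi Hnu.
  - simpl. rewrite (csum_single _ pi); auto.
    + assert (Hl : length pi = N) by (apply in_words in Hpi; apply Hpi).
      rewrite point_mass_fn by auto. destruct (list_eq_dec _ pi pi); [ring|congruence].
    + apply NoDup_words_len.
    + intros u Hu Hne. apply in_words in Hu. rewrite point_mass_fn by apply Hu.
      destruct (list_eq_dec _ u pi); [congruence|ring].
  - cbn [fold_left]. rewrite IH; auto; [|rewrite length_swap_at; lia].
    set (Phi := rhos p a (fun _ w => point_mass N pi w)).
    set (xi1 := fun j => xi (fn 0%nat (swap_at k tau) j)).
    assert (E1 : xi1 = sw k (fun j => xi (fn 0%nat tau j))).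
    { apply functional_extensionality; intros j. unfold xi1. rewrite fn_swap_at by lia.
      unfold sw. destruct (j =? k)%nat; [|destruct (j =? S k)%nat]; reflexivity. }
    unfold mmul.
    rewrite (csum_ext _ _ (fun u => csum (words N) (fun u' =>
      Phi xi1 (fn 0%nat u) * (Tmat p N xi k (nth k tau 0%nat) (nth (k - 1) tau 0%nat) u u' * M u' nu))))
      by (intros; rewrite csum_scal; reflexivity).
    rewrite csum_swap. apply csum_ext. intros w Hw.
    rewrite (csum_ext _ _ (fun u => M w nu *
      (Phi xi1 (fn 0%nat u) * Tmat p N xi k (nth k tau 0%nat) (nth (k - 1) tau 0%nat) u w)))
      by (intros; ring).
    rewrite csum_scal, (Tmat_row p N xi k _ _ (fun u => Phi xi1 (fn 0%nat u))) by auto.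
    rewrite fn_swap_at by (apply in_words in Hw; lia).
    simpl. unfold rho, hop. fold Phi. rewrite <- E1.
    replace (nth (k - 1) tau 0%nat) with (fn 0%nat tau k)
      by (destruct k as [|k]; [lia|]; simpl; rewrite Nat.sub_0_r; reflexivity).
    change (nth k tau 0%nat) with (fn 0%nat tau (S k)). ring.
Qed.

Lemma Amat_seq_rhos p N xi a pi nu : gens N a -> In pi (words N) -> In nu (words N) ->
  Amat_seq p N xi a pi nu = rhos p a (fun _ w => point_mass N pi w) xi (fn 0%nat nu).
Proof.
  intros Ha Hpi Hnu. unfold Amat_seq. rewrite Amat_fold by (auto; apply length_seq).
  rewrite (csum_single _ nu); auto.
  - unfold mid. destruct (list_eq_dec _ nu nu); [|congruence]. rewrite Cmult_1_r.
    apply (rhos_agree p N); auto. intros j Hj. rewrite fn_seq.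
    destruct (Nat.leb_spec j N); [reflexivity|lia].
  - apply NoDup_words_len.
  - intros u Hu Hne. unfold mid. destruct (list_eq_dec _ u nu); [congruence|ring].
Qed.

(** * Factorisation of the integrand *)

Lemma cprod_mult {A} (l : list A) (f g : A -> C) :
  cprod l (fun a => f a * g a) = cprod l f * cprod l g.
Proof. induction l as [|a l IH]; simpl; [|rewrite IH]; ring. Qed.

Lemma cprod_ext {A} (l : list A) (f g : A -> C) :
  (forall a, In a l -> f a = g a) -> cprod l f = cprod l g.
Proof.
  induction l as [|a l IH]; simpl; intros H; [reflexivity|]. rewrite H, IH; auto.
Qed.

Lemma cprod_map {A B} (h : A -> B) (l : list A) (f : B -> C) :
  cprod (map h l) f = cprod l (fun a => f (h a)).
Proof. induction l as [|a l IH]; simpl; [|rewrite IH]; reflexivity. Qed.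

Lemma cprod_Permutation {A} (l l' : list A) (f : A -> C) :
  Permutation l l' -> cprod l f = cprod l' f.
Proof. induction 1; simpl; try congruence; ring. Qed.

Lemma cprod_app {A} (l l' : list A) (f : A -> C) : cprod (l ++ l') f = cprod l f * cprod l' f.
Proof. induction l as [|a l IH]; simpl; [|rewrite IH]; ring. Qed.

Lemma mono_cprod n e xi : mono n e xi = cprod (seq 1 n) (fun j => zpowC (xi j) (e j)).
Proof.
  induction n as [|n IH]; [reflexivity|]. rewrite seq_S, cprod_app, <- IH. simpl. ring.
Qed.

Definition exp_energy (p t : R) (n : nat) (xi : nat -> C) : C :=
  cprod (seq 1 n) (fun i => cexp (epsC p (xi i) * RtoC t)).

(** The exponential factor is the same in all terms and leaves the sum; in each term the product
    over [i] is reindexed by [j = s(i)], which splits off the monomial in the initial positions. *)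
Lemma integrand_smono p r t N dec X Y pi nu xi : (0 < r)%R -> torus r N xi ->
  decomp N dec -> In pi (words N) -> In nu (words N) ->
  integrand p t N dec X Y pi nu xi =
  mono N (fun j => (- fn 0%Z Y j - 1)%Z) xi *
    (exp_energy p t N xi * smono p N dec (fn 0%Z X) (point_mass N pi) xi (fn 0%nat nu)).
Proof.
  intros Hr Hxi Hd Hpi Hnu. unfold integrand, smono, sym.
  rewrite Cmult_assoc, <- csum_scal. apply csum_ext. intros s Hs.
  destruct (Hd s Hs) as [H1 H2].
  rewrite rhos_mono, Amat_seq_rhos by auto. set (A := rhos _ _ _ _ _).
  set (G := fun j => zpowC (xi j) (final_exps (dec s) (fn 0%Z X) j - fn 0%Z Y j - 1)).
  assert (E : cprod (seq 1 N) (fun i => let si := nth (i - 1) s 0%nat in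
      zpowC (xi si) (nth (i - 1) X 0%Z - nth (si - 1) Y 0%Z - 1)%Z
        * cexp (epsC p (xi i) * RtoC t)) =
    cprod (seq 1 N) G * exp_energy p t N xi).
  { cbv zeta. rewrite cprod_mult. f_equal.
    transitivity (cprod (map (fn 0%nat s) (seq 1 N)) G).
    - rewrite cprod_map. apply cprod_ext. intros i Hi. apply in_seq in Hi.
      assert (Hr1 := perm_range N s i Hs ltac:(lia)). unfold G.
      rewrite (final_exps_perm N) by (auto; lia).
      destruct i as [|i]; [lia|]. simpl (S i - 1)%nat. rewrite Nat.sub_0_r.
      change (nth i s 0%nat) with (fn 0%nat s (S i)).
      change (nth i X 0%Z) with (fn 0%Z X (S i)).
      destruct (fn 0%nat s (S i)) as [|j]; [lia|]. simpl (S j - 1)%nat. rewrite Nat.sub_0_r.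
      reflexivity.
    - apply cprod_Permutation. rewrite <- (length_perm N s Hs) at 1. rewrite map_fn.
      apply Permutation_sym, in_perms, Hs. }
  transitivity (A * (cprod (seq 1 N) G * exp_energy p t N xi)); [f_equal; exact E|]. unfold G.
  rewrite <- (mono_cprod N (fun j => (final_exps (dec s) (fn 0%Z X) j - fn 0%Z Y j - 1)%Z)).
  rewrite (mono_ext N _ (fun j => (final_exps (dec s) (fn 0%Z X) j + (- fn 0%Z Y j - 1))%Z) xi xi)
    by (intros; try reflexivity; lia).
  rewrite (mono_add r) by auto. ring.
Qed.

(** * The exponential of the energy *)

Lemma cexp_plus z w : cexp (z + w) = cexp z * cexp w.
Proof.
  destruct z as [a b], w as [c d]. unfold cexp, Cmult. simpl.
  rewrite exp_plus, cos_plus, sin_plus. f_equal; ring.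
Qed.

Lemma cexp_0 : cexp 0 = 1.
Proof.
  unfold cexp. simpl. rewrite exp_0, cos_0, sin_0. change (1%R, 0%R) with (RtoC 1). ring.
Qed.

Lemma exp_energy_cexp p t n xi : exp_energy p t n xi = cexp (energy p n xi * RtoC t).
Proof.
  unfold exp_energy, energy. induction (seq 1 n) as [|i l IH]; simpl.
  - rewrite Cmult_0_l, cexp_0. reflexivity.
  - rewrite IH, <- cexp_plus. f_equal. ring.
Qed.

(* [Re (u * cexp (s * z))]: all its derivatives in the real variable [s] are of
   the same form, so that Taylor's formula applies. *)
Definition re_exp (u z : C) (s : R) : R :=
  (exp (s * fst z) * (fst u * cos (s * snd z) - snd u * sin (s * snd z)))%R.

Lemma re_exp_derive u z s : is_derive (re_exp u z) s (re_exp (u * z) z s).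
Proof.
  unfold re_exp. auto_derive; auto. simpl. ring.
Qed.

Lemma Derive_n_re_exp u z m s : Derive_n (re_exp u z) m s = re_exp (u * z ^ m) z s.
Proof.
  revert s. induction m as [|m IH]; intros s.
  - simpl. rewrite Cmult_1_r. reflexivity.
  - simpl. rewrite (Derive_ext _ _ s IH).
    rewrite (is_derive_unique _ _ _ (re_exp_derive _ z s)).
    f_equal. ring.
Qed.

Lemma ex_derive_n_re_exp u z m s : ex_derive_n (re_exp u z) m s.
Proof.
  destruct m as [|m]; simpl; auto.
  apply (ex_derive_ext (re_exp (u * z ^ m) z)).
  - intros x. symmetry. apply Derive_n_re_exp.
  - exists (re_exp (u * z ^ m * z) z s). apply re_exp_derive.
Qed.

Lemma re_exp_bound u z s : (0 <= s <= 1)%R ->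
  (Rabs (re_exp u z s) <= 2 * Cmod u * exp (Cmod z))%R.
Proof.
  intros Hs. unfold re_exp. rewrite Rabs_mult.
  assert (H1 : (Rabs (exp (s * fst z)) <= exp (Cmod z))%R).
  { rewrite Rabs_pos_eq by (apply Rlt_le, exp_pos).
    assert (H : (s * fst z <= Cmod z)%R).
    { assert (Ha := re_le_Cmod z). unfold Re in Ha.
      assert (Hb := Rle_abs (fst z)). assert (Hc := Rabs_pos (fst z)).
      apply Rle_trans with (s * Rabs (fst z))%R; [apply Rmult_le_compat_l; lra|nra]. }
    destruct H as [H|H]; [apply Rlt_le, exp_increasing, H|rewrite H; lra]. }
  assert (H2 : (Rabs (fst u * cos (s * snd z) - snd u * sin (s * snd z)) <= 2 * Cmod u)%R).
  { assert (B := Rmax_Cmod u).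
    assert (Bu := Rle_trans _ _ _ (Rmax_l _ _) B). assert (Bv := Rle_trans _ _ _ (Rmax_r _ _) B).
    unfold Rminus. eapply Rle_trans; [apply Rabs_triang|].
    rewrite Rabs_Ropp, !Rabs_mult.
    assert (C1 : (Rabs (cos (s * snd z)) <= 1)%R) by (apply Rabs_le, COS_bound).
    assert (C2 : (Rabs (sin (s * snd z)) <= 1)%R) by (apply Rabs_le, SIN_bound).
    generalize (Rabs_pos (fst u)) (Rabs_pos (snd u)) (Rabs_pos (cos (s * snd z)))
      (Rabs_pos (sin (s * snd z))). nra. }
  rewrite Rmult_comm. apply Rmult_le_compat; auto using Rabs_pos.
Qed.

Definition exp_partial (M : nat) (z : C) : C :=
  csum (seq 0 (S M)) (fun m => RtoC (/ INR (fact m)) * z ^ m).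

Lemma re_exp_1 u z : re_exp u z 1 = fst (u * cexp z).
Proof.
  unfold re_exp, cexp, Re, Im. rewrite !Rmult_1_l. simpl. ring.
Qed.

Lemma exp_partial_fst u M z :
  fst (u * exp_partial M z) = sum_f_R0 (fun m => (1 - 0) ^ m / INR (fact m) * re_exp (u * z ^ m) z 0)%R M.
Proof.
  assert (H0 : forall v, re_exp v z 0 = fst v).
  { intros v. unfold re_exp. rewrite !Rmult_0_l, exp_0, cos_0, sin_0. ring. }
  induction M as [|M IH].
  - unfold exp_partial. simpl. rewrite H0. simpl. field.
  - unfold exp_partial in *. rewrite seq_S, csum_app.
    rewrite Cmult_plus_distr_l. cbn [csum fold_right sum_f_R0]. rewrite <- IH.
    change (fst (?x + ?y)) with (fst x + fst y)%R.
    simpl (0 + S M)%nat. rewrite H0.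
    replace (u * (RtoC (/ INR (fact (S M))) * z ^ S M + RtoC 0))
      with (RtoC (/ INR (fact (S M))) * (u * z ^ S M)) by ring.
    rewrite Rminus_0_r, pow1. generalize (u * z ^ S M)%C. intros [x y].
    set (c := INR (fact (S M))). simpl. unfold Rdiv.
    change (fst (?x + ?y)%C) with (fst x + fst y)%R. f_equal. ring.
Qed.

Lemma cexp_taylor_re u M z : (Cmod u = 1)%R ->
  (Rabs (fst (u * (cexp z - exp_partial M z))%C) <=
     2 * exp (Cmod z) * (Cmod z ^ S M / INR (fact (S M))))%R.
Proof.
  intros Hu.
  destruct (Taylor_Lagrange (re_exp u z) M 0 1) as [zeta [Hz E]]; [lra| |].
  { intros s _ k _. apply ex_derive_n_re_exp. }
  assert (E' : fst (u * (cexp z - exp_partial M z)) =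
    ((1 - 0) ^ S M / INR (fact (S M)) * re_exp (u * z ^ S M) z zeta)%R).
  { replace (u * (cexp z - exp_partial M z)) with (u * cexp z - u * exp_partial M z) by ring.
    change (fst (u * cexp z - u * exp_partial M z)) with
      (fst (u * cexp z)%C - fst (u * exp_partial M z)%C)%R.
    rewrite <- re_exp_1, E, exp_partial_fst, Derive_n_re_exp.
    rewrite (sum_eq _ (fun m => (1 - 0) ^ m / INR (fact m) * re_exp (u * z ^ m) z 0)%R)
      by (intros; rewrite Derive_n_re_exp; reflexivity).
    ring. }
  rewrite E', Rminus_0_r, pow1, Rabs_mult.
  assert (Hf : (0 < INR (fact (S M)))%R) by apply INR_fact_lt_0.
  assert (B := re_exp_bound (u * z ^ S M) z zeta ltac:(lra)).
  rewrite Cmod_mult, Hu, Cmod_pow, Rmult_1_l in B.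
  unfold Rdiv at 1. rewrite Rmult_1_l, Rabs_pos_eq by (apply Rlt_le, Rinv_0_lt_compat; auto).
  apply Rle_trans with (/ INR (fact (S M)) * (2 * Cmod z ^ S M * exp (Cmod z)))%R.
  - apply Rmult_le_compat_l; auto. apply Rlt_le, Rinv_0_lt_compat; auto.
  - right. field. lra.
Qed.

(** The estimate with [u = 1] controls the real part and the one with [u = - Ci] the imaginary part;
    each brings a factor 2. *)
Lemma cexp_taylor M z :
  (Cmod (cexp z - exp_partial M z) <= 4 * exp (Cmod z) * (Cmod z ^ S M / INR (fact (S M))))%R.
Proof.
  assert (A := cexp_taylor_re 1 M z Cmod_1).
  assert (B := cexp_taylor_re (- Ci) M z ltac:(rewrite Cmod_opp; apply Cmod_Ci)).
  set (d := cexp z - exp_partial M z) in *.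
  assert (E1 : fst (1 * d) = fst d) by (rewrite Cmult_1_l; reflexivity).
  assert (E2 : fst (- Ci * d) = snd d) by (simpl; ring).
  rewrite E1 in A. rewrite E2 in B.
  replace d with (RtoC (fst d) + Ci * RtoC (snd d)).
  - eapply Rle_trans; [apply Cmod_triangle|].
    rewrite Cmod_mult, Cmod_Ci, !Cmod_R, Rmult_1_l. lra.
  - destruct d as [x y]. unfold Ci, Cplus, Cmult, RtoC; simpl. f_equal; ring.
Qed.

Lemma cexp_uniform B : (0 < B)%R -> forall eps, (0 < eps)%R -> exists M0, forall M, (M0 <= M)%nat ->
  forall z, (Cmod z <= B)%R -> (Cmod (cexp z - exp_partial M z) <= eps)%R.
Proof.
  intros HB eps He. assert (Hexp := exp_pos B).
  destruct (cv_speed_pow_fact B (eps / (4 * exp B))%R) as [M0 HM].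
  { apply Rdiv_lt_0_compat; lra. }
  exists M0. intros M HMM z Hz. specialize (HM (S M) ltac:(lia)).
  unfold Rdist in HM. rewrite Rminus_0_r in HM. apply Rabs_def2 in HM. destruct HM as [HM _].
  assert (Hf : (0 < / INR (fact (S M)))%R) by apply Rinv_0_lt_compat, INR_fact_lt_0.
  eapply Rle_trans; [apply cexp_taylor|].
  assert (H1 : (exp (Cmod z) <= exp B)%R).
  { destruct Hz as [Hz|Hz]; [apply Rlt_le, exp_increasing, Hz|rewrite Hz; lra]. }
  assert (H2 : (Cmod z ^ S M / INR (fact (S M)) <= B ^ S M / INR (fact (S M)))%R).
  { apply Rmult_le_compat_r; [lra|]. apply pow_incr. split; auto using Cmod_ge_0. }
  assert (H3 : (0 <= Cmod z ^ S M / INR (fact (S M)))%R).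
  { apply Rmult_le_pos; [apply pow_le, Cmod_ge_0|lra]. }
  replace eps with (4 * exp B * (eps / (4 * exp B)))%R by (field; lra).
  assert (Hpz := exp_pos (Cmod z)).
  apply Rmult_le_compat; auto; lra.
Qed.

(** * Summation of the exponential series *)

Definition heat (p t : R) (n M : nat) (xi : nat -> C) : C :=
  csum (seq 0 (S M)) (fun m => RtoC (t ^ m / INR (fact m)) * energy p n xi ^ m).

Lemma heat_exp_partial p t n M xi : heat p t n M xi = exp_partial M (energy p n xi * RtoC t).
Proof.
  apply csum_ext. intros m _. rewrite Cpow_mult_l. unfold Rdiv.
  rewrite RtoC_mult, RtoC_pow. ring.
Qed.

Lemma approx_heat p t r n M : (0 < r)%R -> approx r false n (heat p t n M).
Proof.
  intros Hr. apply (approx_csum r false n (seq 0 (S M))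
    (fun m xi => RtoC (t ^ m / INR (fact m)) * energy p n xi ^ m)); auto.
  intros m _. apply approx_mult; auto using approx_const, approx_energy_pow.
Qed.

Lemma heat_exp_energy p t r n : (0 < r)%R -> forall eps, (0 < eps)%R ->
  exists M0, forall M, (M0 <= M)%nat -> forall xi, torus r n xi ->
    (Cmod (exp_energy p t n xi - heat p t n M xi) <= eps)%R.
Proof.
  intros Hr eps He.
  destruct (approx_bounded r false n (energy p n) Hr (approx_energy p r n Hr)) as [B [HB HE]].
  (* The added 1 keeps the bound positive when [t = 0]. *)
  destruct (cexp_uniform (B * Rabs t + 1)%R) with (eps := eps) as [M0 HM]; auto.
  { generalize (Rabs_pos t). nra. }
  exists M0. intros M HMM xi Hxi. rewrite exp_energy_cexp, heat_exp_partial.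
  apply HM; auto. rewrite Cmod_mult, Cmod_R. specialize (HE xi Hxi).
  generalize (Rabs_pos t). nra.
Qed.

Lemma approx_exp_energy p t r n : (0 < r)%R -> approx r false n (exp_energy p t n).
Proof.
  intros Hr. apply approx_limit. intros eps He.
  destruct (heat_exp_energy p t r n Hr eps He) as [M0 HM].
  exists (heat p t n M0). split; [apply approx_heat; auto|]. apply HM. lia.
Qed.

Lemma kern_heat p t r n M Psi Y w : (0 < r)%R -> approx_vec r false n Psi ->
  kern r n (heat p t n M) Psi Y w =
  csum (seq 0 (S M)) (fun m => RtoC (t ^ m / INR (fact m)) *
    kern r n (fun xi => energy p n xi ^ m) Psi Y w).
Proof.
  intros Hr HP.
  set (g := fun m xi => mono n (fun j => (- Y j - 1)%Z) xi * (energy p n xi ^ m * Psi xi w)).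
  assert (Ha : forall m, approx r false n (g m)).
  { intros m. apply (approx_kern r n (fun xi => energy p n xi ^ m)); auto using approx_energy_pow. }
  rewrite (csum_ext _ _ (fun m => contour r n (fun xi => RtoC (t ^ m / INR (fact m)) * g m xi))).
  2:{ intros m _. symmetry. apply (contour_scal r false n); auto. }
  rewrite <- (contour_csum r false n (seq 0 (S M))
    (fun m xi => RtoC (t ^ m / INR (fact m)) * g m xi)); auto.
  - unfold kern. f_equal. apply functional_extensionality; intros xi. unfold heat.
    set (e := mono n _ xi). set (f := Psi xi w).
    transitivity ((e * f) * csum (seq 0 (S M)) (fun m => RtoC (t ^ m / INR (fact m)) * energy p n xi ^ m));
      [ring|].
    rewrite <- csum_scal. apply csum_ext. intros m _. unfold g. fold e f. ring.
  - intros m _. apply (contour_scal r false n); auto.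
Qed.

Lemma kern_exp_limit p t r n Psi Y w : small_radius p r -> approx_vec r false n Psi ->
  forall eps, (0 < eps)%R -> exists M0, forall M, (M0 <= M)%nat ->
  (Cmod (csum (seq 0 (S M)) (fun m => RtoC (t ^ m / INR (fact m)) *
     kern r n (fun xi => energy p n xi ^ m) Psi Y w)
     - kern r n (exp_energy p t n) Psi Y w)%C <= eps)%R.
Proof.
  intros Hp HP eps He. assert (Hr := small_radius_pos p r Hp).
  assert (Ha : approx r false n (fun xi => mono n (fun j => (- Y j - 1)%Z) xi * Psi xi w)).
  { apply approx_mult; auto using approx_mono. }
  destruct (approx_bounded r false n _ Hr Ha) as [B [HB Hbd]].
  assert (Hrn : (0 < r ^ n)%R) by (apply pow_lt; auto).
  (* [B] bounds the rest of the integrand on the torus, and [3 r^n] is the constant of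
     [contour_bound]. *)
  assert (Hd : (0 < eps / (3 * r ^ n * B))%R).
  { apply Rdiv_lt_0_compat; auto. repeat apply Rmult_lt_0_compat; auto; lra. }
  destruct (heat_exp_energy p t r n Hr _ Hd) as [M0 HM]. exists M0. intros M HMM.
  rewrite <- kern_heat by auto.
  replace eps with (3 * r ^ n * (B * (eps / (3 * r ^ n * B))))%R by (field; lra).
  apply (contour_bound r false n); auto.
  - apply Rmult_lt_0_compat; auto.
  - apply approx_kern; auto using approx_heat.
  - apply approx_kern; auto using approx_exp_energy.
  - intros xi Hxi. set (e := mono n _ xi). set (f := Psi xi w).
    replace (e * (heat p t n M xi * f) - e * (exp_energy p t n xi * f))
      with (- ((e * f) * (exp_energy p t n xi - heat p t n M xi))) by ring.
    rewrite Cmod_opp, Cmod_mult. apply Rmult_le_compat; auto using Cmod_ge_0.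
    apply Hbd; auto.
Qed.

Lemma RtoC_sum_n (a : nat -> R) M : RtoC (sum_n a M) = csum (seq 0 (S M)) (fun m => RtoC (a m)).
Proof.
  induction M as [|M IH].
  - rewrite sum_O. simpl. ring.
  - rewrite sum_Sn, seq_S, csum_app, <- IH. simpl. change (@plus R_AbelianMonoid) with Rplus.
    rewrite RtoC_plus. ring.
Qed.

(** The partial sums are real, so the imaginary part of [l] is bounded by every positive [eps], and
    the real parts converge to [fst l]. *)
Lemma RtoC_Series (a : nat -> R) (l : C) :
  (forall eps, (0 < eps)%R -> exists M0, forall M, (M0 <= M)%nat ->
     (Cmod (csum (seq 0 (S M)) (fun m => RtoC (a m)) - l)%C <= eps)%R) ->
  RtoC (Series a) = l.
Proof.
  intros H.
  assert (Hc : forall eps, (0 < eps)%R -> exists M0, forall M, (M0 <= M)%nat ->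
     (Rabs (sum_n a M - fst l) <= eps)%R /\ (Rabs (snd l) <= eps)%R).
  { intros eps He. destruct (H eps He) as [M0 HM]. exists M0. intros M HMM.
    specialize (HM M HMM). rewrite <- RtoC_sum_n in HM.
    assert (B := Rmax_Cmod (RtoC (sum_n a M) - l)). simpl in B.
    assert (B1 := Rle_trans _ _ _ (Rmax_l _ _) B). assert (B2 := Rle_trans _ _ _ (Rmax_r _ _) B).
    rewrite Rplus_0_l, Rabs_Ropp in B2. unfold Rminus in *. split; lra. }
  assert (Him : snd l = 0%R).
  { apply Rabs_eq_0. apply Rle_antisym; [|apply Rabs_pos]. apply le_epsilon. intros e He.
    destruct (Hc e He) as [M0 HM]. rewrite Rplus_0_l. apply (HM M0). lia. }
  assert (Hre : Series a = fst l).
  { apply is_series_unique. unfold is_series. apply filterlim_locally. intros e.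
    destruct (Hc (e / 2)%R) as [M0 HM]; [generalize (cond_pos e); lra|].
    exists M0. intros M HMM. destruct (HM M HMM) as [B _].
    change (Rabs (sum_n a M - fst l) < e)%R. generalize (cond_pos e); lra. }
  rewrite Hre. destruct l as [x y]. simpl in *. rewrite Him. reflexivity.
Qed.

(** * The radius and the conclusion *)

Lemma small_radius_of_bound p r : (0 < p < 1)%R -> (0 < r)%R ->
  (r < (-1 + sqrt (1 + 4 * p * (1 - p))) / (2 * (1 - p)))%R -> small_radius p r.
Proof.
  intros Hp Hr H. repeat split; try lra.
  set (s := sqrt (1 + 4 * p * (1 - p))) in *.
  assert (Hs : (s * s = 1 + 4 * p * (1 - p))%R) by (apply sqrt_sqrt; nra).
  assert (Hs0 : (0 <= s)%R) by apply sqrt_pos.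
  assert (H1 : (r * (2 * (1 - p)) < -1 + s)%R).
  { replace (-1 + s)%R with ((-1 + s) / (2 * (1 - p)) * (2 * (1 - p)))%R by (field; lra).
    apply Rmult_lt_compat_r; lra. }
  (* With [u = 2 q r + 1] the hypothesis reads [u < s]; squaring and dividing by [4 q] gives
     [q r^2 + r < p]. *)
  set (u := (r * (2 * (1 - p)) + 1)%R).
  assert (H2 : (u * u < s * s)%R) by (assert (0 < u)%R by (unfold u; nra); unfold u in *; nra).
  unfold u in H2. rewrite Hs in H2.
  apply Rmult_lt_reg_l with (4 * (1 - p))%R; [lra|]. nra.
Qed.

Lemma valid_decomp_decomp N dec : (1 <= N)%nat -> valid_decomp N dec -> decomp N dec.
Proof.
  intros HN H s Hs. destruct (H s Hs) as [H1 H2]. split; auto.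
  eapply Forall_impl; [|apply H1]. simpl; intros; lia.
Qed.

Local Close Scope C_scope.

Theorem mainTheorem1 (p : R) (N : nat) (r : R) (Y X : list Z) (t : R)
    (dec : list nat -> list nat) :
  0 < p < 1 ->
  (1 <= N)%nat ->
  0 < r ->
  r < (-1 + sqrt (1 + 4 * p * (1 - p))) / (2 * (1 - p)) ->
  length Y = N -> Sorted Z.lt Y ->
  length X = N -> Sorted Z.lt X ->
  0 <= t ->
  valid_decomp N dec ->
  forall pi nu : list nat, In pi (words N) -> In nu (words N) ->
    RtoC (asep_prob p t (Y, nu) (X, pi)) =
    Cmult (Cinv (pow_n (K := C_Ring) (Cmult (RtoC (2 * PI)) Ci) N))
          (circle_int_n r N (integrand p t N dec X Y pi nu) (fun _ => RtoC 0)).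
Proof.
  intros Hp HN Hr0 Hr HY HYs HX HXs Ht Hdec pi nu Hpi Hnu.
  assert (Hsm := small_radius_of_bound p r Hp Hr0 Hr).
  apply valid_decomp_decomp in Hdec; auto.
  assert (HXi := Sorted_increasing X HXs). assert (HYi := Sorted_increasing Y HYs).
  rewrite HX in HXi. rewrite HY in HYi.
  assert (Hnl : length nu = N) by (apply in_words in Hnu; apply Hnu).
  set (Psi := smono p N dec (fn 0%Z X) (point_mass N pi)).
  assert (HPsi : approx_vec r false N Psi) by (apply approx_smono; auto).
  transitivity (kern r N (exp_energy p t N) Psi (fn 0%Z Y) (fn 0%nat nu)).
  (* The intermediate value is reached from the probability by the exponential series, and from the
     contour integral by the factorisation of the integrand. *)
  - apply RtoC_Series. intros eps He.
    destruct (kern_exp_limit p t r N Psi (fn 0%Z Y) (fn 0%nat nu) Hsm HPsi eps He) as [M0 HM].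
    exists M0. intros M HMM. specialize (HM M HMM).
    rewrite (csum_ext _ _ (fun m => Cmult (RtoC (t ^ m / INR (fact m)))
      (kern r N (fun xi => Cpow (energy p N xi) m) Psi (fn 0%Z Y) (fn 0%nat nu)))); auto.
    intros m _. rewrite RtoC_mult. f_equal. apply Qpow_kern; auto.
  - rewrite Cmult_comm, pow_n_Cpow.
    change (kern r N (exp_energy p t N) Psi (fn 0%Z Y) (fn 0%nat nu) =
            contour r N (integrand p t N dec X Y pi nu)).
    symmetry. apply (contour_ext r false N); auto.
    + apply approx_kern; auto using approx_exp_energy.
    + intros xi Hxi. symmetry. apply (integrand_smono p r); auto.
Qed.
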